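(* There is a distributed algorithm in the LOCAL model, using only polynomial local computation, for the minimum 2-spanner problem that always (deterministically) outputs a 2-spanner of size at most $O(\log\frac{m}{n})$ times the minimum, and terminates within $O(\log n \log \Delta)$ rounds with high probability, where $n$, $m$, $\Delta$ are the number of vertices, number of edges and maximum degree of the input graph.
   Context: For a connected undirected graph $G=(V,E)$, a subgraph $H\subseteq E$ is a 2-spanner if for every edge $\{u,v\}\in E$ there is a path of length at most $2$ between $u$ and $v$ in $H$. The minimum 2-spanner problem asks for a 2-spanner with the minimum number of edges. Distributed setting: the input graph is the communication network; vertices have unique IDs and initially know only their neighbors; computation proceeds in synchronous rounds; each vertex outputs a subset of its incident edges and the union of the outputs is the spanner. In the LOCAL model messages have unbounded size. ''With high probability'' means with probability at least $1-1/n^c$ for a constant $c\geq 1$. *)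

(* Defs.v *)
From HB Require Import structures.
From mathcomp Require Import all_boot all_order all_algebra.
From mathcomp Require Import boolp reals.

Set Implicit Arguments.
Unset Strict Implicit.
Unset Printing Implicit Defensive.

Import Order.TTheory GRing.Theory Num.Theory.

(** ** Graphs and 2-spanners *)

Record sgraph := SGraph {
  vert :> finType;
  adj : rel vert;
  adj_sym : symmetric adj;
  adj_irr : irreflexive adj }.

Section Graph.
Variable G : sgraph.

Definition connected_graph : Prop :=
  0 < #|G| /\ forall u v : G, connect (@adj G) u v.

Definition edges : {set {set G}} :=
  [set [set x.1; x.2] | x : G * G & adj x.1 x.2].

Definition max_degree : nat := \max_(v : G) #|[pred u | adj v u]|.

Definition edge_rel (H : {set {set G}}) : rel G :=
  fun u v => [set u; v] \in H.

Definition two_spanner (H : {set {set G}}) : Prop :=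
  H \subset edges /\
  forall u v : G, [set u; v] \in edges ->
    exists p : seq G, [/\ path (edge_rel H) u p, last u p = v & size p <= 2].

(** The whole edge set is a 2-spanner, so the minimum below ranges over a
    nonempty family. *)
Definition min_two_spanner : nat :=
  #|[arg min_(H < edges | `[< two_spanner H >]) #|H| ]|.

End Graph.

(** ** Local computation

    Jones' WHILE language over binary trees, extended with coin flips.  Every
    evaluated subexpression is charged the full size of its value, so that
    sharing is not free and time also bounds the size of everything that is
    built; polynomial time here is polynomial time on Turing machines. *)

Inductive data := Nil | Cons of data & data.

Definition hd (d : data) : data := if d is Cons a _ then a else Nil.
Definition tl (d : data) : data := if d is Cons _ b then b else Nil.
Definition is_cons (d : data) : bool := if d is Cons _ _ then true else false.

Fixpoint data_eqb (a b : data) : bool :=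
  match a, b with
  | Nil, Nil => true
  | Cons a1 a2, Cons b1 b2 => data_eqb a1 b1 && data_eqb a2 b2
  | _, _ => false
  end.

Fixpoint data_size (d : data) : nat :=
  if d is Cons a b then (data_size a + data_size b).+1 else 1.

Definition of_bool (b : bool) : data := if b then Cons Nil Nil else Nil.
Definition of_seq (s : seq data) : data := foldr Cons Nil s.
Fixpoint to_seq (d : data) : seq data :=
  if d is Cons a b then a :: to_seq b else [::].

Inductive expr :=
| EVar of nat
| ENil
| ECons of expr & expr
| EHd of expr
| ETl of expr
| EEq of expr & expr.

Inductive cmd :=
| CSkip
| CAssign of nat & expr
| CFlip of nat
| CSeq of cmd & cmd
| CIf of expr & cmd & cmd
| CWhile of expr & cmd.

Definition store := nat -> data.

Definition update (s : store) (x : nat) (d : data) : store :=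
  fun y => if y == x then d else s y.

Fixpoint eval (s : store) (e : expr) : data :=
  match e with
  | EVar x => s x
  | ENil => Nil
  | ECons a b => Cons (eval s a) (eval s b)
  | EHd a => hd (eval s a)
  | ETl a => tl (eval s a)
  | EEq a b => of_bool (data_eqb (eval s a) (eval s b))
  end.

Fixpoint eval_cost (s : store) (e : expr) : nat :=
  data_size (eval s e) +
  match e with
  | EVar _ | ENil => 0
  | EHd a | ETl a => eval_cost s a
  | ECons a b | EEq a b => eval_cost s a + eval_cost s b
  end.

(** [exec r c s i k s' j]: on the random tape [r], command [c] started in
    store [s] with the head of the tape at position [i] halts after time [k]
    in store [s'] with the head at position [j]. *)
Inductive exec (r : nat -> bool) :
  cmd -> store -> nat -> nat -> store -> nat -> Prop :=
| XSkip s i : exec r CSkip s i 1 s i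
| XAssign x e s i :
    exec r (CAssign x e) s i (eval_cost s e).+1 (update s x (eval s e)) i
| XFlip x s i :
    exec r (CFlip x) s i 1 (update s x (of_bool (r i))) i.+1
| XSeq c1 c2 s i k1 s1 i1 k2 s2 i2 :
    exec r c1 s i k1 s1 i1 -> exec r c2 s1 i1 k2 s2 i2 ->
    exec r (CSeq c1 c2) s i (k1 + k2).+1 s2 i2
| XIf e c1 c2 s i k s' j :
    exec r (if is_cons (eval s e) then c1 else c2) s i k s' j ->
    exec r (CIf e c1 c2) s i (eval_cost s e + k).+1 s' j
| XWhileF e c s i :
    is_cons (eval s e) = false ->
    exec r (CWhile e c) s i (eval_cost s e).+1 s i
| XWhileT e c s i k1 s1 i1 k2 s2 i2 :
    is_cons (eval s e) ->
    exec r c s i k1 s1 i1 -> exec r (CWhile e c) s1 i1 k2 s2 i2 ->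
    exec r (CWhile e c) s i (eval_cost s e + k1 + k2).+1 s2 i2.

(** Input and output are passed in variable 0. *)
Definition computes_within (c : cmd) (r : nat -> bool) (x y : data) (T : nat)
    : Prop :=
  exists k s j,
    [/\ exec r c (update (fun=> Nil) 0 x) 0 k s j, s 0 = y & k <= T].

(** ** The LOCAL model

    In every round, each running vertex applies the same map to its memory,
    the messages received on its ports, and a fresh random tape; the result
    encodes its new memory, the messages to be sent on its ports, and whether
    it stops, in which case it also gives its output. *)

Definition local_alg := data -> (nat -> bool) -> data.

Record vconf := VConf {
  memory : data;
  outbox : seq data;             (* one message per port *)
  decision : option (seq data)   (* None: running; Some o: stopped *) }.

Definition decode (d : data) : vconf :=
  VConf (hd d) (to_seq (hd (tl d)))
        (if tl (tl d) is Cons _ o then Some (to_seq o) else None).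

Section Local.
Variables (A : local_alg) (G : sgraph) (id : G -> seq bool).

(** [w t v i] is the [i]-th random bit available to [v] in round [t]. *)
Definition coins := nat -> G -> nat -> bool.

(** The ports of [v] are the positions in this sequence.  It depends on the
    enumeration of [G], which is arbitrary. *)
Definition neighbours (v : G) : seq G := enum [pred u | adj v u].

Definition of_id (v : G) : data := of_seq (map of_bool (id v)).

Definition init (v : G) : vconf :=
  VConf (Cons (of_id v) (of_seq (map of_id (neighbours v)))) [::] None.

Definition message (c : G -> vconf) (u v : G) : data :=
  nth Nil (outbox (c u)) (index v (neighbours u)).

Definition local_input (c : G -> vconf) (v : G) : data :=
  Cons (memory (c v)) (of_seq [seq message c u v | u <- neighbours v]).

Definition round (r : G -> nat -> bool) (c : G -> vconf) (v : G) : vconf :=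
  if decision (c v) is Some o then VConf (memory (c v)) [::] (Some o)
  else decode (A (local_input c v) (r v)).

Fixpoint run (w : coins) (t : nat) : G -> vconf :=
  if t is t'.+1 then round (w t') (run w t') else init.

Definition halted (w : coins) (t : nat) (v : G) : bool :=
  isSome (decision (run w t v)).

Definition terminated (t : nat) (w : coins) : bool :=
  [forall v, halted w t v].

(** A stopped vertex selects the edge at each port whose output entry is a
    [Cons]. *)
Definition selects (w : coins) (t : nat) (v u : G) : bool :=
  is_cons (nth Nil (odflt [::] (decision (run w t v)))
                   (index u (neighbours v))).

Definition output (w : coins) (t : nat) : {set {set G}} :=
  [set [set x.1; x.2] | x : G * G & adj x.1 x.2 && selects w t x.1 x.2].

(** Number of vertices plus the length of the longest identifier. *)
Definition instance_size : nat := #|G| + \max_(v : G) size (id v).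

End Local.

(** One program performs the computation of every vertex in every round of
    every execution, within polynomial time in the size of the instance. *)
Definition polynomial_local_computation (A : local_alg) : Prop :=
  exists (c : cmd) (p : {poly nat}),
  forall (G : sgraph) (id : G -> seq bool) (w : coins G) (t : nat) (v : G),
    connected_graph G -> injective id -> ~~ halted A id w t v ->
    let x := local_input (run A id w t) v in
    computes_within c (w t v) x (A x (w t v)) (p.[instance_size id])%R.

(** ** Probability over independent fair coins

    An event determined by finitely many of the coins has as probability the
    proportion of the outcomes of these coins for which it occurs; this does
    not depend on the [K] chosen. *)

Section Probability.
Variable G : sgraph.

Definition agree_upto (K : nat) (w w' : coins G) : Prop :=
  forall t v i, t < K -> i < K -> w t v i = w' t v i.

Definition extend (K : nat) (f : {ffun 'I_K * G * 'I_K -> bool}) : coins G :=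
  fun t v i =>
    if (insub t, insub i) is (Some t', Some i') then f (t', v, i') else false.

Definition has_probability (R : realType) (E : coins G -> bool) (p : R)
    : Prop :=
  exists2 K : nat,
    forall w w', agree_upto K w w' -> E w = E w' &
    p = (#|[set f | E (@extend K f)]|%:R
         / #|{ffun 'I_K * G * 'I_K -> bool}|%:R)%R.

End Probability.

(* Main.v *)
From Pilot Require Import Defs.
From HB Require Import structures.
From mathcomp Require Import all_boot all_order all_algebra.
From mathcomp Require Import boolp reals exp.
From mathcomp Require Import perm.
From mathcomp Require Import zify ring lra.
Import Pilot.Defs.

Set Implicit Arguments.
Unset Strict Implicit.
Unset Printing Implicit Defensive.

Import Order.TTheory GRing.Theory Num.Theory.

(** The spanner is a union of stars.  For a power [k] of two, the [k]-core of a
    vertex [v] is the largest set [S] of neighbours of [v] each of which has at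
    least [k] uncovered edges to [S] and [v]; the level of [v] is the largest
    [k] for which it is not empty, and the star of [v] has this core as leaves.
    In a phase, each end [a] of an uncovered edge votes, among the vertices of
    maximal level in its neighbourhood whose star spans the edge, for the one
    of highest random priority, and a star that gets an eighth of the possible
    votes is bought.

    Size.  Charge a star bought at level [k] to its voters, at most [8 / k]
    each.  Assign every edge to a star of the optimum that spans it.  If [j]
    ordered pairs assigned to a star with [s] leaves are uncovered, then each
    of them votes at a level of at least [j / (4 s)], as otherwise the star
    would contain a core of twice that level; it therefore pays at most
    [40 s / (s + j)], which is at most the drop of [40 s ln (1 + j / s)] per
    covered pair.

    Time.  Cores only shrink.  Let [d e] be the number of stars of the largest
    level [k] that span [e], and let [Phi_k] be the sum of [d e] over uncovered
    [e].  If no priorities collide, [e] votes for each of its [d e] candidates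
    with probability [1 / d e], and [e] and [f] vote for a common candidate
    with probability at least [1 / (d e + d f)]; so [Phi_k] drops by a constant
    factor in expectation, and so does [sum_k W^(log k) Phi_k] when [W] is
    larger than the cube of the number of vertices.  The priorities get longer
    with time, since the number of vertices is not known; ties are broken by
    the identifiers, so that every phase covers an edge. *)

(** * Polynomial-time functions on binary trees *)

(** Cores stand in for densest stars. Feasible sets of a given level are closed under union, so
    there is a greatest one; peeling finds it in polynomial time, and it can only shrink when pairs
    get covered, whereas a densest star may change altogether. This loses a constant factor, since a
    set of leaves that spans enough pairs for twice the level still contains a core. The size bound
    holds for every outcome of the coins: it needs only that priorities are injective and that a
    voter sees every vertex whose star could span its edge. Randomness affects the time alone. There
    the obstacle is that the votes of two pairs for one star are dependent. Being first in two
    candidate sets is the same as being first in their union, which bounds the joint probability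
    from below. The vote of [e] is weighted with [d e]: the weighted votes for a star then have the
    number of its pairs as expectation, and as each pair votes once, the weighted votes for all
    bought stars add up to at most the weight that gets covered. *)

Definition poly_bounded (f : data -> nat) :=
  exists e, forall x, f x <= (data_size x).+1 ^ e.

Lemma data_size_gt0 d : 0 < data_size d.
Proof. by case: d. Qed.

Lemma poly_boundedW f g :
  poly_bounded g -> (forall x, f x <= g x) -> poly_bounded f.
Proof. by move=> [e He] H; exists e => x; apply: leq_trans (H x) (He x). Qed.

Lemma poly_bounded_size : poly_bounded data_size.
Proof. by exists 1 => x; rewrite expn1. Qed.

(** The base [(data_size x).+1] is at least 2, and [n < 2 ^ n]. *)
Lemma poly_bounded_const n : poly_bounded (fun _ => n).
Proof.
exists n => x; apply: leq_trans (ltnW (ltn_expl n (ltnSn 1))) _.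
by case: n => // n; rewrite leq_exp2r // ltnS data_size_gt0.
Qed.

Lemma poly_bounded_add f g :
  poly_bounded f -> poly_bounded g -> poly_bounded (fun x => f x + g x).
Proof.
move=> [a Ha] [b Hb]; exists (maxn a b).+1 => x.
have x1 : 1 < (data_size x).+1 by rewrite ltnS data_size_gt0.
have Ea : f x <= (data_size x).+1 ^ maxn a b.
  by apply: leq_trans (Ha x) _; rewrite leq_exp2l // leq_maxl.
have Eb : g x <= (data_size x).+1 ^ maxn a b.
  by apply: leq_trans (Hb x) _; rewrite leq_exp2l // leq_maxr.
apply: leq_trans (leq_add Ea Eb) _.
by rewrite addnn -mul2n expnS leq_mul.
Qed.

Lemma poly_bounded_mul f g :
  poly_bounded f -> poly_bounded g -> poly_bounded (fun x => f x * g x).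
Proof. by move=> [a Ha] [b Hb]; exists (a + b) => x; rewrite expnD leq_mul. Qed.

Lemma poly_bounded_exp f e :
  poly_bounded f -> poly_bounded (fun x => f x ^ e).
Proof.
move=> Hf; elim: e => [|e IH]; first exact: (poly_bounded_const 1).
by apply: poly_boundedW (poly_bounded_mul Hf IH) _ => x; rewrite expnS.
Qed.

Lemma poly_bounded_comp f (g : data -> data) :
  poly_bounded f -> poly_bounded (fun x => data_size (g x)) ->
  poly_bounded (fun x => f (g x)).
Proof.
move=> [a Ha] Hg; apply: poly_boundedW (fun x => Ha (g x)).
apply: poly_bounded_exp.
by apply: poly_boundedW (poly_bounded_add (poly_bounded_const 1) Hg) _ => x.
Qed.

Ltac poly_bounded_tac :=
  lazymatch goal with
  | |- poly_bounded (fun x => @?f x + @?g x) =>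
      apply: (poly_bounded_add (f := f) (g := g)); poly_bounded_tac
  | |- poly_bounded (fun x => @?f x * @?g x) =>
      apply: (poly_bounded_mul (f := f) (g := g)); poly_bounded_tac
  | |- poly_bounded (fun x => @?f x ^ ?e) =>
      apply: (poly_bounded_exp (f := f) e); poly_bounded_tac
  | |- poly_bounded (fun x => data_size x) => exact: poly_bounded_size
  | |- _ => first [ assumption | exact: poly_bounded_const | idtac ]
  end.

(** The command may use the variables below [N] as scratch space, whatever
    they contain, and leaves the others and the random tape alone. *)
Definition computable (f : data -> data) :=
  exists (c : cmd) (N : nat) (T : data -> nat), 
    [/\ 0 < N, poly_bounded T, poly_bounded (fun x => data_size (f x)) &
     forall r s i, exists k s',
       [/\ exec r c s i k s' i, s' 0 = f (s 0),
           forall y, N <= y -> s' y = s y & k <= T (s 0)]].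

Lemma computable_ext f g : f =1 g -> computable f -> computable g.
Proof. by move=> /funext ->. Qed.

Lemma computable_id : computable (fun x => x).
Proof.
exists CSkip, 1, (fun _ => 1); split=> //.
- exact: poly_bounded_const.
- exact: poly_bounded_size.
- by move=> r s i; exists 1, s; split=> //; constructor.
Qed.

Lemma computable_comp f g :
  computable f -> computable g -> computable (fun x => f (g x)).
Proof.
move=> [cf [Nf [Tf [Nf0 HTf Hf Ef]]]] [cg [Ng [Tg [Ng0 HTg Hg Eg]]]].
exists (CSeq cg cf), (maxn Nf Ng), (fun x => Tg x + Tf (g x) + 1); split.
- by rewrite leq_max Nf0.
- by poly_bounded_tac; exact: poly_bounded_comp.
- exact: (@poly_bounded_comp (fun x => data_size (f x)) g).
- move=> r s i.
  have [k1 [s1 [X1 E1 F1 K1]]] := Eg r s i.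
  have [k2 [s2 [X2 E2 F2 K2]]] := Ef r s1 i.
  exists (k1 + k2).+1, s2; split.
  + by apply: XSeq X1 X2.
  + by rewrite E2 E1.
  + by move=> y; rewrite geq_max => /andP[Y1 Y2]; rewrite F2 // F1.
  + by rewrite E1 in K2; rewrite addn1 ltnS leq_add.
Qed.

Lemma computable_expr (e : expr) (f : data -> data) (T : data -> nat) :
  poly_bounded T -> poly_bounded (fun x => data_size (f x)) ->
  (forall s, eval s e = f (s 0)) -> (forall s, eval_cost s e <= T (s 0)) ->
  computable f.
Proof.
move=> HT Hf Ev Ec; exists (CAssign 0 e), 1, (fun x => T x + 1).
split=> //; first by poly_bounded_tac.
move=> r s i; exists (eval_cost s e).+1, (update s 0 (eval s e)); split.
- exact: XAssign.
- by rewrite /update eqxx.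
- by case.
- by rewrite addn1 ltnS.
Qed.

Lemma data_size_hd d : data_size (hd d) <= data_size d.
Proof. by case: d => //= a b; rewrite ltnW // ltnS leq_addr. Qed.

Lemma data_size_tl d : data_size (tl d) <= data_size d.
Proof. by case: d => //= a b; rewrite ltnW // ltnS leq_addl. Qed.

Lemma computable_hd f : computable f -> computable (fun x => hd (f x)).
Proof.
apply: (computable_comp (f := hd)).
apply: (@computable_expr (EHd (EVar 0)) hd (fun x => data_size x + data_size x))
  => //.
- by poly_bounded_tac.
- exact: poly_boundedW poly_bounded_size data_size_hd.
- by move=> s /=; rewrite addn0 leq_add2r data_size_hd.
Qed.

Lemma computable_tl f : computable f -> computable (fun x => tl (f x)).
Proof.
apply: (computable_comp (f := tl)).
apply: (@computable_expr (ETl (EVar 0)) tl (fun x => data_size x + data_size x))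
  => //.
- by poly_bounded_tac.
- exact: poly_boundedW poly_bounded_size data_size_tl.
- by move=> s /=; rewrite addn0 leq_add2r data_size_tl.
Qed.

Fixpoint expr_of (d : data) : expr :=
  if d is Cons a b then ECons (expr_of a) (expr_of b) else ENil.

Lemma computable_const d : computable (fun _ => d).
Proof.
have E s : eval s (expr_of d) = d by elim: d => //= a -> b ->.
apply: (@computable_expr (expr_of d) _
          (fun _ => eval_cost (fun=> Nil) (expr_of d))) => //.
- exact: poly_bounded_const.
- exact: poly_bounded_const.
- move=> s; rewrite leq_eqVlt; apply/orP; left; apply/eqP.
  elim: d {E} => //= a IHa b IHb; rewrite IHa IHb.
  have E s' d : eval s' (expr_of d) = d by elim: d => //= ? -> ? ->.
  by rewrite !E.
Qed.

Definition unpair (h : data -> data -> data) (z : data) := h (hd z) (tl z).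

Lemma computable_cons f g :
  computable f -> computable g -> computable (fun x => Cons (f x) (g x)).
Proof.
move=> [cf [Nf [Tf [Nf0 HTf Hf Ef]]]] [cg [Ng [Tg [Ng0 HTg Hg Eg]]]].
(* Variables [N] and [N.+1] lie above the scratch space of both commands; they keep the input and
   the first result. *)
set N := maxn Nf Ng.
exists (CSeq (CAssign N (EVar 0)) (CSeq cf (CSeq (CAssign N.+1 (EVar 0))
  (CSeq (CAssign 0 (EVar N)) (CSeq cg (CAssign 0 (ECons (EVar N.+1) (EVar 0)))))))),
  N.+2, (fun x => Tf x + Tg x + 2 * data_size x + 3 * data_size (f x) + 2 *
    data_size (g x) + 20).
split=> //; first by poly_bounded_tac.
  by apply: poly_boundedW (poly_bounded_add (poly_bounded_add Hf Hg)
    (poly_bounded_const 1)) _ => x /=; rewrite addn1.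
move=> r s i.
have N0 : (0 == N) = false by rewrite /N; lia.
pose s1 := update s N (s 0).
have [k2 [s2 [X2 E2 F2 K2]]] := Ef r s1 i.
pose s3 := update s2 N.+1 (s2 0).
pose s4 := update s3 0 (s3 N).
have [k5 [s5 [X5 E5 F5 K5]]] := Eg r s4 i.
have e1 : s1 0 = s 0 by rewrite /s1 /update N0.
have e2 : s2 N = s 0 by rewrite F2 ?leq_maxl // /s1 /update eqxx.
have e4 : s4 0 = s 0.
  rewrite /s4 /update eqxx /s3 /update.
  by rewrite (_ : (N == N.+1) = false) ?e2 //; lia.
have e5 : s5 N.+1 = f (s 0).
  rewrite F5; last by rewrite /N; lia.
  by rewrite /s4 /s3 /update /= eqxx E2 e1.
do 2!eexists; split.
- apply: XSeq; first exact: XAssign.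
  apply: XSeq; first exact: X2.
  apply: XSeq; first exact: XAssign.
  apply: XSeq; first exact: XAssign.
  apply: XSeq; first exact: X5.
  exact: XAssign.
- by rewrite /update eqxx /= e5 E5 e4.
- move=> y Hy; rewrite /update (_ : (y == 0) = false); last by lia.
  rewrite F5; last by rewrite /N in Hy; lia.
  rewrite /s4 /s3 /update (_ : (y == 0) = false); last by lia.
  rewrite (_ : (y == N.+1) = false); last by lia.
  rewrite F2; last by rewrite /N in Hy; lia.
  by rewrite /s1 /update (_ : (y == N) = false); last by lia.
- rewrite e1 in E2 K2; rewrite e4 in E5 K5.
  have e3 : s3 N = s 0.
    by rewrite /s3 /update (_ : (N == N.+1) = false) ?e2 //; lia.
  cbn [eval eval_cost data_size].
  by rewrite -/s3 E2 e3 e5 E5 /=; lia.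
Qed.

Lemma computable_pair2 (h : data -> data -> data) f g :
  computable (unpair h) -> computable f -> computable g ->
  computable (fun x => h (f x) (g x)).
Proof.
by move=> Hh Hf Hg; exact: (computable_comp Hh (computable_cons Hf Hg)).
Qed.

Definition computableb (b : data -> bool) := computable (fun x => of_bool (b x)).

Lemma data_size_of_bool b : data_size (of_bool b) <= 3.
Proof. by case: b. Qed.

Lemma computableb_eq f g : computable f -> computable g ->
  computableb (fun x => data_eqb (f x) (g x)).
Proof.
apply: (@computable_pair2 (fun a b => of_bool (data_eqb a b))).
apply: (@computable_expr (EEq (EHd (EVar 0)) (ETl (EVar 0))) _ (fun x =>
  3 + 4 * data_size x)) => //.
- by poly_bounded_tac.
- by apply: poly_boundedW (poly_bounded_const 3) _ => x; exact: data_size_of_bool.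
- move=> s /=; have := data_size_hd (s 0); have := data_size_tl (s 0).
  have := data_size_of_bool (data_eqb (hd (s 0)) (tl (s 0))); lia.
Qed.

Lemma computable_if b f g : computableb b -> computable f -> computable g ->
  computable (fun x => if b x then f x else g x).
Proof.
move=> [cb [Nb [Tb [Nb0 HTb _ Eb]]]].
move=> [cf [Nf [Tf [Nf0 HTf Hf Ef]]]] [cg [Ng [Tg [Ng0 HTg Hg Eg]]]].
set N := maxn Nb (maxn Nf Ng).
exists (CSeq (CAssign N (EVar 0)) (CSeq cb (CSeq (CAssign N.+1 (EVar 0))
  (CSeq (CAssign 0 (EVar N)) (CIf (EVar N.+1) cf cg))))),
  N.+2, (fun x => Tb x + Tf x + Tg x + 2 * data_size x + 30).
split=> //; first by poly_bounded_tac.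
  by apply: poly_boundedW (poly_bounded_add Hf Hg) _ => x; case: (b x); lia.
move=> r s i.
have N0 : (0 == N) = false by rewrite /N; lia.
pose s1 := update s N (s 0).
have [k2 [s2 [X2 E2 F2 K2]]] := Eb r s1 i.
pose s3 := update s2 N.+1 (s2 0).
pose s4 := update s3 0 (s3 N).
have e1 : s1 0 = s 0 by rewrite /s1 /update N0.
have e2 : s2 N = s 0 by rewrite F2 ?leq_maxl // /s1 /update eqxx.
have e3 : s3 N = s 0.
  by rewrite /s3 /update (_ : (N == N.+1) = false) ?e2 //; lia.
have e4 : s4 0 = s 0 by rewrite /s4 /update eqxx.
have e5 : s4 N.+1 = of_bool (b (s 0)).
  by rewrite /s4 /s3 /update /= eqxx E2 e1.
have [k5 [s5 [X5 E5 F5 K5]]] : exists k s',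
  [/\ exec r (if b (s 0) then cf else cg) s4 i k s' i,
    s' 0 = (if b (s 0) then f (s 0) else g (s 0)), forall y, N <= y ->
      s' y = s4 y & k <= Tf (s 0) + Tg (s 0)].
  case: (b (s 0)).
    have [k [s' [X E F K]]] := Ef r s4 i; exists k, s'; rewrite -e4; split=> //;
      last by lia.
    by move=> y Hy; rewrite F //; move: Hy; rewrite /N; lia.
  have [k [s' [X E F K]]] := Eg r s4 i; exists k, s'; rewrite -e4; split=> //;
    last by lia.
  by move=> y Hy; rewrite F //; move: Hy; rewrite /N; lia.
do 2!eexists; split.
- apply: XSeq; first exact: XAssign.
  apply: XSeq; first exact: X2.
  apply: XSeq; first exact: XAssign.
  apply: XSeq; first exact: XAssign.
  apply: XIf; rewrite [is_cons _](_ : _ = b (s 0)); first exact: X5.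
  by change (is_cons (s4 N.+1) = b (s 0)); rewrite e5; case: (b _).
- by [].
- move=> y Hy; rewrite F5; last by lia.
  rewrite /s4 /s3 /update (_ : (y == 0) = false); last by lia.
  rewrite (_ : (y == N.+1) = false); last by lia.
  rewrite F2; last by move: Hy; rewrite /N; lia.
  by rewrite /s1 /update (_ : (y == N) = false); last by lia.
- rewrite e1 in E2 K2.
  cbn [eval eval_cost data_size]. rewrite -/s3 -/s4.
  have := data_size_of_bool (b (s 0)).
  by rewrite E2 e3 e5; lia.
Qed.

(** * Lists encoded as trees, and loops over them *)

Lemma of_seqK : cancel of_seq to_seq.
Proof. by elim=> //= a s ->. Qed.

Lemma to_seqK : cancel to_seq of_seq.
Proof. by elim=> //= a _ b ->. Qed.

Lemma data_size_of_seq_cat s t :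
  (data_size (of_seq (s ++ t))).+1 = data_size (of_seq s) + data_size (of_seq t).
Proof. by elim: s => //= a s IH; lia. Qed.

Lemma size_le_data_size s : size s < data_size (of_seq s).
Proof. by elim: s => //= a s; lia. Qed.

Lemma data_size_filter s (P : data -> bool) :
  data_size (of_seq (filter P s)) <= data_size (of_seq s).
Proof. by elim: s => //= a s IH; case: (P a) => /=; lia. Qed.

(* The loop keeps the input in [N] and the rest of the list in [N.+1]. *)
Lemma computable_foldl (g : data -> data -> data -> data) i l (B : data -> nat) :
  computable (fun z => g (hd z) (hd (tl z)) (tl (tl z))) -> computable i ->
  computable (fun x => of_seq (l x)) -> poly_bounded B ->
  (forall x s1 s2, l x = s1 ++ s2 -> data_size (foldl (g x) (i x) s1) <= B x) ->
  computable (fun x => foldl (g x) (i x) (l x)).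
Proof.
move=> [cg [Ng [Tg [Ng0 [e HTg] _ Eg]]]] Ci Cl HB BP.
have [ch [Nh [Th [Nh0 HTh Hh Eh]]]] :=
  computable_cons computable_id (computable_cons Ci Cl).
set N := maxn Nh Ng.
set body := CSeq (CAssign 0 (ECons (EVar N) (ECons (EVar 0) (EHd (EVar N.+1)))))
  (CSeq (CAssign N.+1 (ETl (EVar N.+1))) cg).
(* [D] bounds the size of whatever the body handles, thanks to the bound [B] on all intermediate
   accumulators, and also the number of iterations; [C] bounds the time of one iteration. *)
pose D x := data_size (Cons x (Cons (i x) (of_seq (l x)))) + B x + 3.
pose C x := D x ^ e + 20 * D x + 20.
have HD : poly_bounded D by rewrite /D; poly_bounded_tac.
have loop x r : forall s2 s1 s p, l x = s1 ++ s2 -> s N = x -> s N.+1 = of_seq s2 ->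
  s 0 = foldl (g x) (i x) s1 ->
  exists k s', [/\ exec r (CWhile (EVar N.+1) body) s p k s' p,
     s' 0 = foldl (g x) (i x) (l x), forall y, N.+2 <= y -> s' y = s y &
     k <= size s2 * C x + 2].
  elim=> [|a s2 IH] s1 s p El EN EN1 E0.
    exists (eval_cost s (EVar N.+1)).+1, s; split=> //.
    - by apply: XWhileF; rewrite /= EN1.
    - by rewrite El cats0.
    - by rewrite /= EN1.
  pose s3 := update s 0 (Cons x (Cons (s 0) a)).
  pose s4 := update s3 N.+1 (of_seq s2).
  have [k5 [s5 [X5 E5 F5 K5]]] := Eg r s4 p.
  have e4 : s4 0 = Cons x (Cons (s 0) a) by rewrite /s4 /s3 /update.
  have s5N : s5 N = x.
    rewrite F5; last by rewrite /N; lia.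
    rewrite /s4 /s3 /update (_ : (N == N.+1) = false); last by lia.
    by rewrite (_ : (N == 0) = false) //; rewrite /N; lia.
  have s5N1 : s5 N.+1 = of_seq s2.
    rewrite F5; last by rewrite /N; lia.
    by rewrite /s4 /update eqxx.
  have s50 : s5 0 = foldl (g x) (i x) (rcons s1 a).
    by rewrite E5 e4 /= E0 -cats1 foldl_cat.
  have El' : l x = rcons s1 a ++ s2 by rewrite El cat_rcons.
  have [k6 [s6 [X6 E6 F6 K6]]] := IH _ _ p El' s5N s5N1 s50.
  do 2!eexists; split.
  - apply: XWhileT; last exact: X6; first by rewrite /= EN1.
    apply: XSeq; first exact: XAssign.
    apply: XSeq; first exact: XAssign.
    cbn [eval]; rewrite EN EN1 /= -/s3.
    have -> : s3 N.+1 = of_seq (a :: s2) by rewrite -EN1 /s3 /update.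
    exact: X5.
  - by [].
  - move=> y Hy; rewrite F6 // F5; last by move: Hy; rewrite /N; lia.
    rewrite /s4 /s3 /update (_ : (y == N.+1) = false); last by lia.
    by rewrite (_ : (y == 0) = false) //; lia.
  - cbn [eval eval_cost data_size]; rewrite EN EN1 /= -/s3.
    have -> : s3 N.+1 = of_seq (a :: s2) by rewrite -EN1 /s3 /update.
    move: K5; rewrite e4 => K5.
    have {}BP := BP x s1 (a :: s2) El.
    have Hl : data_size (of_seq (a :: s2)) <= data_size (of_seq (l x)).
      by have := data_size_of_seq_cat s1 (a :: s2); rewrite -El;
        have := data_size_gt0 (of_seq s1); lia.
    have HK : Tg (Cons x (Cons (s 0) a)) <= D x ^ e.
      apply: leq_trans (HTg _) _; case: (e) => // e'; rewrite leq_exp2r //.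
      move: BP Hl; rewrite /D -E0 /=; lia.
    move: Hl BP; rewrite -E0 => Hl BP.
    have Hx : data_size x + data_size (s 0) + data_size (of_seq (a :: s2)) +
      3 <= D x.
      by rewrite /D /=; move: Hl; rewrite /=; lia.
    move: Hx; rewrite /= => Hx.
    have EC : C x = D x ^ e + 20 * D x + 20 by [].
    by rewrite mulSn; lia.
exists (CSeq ch (CSeq (CAssign N (EHd (EVar 0)))
  (CSeq (CAssign N.+1 (ETl (ETl (EVar 0))))
  (CSeq (CAssign 0 (EHd (ETl (EVar 0)))) (CWhile (EVar N.+1) body))))),
  N.+2, (fun x => Th x + D x * C x + 20 * D x + 20).
split=> //.
- by rewrite /C; poly_bounded_tac.
- by apply: poly_boundedW HB _ => x; apply: (BP _ _ [::]); rewrite cats0.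
move=> r s p.
have [k1 [s1 [X1 E1 F1 K1]]] := Eh r s p.
pose s2 := update s1 N (s 0).
pose s3 := update s2 N.+1 (of_seq (l (s 0))).
pose s4 := update s3 0 (i (s 0)).
have s20 : s2 0 = s1 0 by rewrite /s2 /update (_ : (0 == N) = false) //;
  rewrite /N; lia.
have s30 : s3 0 = s1 0 by rewrite /s3 /update.
have [||||k5 [s5 [X5 E5 F5 K5]]] := loop (s 0) r (l (s 0)) [::] s4 p.
- by [].
- rewrite /s4 /s3 /s2 /update (_ : (N == N.+1) = false) ?eqxx; last by lia.
  by rewrite (_ : (N == 0) = false) //; rewrite /N; lia.
- by rewrite /s4 /s3 /update /= eqxx.
- by rewrite /s4 /update.
do 2!eexists; split.
- apply: XSeq; first exact: X1.
  apply: XSeq; first exact: XAssign.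
  apply: XSeq; first exact: XAssign.
  apply: XSeq; first exact: XAssign.
  cbn [eval]; rewrite E1 /= -/s2 s20 E1 /= -/s3 s30 E1 /= -/s4; exact: X5.
- by [].
- move=> y Hy; rewrite F5 // /s4 /s3 /s2 /update.
  rewrite (_ : (y == 0) = false); last by lia.
  rewrite (_ : (y == N.+1) = false); last by lia.
  rewrite (_ : (y == N) = false); last by lia.
  by rewrite F1 //; move: Hy; rewrite /N; lia.
- cbn [eval eval_cost data_size]; rewrite E1 /= -/s2 s20 E1 /= -/s3 s30 E1 /=.
  have Hsz : size (l (s 0)) <= D (s 0).
    by have := size_le_data_size (l (s 0)); rewrite /D /=; lia.
  have : size (l (s 0)) * C (s 0) <= D (s 0) *
    C (s 0) by rewrite leq_mul2r Hsz orbT.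
  have : data_size (s 0) + data_size (i (s 0)) + data_size (of_seq (l (s 0))) +
    5 <= D (s 0).
    by rewrite /D /=; lia.
  lia.
Qed.

Definition computables (s : data -> seq data) := computable (fun x => of_seq (s x)).

Lemma computables_to_seq f : computable f -> computables (fun x => to_seq (f x)).
Proof. by apply: computable_ext => x; rewrite to_seqK. Qed.

Lemma computables_nil : computables (fun _ => [::]).
Proof. exact: (computable_const Nil). Qed.

Lemma computables_cons f s : computable f -> computables s ->
  computables (fun x => f x :: s x).
Proof. exact: computable_cons. Qed.

Lemma computableb_is_cons f : computable f -> computableb (fun x => is_cons (f x)).
Proof.
move=> Hf; have := computableb_eq Hf (computable_const Nil).
move=> /computable_if /(_ (computable_const Nil) (computable_const (Cons Nil Nil))).
by apply: computable_ext => x; case: (f x).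
Qed.

Lemma computableb_const b : computableb (fun _ => b).
Proof. exact: computable_const. Qed.

Lemma computableb_if b c d : computableb b -> computableb c -> computableb d ->
  computableb (fun x => if b x then c x else d x).
Proof.
move=> Hb Hc Hd; apply: computable_ext (computable_if Hb Hc Hd) => x.
by case: (b x).
Qed.

Lemma computableb_neg b : computableb b -> computableb (fun x => ~~ b x).
Proof.
by move=> Hb; exact: (computableb_if Hb (computableb_const false)
  (computableb_const true)).
Qed.

Lemma computableb_and b c : computableb b -> computableb c ->
  computableb (fun x => b x && c x).
Proof.
by move=> Hb Hc; exact: (computableb_if Hb Hc (computableb_const false)).
Qed.

Lemma computableb_or b c : computableb b -> computableb c ->
  computableb (fun x => b x || c x).
Proof. by move=> Hb Hc; exact: (computableb_if Hb (computableb_const true) Hc). Qed.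

Lemma computables_if b s t : computableb b -> computables s -> computables t ->
  computables (fun x => if b x then s x else t x).
Proof.
move=> Hb Hs Ht; apply: computable_ext (computable_if Hb Hs Ht) => x.
by case: (b x).
Qed.

Lemma foldl_Cons s d : foldl (fun acc a => Cons a acc) d s =
  of_seq (catrev s (to_seq d)).
Proof. by elim: s d => [|a s IH] d /=; rewrite ?to_seqK // IH. Qed.

Lemma data_size_catrev s t :
  (data_size (of_seq (catrev s t))).+1 = data_size (of_seq s) +
    data_size (of_seq t).
Proof. by elim: s t => //= a s IH t; rewrite IH /=; lia. Qed.

Lemma computable_poly_bounded f : computable f ->
  poly_bounded (fun x => data_size (f x)).
Proof. by case=> c [N [T []]]. Qed.

Lemma computables_rev s : computables s -> computables (fun x => rev (s x)).
Proof.
move=> Hs; apply: (computable_ext (f := fun x =>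
  foldl (fun acc a => Cons a acc) Nil (s x))).
  by move=> x; rewrite foldl_Cons.
apply: (computable_foldl (g := fun _ acc a => Cons a acc) _ _ Hs).
- by apply: computable_cons;
    [do 2!apply: computable_tl | apply: computable_hd; apply: computable_tl];
    exact: computable_id.
- exact: computable_const.
- exact: (computable_poly_bounded Hs).
- move=> x s1 s2 /= ->; rewrite foldl_Cons.
  have := data_size_catrev s1 (to_seq Nil); have := data_size_of_seq_cat s1 s2.
  by have := data_size_gt0 (of_seq s2) => /=; lia.
Qed.

Lemma computables_cat s t : computables s -> computables t ->
  computables (fun x => s x ++ t x).
Proof.
move=> Hs Ht; apply: (computable_ext (f := fun x =>
  foldl (fun acc a => Cons a acc) (of_seq (t x)) (rev (s x)))).
  by move=> x; rewrite foldl_Cons of_seqK catrevE revK.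
apply: (computable_foldl (g := fun _ acc a =>
  Cons a acc) _ Ht (computables_rev Hs)).
- by apply: computable_cons;
    [do 2!apply: computable_tl | apply: computable_hd; apply: computable_tl];
    exact: computable_id.
- exact: (poly_bounded_add (computable_poly_bounded (computables_rev Hs))
    (computable_poly_bounded Ht)).
- move=> x s1 s2 /= ->; rewrite foldl_Cons of_seqK.
  have := data_size_catrev s1 (t x); have := data_size_of_seq_cat s1 s2.
  by have := data_size_gt0 (of_seq s2) => /=; lia.
Qed.

Lemma data_size_mem_seq a s1 s2 : 
  data_size a <= data_size (of_seq (s1 ++ a :: s2)).
Proof.
by have /= := data_size_of_seq_cat s1 (a :: s2);
  have := data_size_gt0 (of_seq s1); lia.
Qed.

(** Folding over the reversed list lets each piece be put in front of those already collected. *)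
Lemma computables_flatmap (g : data -> data -> seq data) l :
  computables (fun z => g (hd z) (tl z)) -> computables l ->
  computables (fun x => flatten [seq g x y | y <- l x]).
Proof.
move=> Hg Hl.
have E x s : foldl (fun acc y => of_seq (g x y ++ to_seq acc)) Nil s = 
   of_seq (flatten [seq g x y | y <- rev s]).
  elim/last_ind: s => // s a IH.
  by rewrite -cats1 foldl_cat /= IH of_seqK rev_cat.
apply: (computable_ext (f := fun x =>
  foldl (fun acc y => of_seq (g x y ++ to_seq acc)) Nil (rev (l x)))).
  by move=> x; rewrite E revK.
have [e He] := computable_poly_bounded Hg.
have Hl' := computable_poly_bounded (computables_rev Hl).
have Bd : poly_bounded (fun x => 1 + data_size (of_seq (rev (l x))) * 
    (data_size x + data_size (of_seq (rev (l x))) + 2) ^ e).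
  apply: poly_bounded_add; first exact: poly_bounded_const.
  apply: (poly_bounded_mul Hl'); apply: poly_bounded_exp.
  apply: poly_bounded_add; last exact: poly_bounded_const.
  exact: (poly_bounded_add poly_bounded_size Hl').
apply: (computable_foldl (g := fun x acc y =>
  of_seq (g x y ++ to_seq acc)) _ _ (computables_rev Hl) Bd).
- apply: computables_cat.
    apply: (computable_pair2 (h := fun a b => of_seq (g a b))) => //.
      by apply: computable_hd; exact: computable_id.
    by do 2!apply: computable_tl; exact: computable_id.
  by apply: computables_to_seq; apply: computable_hd; apply: computable_tl;
    exact: computable_id.
- exact: computable_const.
- move=> x s1 s2 Ex.
  set M := _ ^ e.
  have HM : forall a t1 t2, rev (l x) = t1 ++ a :: t2 ->
    data_size (of_seq (g x a)) <= M.
    move=> a t1 t2 El.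
    have := He (Cons x a) => /= /leq_trans; apply.
    rewrite /M; case: (e) => // e'; rewrite leq_exp2r // El.
    by have := data_size_mem_seq a t1 t2; lia.
  apply: (@leq_trans (1 + size s1 * M)).
    elim/last_ind: s1 s2 Ex => [|s1 a IH] s2 Ex //.
    rewrite -cats1 foldl_cat /= size_cat /= addn1 mulSn.
    rewrite cat_rcons in Ex.
    have := IH _ Ex; set d := foldl _ _ _ => Hd.
    have := data_size_of_seq_cat (g x a) (to_seq d); rewrite to_seqK.
    by have := HM _ _ _ Ex; lia.
  rewrite leq_add2l leq_mul2r; apply/orP; right.
  rewrite Ex; have := data_size_of_seq_cat s1 s2; have := size_le_data_size s1.
  by have := data_size_gt0 (of_seq s2); lia.
Qed.

Lemma computables_map (g : data -> data -> data) l :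
  computable (fun z => g (hd z) (tl z)) -> computables l ->
  computables (fun x => [seq g x y | y <- l x]).
Proof.
move=> Hg Hl.
apply: (computable_ext (f := fun x =>
  of_seq (flatten [seq [:: g x y] | y <- l x]))).
  by move=> x; congr of_seq; elim: (l x) => //= a s ->.
by apply: computables_flatmap => //; apply: computables_cons => //;
  exact: computables_nil.
Qed.

Lemma computables_filter (p : data -> data -> bool) l :
  computableb (fun z => p (hd z) (tl z)) -> computables l ->
  computables (fun x => [seq y <- l x | p x y]).
Proof.
move=> Hp Hl.
apply: (computable_ext (f := fun x =>
  of_seq (flatten [seq (if p x y then [:: y] else [::]) | y <- l x]))).
  by move=> x; congr of_seq; elim: (l x) => //= a s ->; case: (p x a).
apply: (computables_flatmap (g := fun x y => if p x y then [:: y] else [::])) => //.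
apply: computables_if => //; last exact: computables_nil.
by apply: computables_cons; [apply: computable_tl;
  exact: computable_id|exact: computables_nil].
Qed.

Lemma computableb_has (p : data -> data -> bool) l :
  computableb (fun z => p (hd z) (tl z)) -> computables l ->
  computableb (fun x => has (p x) (l x)).
Proof.
move=> Hp Hl; apply: computable_ext
  (computableb_is_cons (computables_filter Hp Hl)) => x /=.
by congr of_bool; elim: (l x) => //= a s; case: (p x a).
Qed.

Lemma computableb_all (p : data -> data -> bool) l :
  computableb (fun z => p (hd z) (tl z)) -> computables l ->
  computableb (fun x => all (p x) (l x)).
Proof.
move=> Hp Hl; apply: computable_ext
  (computableb_neg (computableb_has (p := fun x y =>
  ~~ p x y) (computableb_neg Hp) Hl)) => x /=.
by congr of_bool; rewrite has_predC negbK.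
Qed.

Lemma computableb_leq_size s t : computables s -> computables t ->
  computableb (fun x => size (s x) <= size (t x)).
Proof.
move=> Hs Ht.
have E d u : foldl (fun acc _ => tl acc) d u = of_seq (drop (size u) (to_seq d)).
  elim: u d => [|a u IH] d /=; first by rewrite drop0 to_seqK.
  by rewrite IH; case: d.
(* One entry of [Nil :: t x] is dropped for each entry of [s x]; the extra [Nil] is what remains
   when the lengths are equal. *)
apply: (computable_ext (f := fun x =>
  of_bool (is_cons (foldl (fun acc _ => tl acc) (of_seq (Nil :: t x)) (s x))))).
  move=> x; rewrite E of_seqK; congr of_bool.
  by rewrite (_ : is_cons _ = (0 < size (drop (size (s x)) (Nil :: t x))));
    [rewrite size_drop subn_gt0 | case: drop].
apply: computableb_is_cons.
apply: (computable_foldl (g := fun _ acc _ => tl acc) _ _ Hs).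
- by apply: computable_tl; apply: computable_hd; apply: computable_tl;
    exact: computable_id.
- exact: (computables_cons (computable_const Nil) Ht).
- exact: (computable_poly_bounded (computables_cons (computable_const Nil) Ht)).
- move=> x s1 s2 _; elim/last_ind: s1 => // s1 a IH.
  rewrite -cats1 foldl_cat /=; exact: leq_trans (data_size_tl _) IH.
Qed.

(** The bound [B] on the intermediate values is essential: a polynomial-time step that doubles its
    argument has exponential iterates. *)
Lemma computable_iter (g : data -> data -> data) i n (B : data -> nat) :
  computable (fun z => g (hd z) (tl z)) -> computable i -> computables n ->
  poly_bounded B -> (forall x j, j <= size (n x) ->
    data_size (iter j (g x) (i x)) <= B x) ->
  computable (fun x => iter (size (n x)) (g x) (i x)).
Proof.
move=> Hg Hi Hn HB BP.
have E x u : foldl (fun acc _ => g x acc) (i x) u = iter (size u) (g x) (i x).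
  by elim/last_ind: u => // u a IH; rewrite -cats1 foldl_cat /= IH size_cat addn1.
apply: (computable_ext (f := fun x => foldl (fun acc _ => g x acc) (i x) (n x))).
  by move=> x; rewrite E.
apply: (computable_foldl (g := fun x acc _ => g x acc) _ Hi Hn HB).
  apply: (computable_pair2 (h := g)) => //.
    by apply: computable_hd; exact: computable_id.
  by apply: computable_hd; apply: computable_tl; exact: computable_id.
by move=> x s1 s2 Es; rewrite E BP // Es size_cat leq_addr.
Qed.

Ltac computable_step :=
  lazymatch goal with
  | |- computable (fun x => x) => exact: computable_id
  | |- computable hd => exact: (computable_hd computable_id)
  | |- computable tl => exact: (computable_tl computable_id)
  | |- computable (fun x => Cons (@?f x) (@?g x)) =>
      apply: (computable_cons (f := f) (g := g)); cbv beta
  | |- computable (fun x => hd (@?f x)) => apply: (computable_hd (f := f)); cbv beta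
  | |- computable (fun x => tl (@?f x)) => apply: (computable_tl (f := f)); cbv beta
  | |- computable (fun x => of_seq (@?s x)) => change (computables s)
  | |- computable (fun x => of_bool (@?b x)) => change (computableb b)
  | |- computable (fun x => if _ then _ else _) => apply: computable_if
  | |- computables (fun x => to_seq (@?f x)) =>
      apply: (computables_to_seq (f := f)); cbv beta
  | |- computables (fun x => nil) => exact: computables_nil
  | |- computables (fun x => cons (@?f x) (@?s x)) =>
      apply: (computables_cons (f := f) (s := s)); cbv beta
  | |- computables (fun x => (@?s x) ++ (@?t x)) =>
      apply: (computables_cat (s := s) (t := t)); cbv beta
  | |- computables (fun x => rev (@?s x)) =>
      apply: (computables_rev (s := s)); cbv beta
  | |- computables (fun x => flatten (map (@?g x) (@?l x))) =>
      apply: (computables_flatmap (g := g) (l := l)); cbv beta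
  | |- computables (fun x => map (@?g x) (@?l x)) =>
      apply: (computables_map (g := g) (l := l)); cbv beta
  | |- computables (fun x => filter (@?p x) (@?l x)) =>
      apply: (computables_filter (p := p) (l := l)); cbv beta
  | |- computables (fun x => if _ then _ else _) => apply: computables_if
  | |- computableb (fun x => data_eqb (@?f x) (@?g x)) =>
      apply: (computableb_eq (f := f) (g := g)); cbv beta
  | |- computableb (fun x => is_cons (@?f x)) =>
      apply: (computableb_is_cons (f := f)); cbv beta
  | |- computableb (fun x => ~~ (@?b x)) =>
      apply: (computableb_neg (b := b)); cbv beta
  | |- computableb (fun x => (@?b x) && (@?c x)) =>
      apply: (computableb_and (b := b) (c := c)); cbv beta
  | |- computableb (fun x => (@?b x) || (@?c x)) =>
      apply: (computableb_or (b := b) (c := c)); cbv beta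
  | |- computableb (fun x => has (@?p x) (@?l x)) =>
      apply: (computableb_has (p := p) (l := l)); cbv beta
  | |- computableb (fun x => all (@?p x) (@?l x)) =>
      apply: (computableb_all (p := p) (l := l)); cbv beta
  | |- computableb (fun x => size (@?s x) <= size (@?t x)) =>
      apply: (computableb_leq_size (s := s) (t := t)); cbv beta
  | |- computableb (fun x => if _ then _ else _) => apply: computableb_if
  | |- computable _ => first [assumption | exact: computable_const]
  | |- computables _ => assumption
  | |- computableb _ => first [assumption | exact: computableb_const]
  end.
Ltac computable_tac := repeat computable_step.

Fixpoint dlexle (s t : seq data) : bool :=
  match s, t with
  | [::], _ => true
  | _ :: _, [::] => false
  | a :: s', b :: t' => if data_eqb a b then dlexle s' t' else is_cons b
  end.

Lemma computableb_dlexle s t : computables s -> computables t ->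
  computableb (fun x => dlexle (s x) (t x)).
Proof.
move=> Hs Ht.
(* The fold is an automaton. Its state is [Cons Nil rest] while the two lists agree, [rest] being
   unread in the second one, and [Cons (Cons Nil answer) Nil] once the comparison is decided. *)
pose step acc y := if is_cons (hd acc) then acc else
  if is_cons (tl acc) then
    if data_eqb y (hd (tl acc)) then Cons Nil (tl (tl acc))
    else Cons (Cons Nil (of_bool (is_cons (hd (tl acc))))) Nil
  else Cons (Cons Nil Nil) Nil.
pose res st := if is_cons (hd st) then is_cons (tl (hd st)) else true.
have E u v : res (foldl step (Cons Nil (of_seq v)) u) = dlexle u v.
  have D b w : foldl step (Cons (Cons Nil b) Nil) w = Cons (Cons Nil b) Nil.
    by elim: w.
  elim: u v => [|a u IH] [|b v] //=; rewrite /step /=; rewrite -/step ?D //.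
  by case: data_eqb; rewrite ?IH // D /res /=; case: (is_cons b).
apply: (computable_ext (f := fun x =>
  of_bool (res (foldl step (Cons Nil (of_seq (t x))) (s x))))).
  by move=> x; rewrite E.
suff H : computable (fun x => foldl step (Cons Nil (of_seq (t x))) (s x)).
  by rewrite /res; computable_tac.
apply: (computable_foldl (g := fun _ => step) _ _ Hs (B := fun x =>
  data_size (of_seq (t x)) + 10)).
- rewrite /step; computable_tac.
- by computable_tac.
- by apply: poly_bounded_add (poly_bounded_const _); exact: computable_poly_bounded.
- move=> x s1 s2 _; elim/last_ind: s1 => [|s1 a IH] /=; first by lia.
  rewrite -cats1 foldl_cat /= {1}/step; set d := foldl _ _ _ in IH *.
  case: ifP => // _; case: ifP => _ //; last by rewrite /=; lia.
  have := data_size_tl (tl d); have := data_size_tl d.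
  case: ifP => _ /=; last by have := data_size_of_bool (is_cons (hd (tl d))); lia.
  by case: (d) IH => [|? [|? ?]] /=; lia.
Qed.

(** * The algorithm *)

Definition dmem (a : data) (s : seq data) := has (data_eqb a) s.

(** An entry [u] of [S] is the pair of an identifier and its uncovered
    neighbours. *)
Definition dpeel (v : data) (k S : seq data) : seq data :=
  [seq u <- S |
    size k <= size [seq b <- to_seq (tl u) | dmem b (v :: map hd S)]].

(** Only the length of [n] matters, as a unary number of peeling rounds. *)
Definition dcore (v : data) (k n S : seq data) : seq data :=
  to_seq (iter (size n) (fun d => of_seq (dpeel v k (to_seq d))) (of_seq S)).

(** Levels are unary, so appending a level to itself doubles it. The next core is peeled out of the
    current one, because cores of higher level lie inside those of lower level. *)
Definition dgrow (v : data) (n : seq data) (d : data) : data :=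
  let c := dcore v (to_seq (hd d) ++ to_seq (hd d)) n (to_seq (tl d)) in
  if is_cons (of_seq c)
  then Cons (of_seq (to_seq (hd d) ++ to_seq (hd d))) (of_seq c) else d.

Definition dlevel (v : data) (n c : seq data) : data :=
  iter (size n) (dgrow v n) (Cons (of_seq [:: Nil]) (of_seq c)).

(** The clock of a vertex is a list of [tick]s, and it also says how many coins
    to flip in a round. *)
Definition tick : data := Cons (Cons Nil Nil) Nil.

Definition mk_mem (ctr stp id nbrs U Sel aux : data) : data :=
  Cons ctr (Cons stp (Cons id (Cons nbrs (Cons U (Cons Sel aux))))).
Definition m_ctr m := hd m.
Definition m_stp m := hd (tl m).
Definition m_id m := hd (tl (tl m)).
Definition m_nbrs m := hd (tl (tl (tl m))).
Definition m_U m := hd (tl (tl (tl (tl m)))).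
Definition m_sel m := hd (tl (tl (tl (tl (tl m))))).
Definition m_aux m := tl (tl (tl (tl (tl (tl m))))).

Definition send (m : data) (nbrs : data) (msg : data) : data :=
  Cons m (Cons (of_seq [seq msg | _ <- to_seq nbrs]) Nil).

(** After round 0, a phase takes four rounds.  A vertex receives the uncovered
    neighbours of its neighbours in [step1], their levels and cores in [step2],
    votes in [step3] and new stars in [step4]. *)
Definition step0 (m : data) : data :=
  send (mk_mem (Cons tick Nil) Nil (hd m) (tl m) (tl m) Nil Nil)
       (tl m) (Cons (hd m) (tl m)).

(** Drops the [Nil] received from stopped vertices together with the neighbours that have no
    uncovered edge; neither can be in a core. *)
Definition ents (msgs : seq data) := [seq a <- msgs | is_cons (tl a)].

Definition core1 (m : data) (msgs : seq data) :=
  dcore (m_id m) [:: Nil] (ents msgs) (ents msgs).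

Definition step1_halt (m : data) : data :=
  Cons m (Cons Nil (Cons Nil
    (of_seq [seq of_bool (dmem u (to_seq (m_sel m))) | u <- to_seq (m_nbrs m)]))).

(* [lc] is a level with its core. *)
Definition info_of (m bits lc : data) : data :=
  Cons (m_id m) (Cons (of_seq (to_seq bits ++ to_seq (m_id m)))
    (Cons (hd lc) (of_seq (map hd (to_seq (tl lc)))))).

Definition dpairs (m lc : data) : seq data :=
  flatten [seq [seq b <- to_seq (tl u) |
                 dmem b (m_id m :: map hd (to_seq (tl lc)))]
          | u <- Cons (m_id m) (m_U m) :: to_seq (tl lc)].

Definition step1_go (m bits lc : data) : data :=
  send (mk_mem (Cons tick (m_ctr m)) (of_seq [:: Nil]) (m_id m) (m_nbrs m)
         (m_U m) (m_sel m) (Cons (info_of m bits lc) (of_seq (dpairs m lc))))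
       (m_nbrs m) (info_of m bits lc).

Definition step1 (m bits : data) (msgs : seq data) : data :=
  if is_cons (of_seq (core1 m msgs))
  then step1_go m bits (dlevel (m_id m) (ents msgs) (core1 m msgs))
  else step1_halt m.

Definition i_prio e := hd (tl e).
Definition i_level e := hd (tl (tl e)).
Definition i_core e := tl (tl (tl e)).
Definition in_star (a e : data) := dmem a (hd e :: to_seq (i_core e)).

Definition dtop (es : seq data) : seq data :=
  [seq e <- es | all (fun e' => size (to_seq (i_level e')) <=
    size (to_seq (i_level e))) es].

Definition dfirst (es : seq data) : seq data :=
  [seq e <- es | all (fun e' => dlexle (to_seq (i_prio e')) (to_seq (i_prio e)))
    es].

Definition dvotes (v : data) (us es : seq data) : seq data :=
  [seq of_seq (map hd (dfirst [seq e <- dtop es | in_star v e && in_star b e]))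
  | b <- us].

Definition step2_votes (m : data) (msgs : seq data) : data :=
  of_seq (dvotes (m_id m) (to_seq (m_U m)) (hd (m_aux m) ::
    [seq e <- msgs | is_cons e])).

Definition step2 (m : data) (msgs : seq data) : data :=
  send (mk_mem (Cons tick (m_ctr m)) (of_seq [:: Nil; Nil]) (m_id m) (m_nbrs m)
         (m_U m) (m_sel m) (Cons (m_aux m) (step2_votes m msgs)))
       (m_nbrs m) (step2_votes m msgs).

Definition dmine (m : data) (msgs : seq data) : seq data :=
  [seq d <- flatten [seq to_seq l | l <- tl (m_aux m) :: msgs] |
    data_eqb d (Cons (m_id m) Nil)].

(** On lengths this is multiplication by four; [dadd] uses two copies for the threshold of an
    eighth. *)
Definition four (s : seq data) := (s ++ s) ++ (s ++ s).

Definition dadd (m : data) (msgs : seq data) : bool :=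
  size (to_seq (tl (hd (m_aux m)))) <=
    size (four (dmine m msgs) ++ four (dmine m msgs)).

Definition step3_core (m : data) : data := i_core (hd (hd (m_aux m))).

Definition step3_star (m : data) (msgs : seq data) : data :=
  if dadd m msgs then Cons (m_id m) (step3_core m) else Nil.

Definition step3 (m : data) (msgs : seq data) : data :=
  send (mk_mem (Cons tick (m_ctr m)) (of_seq [:: Nil; Nil; Nil]) (m_id m) (m_nbrs m)
         (m_U m)
         (if dadd m msgs then of_seq (to_seq (m_sel m) ++ to_seq (step3_core m))
           else m_sel m)
         (step3_star m msgs))
       (m_nbrs m) (step3_star m msgs).

Definition step4_U (m : data) (msgs : seq data) : data :=
  of_seq [seq b <- to_seq (m_U m) |
    ~~ has (fun st => dmem (m_id m) (to_seq st) && dmem b (to_seq st))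
      (m_aux m :: msgs)].

Definition step4 (m : data) (msgs : seq data) : data :=
  send (mk_mem (Cons tick (m_ctr m)) Nil (m_id m) (m_nbrs m)
         (step4_U m msgs) (m_sel m) Nil)
       (m_nbrs m) (Cons (m_id m) (step4_U m msgs)).

(** The memory of a vertex initially starts with an identifier, whose entries
    have [Nil] as head, and later with a list of [tick]s. *)
Definition local_step (m bits : data) (msgs : seq data) : data :=
  if is_cons (hd (hd (hd m))) then
    if is_cons (m_stp m) then
      if is_cons (tl (m_stp m)) then
        if is_cons (tl (tl (m_stp m))) then step4 m msgs else step3 m msgs
      else step2 m msgs
    else step1 m bits msgs
  else step0 m.

(** Reversed, because the program puts each new coin in front of the earlier ones. *)
Definition draw (r : nat -> bool) (n : nat) : seq bool := rev (mkseq r n).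

Definition spanner_alg : local_alg := fun x r =>
  local_step (hd x) (of_seq (map of_bool (draw r (size (to_seq (hd (hd x)))))))
    (to_seq (tl x)).

(** * The local step runs in polynomial time *)

Lemma computable_dcore v k n s : computable v -> computables k ->
  computables n -> computables s ->
  computables (fun x => dcore (v x) (k x) (n x) (s x)).
Proof.
move=> Hv Hk Hn Hs; rewrite /dcore; apply: computables_to_seq.
pose g x d := of_seq (dpeel (v x) (k x) (to_seq d)).
apply: (@computable_iter g (fun x => of_seq (s x)) n (fun x =>
  data_size (of_seq (s x)))) => //.
- rewrite /g /dpeel /dmem.
  have Hv' f : computable f -> computable (fun z => v (f z)) by exact:
    computable_comp.
  have Hk' f : computable f -> computables (fun z => k (f z)).
    exact: (@computable_comp (fun x => of_seq (k x))).
  by repeat first [apply: Hv' | apply: Hk' | computable_step].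
- exact: computable_poly_bounded Hs.
- move=> x j _; elim: j => //= j IH; apply: leq_trans IH.
  by rewrite /g /dpeel; set d := iter _ _ _;
    rewrite -[X in _ <= data_size X]to_seqK data_size_filter.
Qed.

Lemma data_size_nseq j : data_size (of_seq (nseq j Nil)) = j.*2.+1.
Proof. by elim: j => //= j ->; rewrite doubleS; lia. Qed.

Lemma data_size_dcore v k n s :
  data_size (of_seq (dcore v k n s)) <= data_size (of_seq s).
Proof.
rewrite /dcore to_seqK; elim: (size n) => //= j IH; apply: leq_trans IH.
by rewrite /dpeel; set d := iter _ _ _;
  rewrite -[X in _ <= data_size X]to_seqK data_size_filter.
Qed.

(** An entry that survives a peeling round lists at least [size k] neighbours. This keeps the unary
    level linear in the input, although [dlevel] attempts to double it [size n] times. *)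
Lemma dcore_size v k n s : 0 < size n -> is_cons (of_seq (dcore v k n s)) ->
  size k <= data_size (of_seq s).
Proof.
rewrite /dcore to_seqK; case: (size n) => //= j _.
set d := iter _ _ _ => Hd.
have Hds : data_size d <= data_size (of_seq s).
  by have := data_size_dcore v k (nseq j Nil) s; rewrite /dcore size_nseq to_seqK.
have [a [s1 [s2 [Ed Hk]]]] : exists a s1 s2, to_seq d = s1 ++ a :: s2 /\
    size k <= size [seq b <- to_seq (tl a) | dmem b (v :: map hd (to_seq d))].
  move: Hd; rewrite /dpeel; set P := (fun u => _ <= _).
  suff : is_cons (of_seq [seq u <- to_seq d | P u]) ->
    exists a s1 s2, to_seq d = s1 ++ a :: s2 /\ P a by [].
  elim: (to_seq d) => //= b t IH; case: ifP => [Pb _|_ /IH [a' [s1 [s2 [-> H]]]]].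
    by exists b, [::], t.
  by exists a', (b :: s1), s2.
apply: leq_trans Hk _; rewrite size_filter; apply: leq_trans (count_size _ _) _.
apply: leq_trans Hds; rewrite -[d]to_seqK Ed.
apply: leq_trans (data_size_mem_seq a s1 s2).
apply: leq_trans (data_size_tl a).
by rewrite -[X in _ <= data_size X]to_seqK ltnW // size_le_data_size.
Qed.

Lemma computable_dlevel v n c : computable v -> computables n -> computables c ->
  computable (fun x => dlevel (v x) (n x) (c x)).
Proof.
move=> Hv Hn Hc; rewrite /dlevel.
apply: (@computable_iter (fun x => dgrow (v x) (n x))
  (fun x => Cons (of_seq [:: Nil]) (of_seq (c x))) n
  (fun x => 3 * data_size (of_seq (c x)) + 5)) => //.
- have Hv' f : computable f -> computable (fun z => v (f z)) by exact:
    computable_comp.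
  have Hn' f : computable f -> computables (fun z => n (f z)).
    exact: (@computable_comp (fun x => of_seq (n x))).
  rewrite /dgrow; cbv beta zeta;
    repeat first [apply: Hv' | apply: Hn' | computable_step |
      apply: computable_dcore].
- by computable_tac.
- have := computable_poly_bounded Hc => H.
  exact: (poly_bounded_add (poly_bounded_mul (poly_bounded_const 3) H)
    (poly_bounded_const 5)).
- move=> x i Hi.
  have [n0|n0] := posnP (size (n x)); first by move: Hi; rewrite n0;
    case: (i) => //= _; lia.
  suff [j [c' [-> Hc' Hj]]] : exists j c', [/\ 
      iter i (dgrow (v x) (n x)) (Cons (of_seq [:: Nil]) (of_seq (c x))) =
        Cons (of_seq (nseq j Nil)) (of_seq c'),
      data_size (of_seq c') <= data_size (of_seq (c x)) & j <=
        data_size (of_seq (c x)) + 1].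
    by rewrite /= data_size_nseq; lia.
  elim: i {Hi} => [|i [j [c' [/= -> Hc' Hj]]]]; first by exists 1, (c x);
    split=> //; lia.
  rewrite /dgrow /= !of_seqK -nseqD; case: ifP => Hd; last by exists j, c'.
  do 2!eexists; split; first by reflexivity.
    exact: leq_trans (data_size_dcore _ _ _ _) Hc'.
  by have := dcore_size n0 Hd; rewrite size_nseq; lia.
Qed.

Lemma computable_pair3 (h : data -> data -> data -> data) f g k :
  computable (fun z => h (hd z) (hd (tl z)) (tl (tl z))) ->
  computable f -> computable g -> computable k ->
  computable (fun x => h (f x) (g x) (k x)).
Proof.
move=> Hh Hf Hg Hk.
exact: (computable_comp Hh (computable_cons Hf (computable_cons Hg Hk))).
Qed.

Lemma computable_send m n msg : computable m -> computable n ->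
  computable msg -> computable (fun x => send (m x) (n x) (msg x)).
Proof.
move=> Hm Hn Hmsg; rewrite /send; computable_tac.
by apply: (computable_comp Hmsg); computable_tac.
Qed.

Lemma computable_local_step :
  computable (fun z => local_step (hd (hd z)) (tl z) (to_seq (tl (hd z)))).
Proof.
rewrite /local_step.
have Hm : computable (fun z => hd (hd z)) by computable_tac.
have Hs : computables (fun z => to_seq (tl (hd z))) by computable_tac.
have Hb : computable tl by computable_tac.
apply: computable_if; last by rewrite /step0; apply: computable_send;
  rewrite /mk_mem; computable_tac.
  by computable_tac.
apply: computable_if; first by rewrite /m_stp; computable_tac.
  apply: computable_if; first by rewrite /m_stp; computable_tac.
    apply: computable_if; first by rewrite /m_stp; computable_tac.
      by rewrite /step4; apply: computable_send;
        rewrite ?/mk_mem ?/step4_U /dmem /m_ctr /m_id /m_nbrs /m_U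
           /m_sel /m_aux; computable_tac.
    have Ha : computableb (fun z => dadd (hd (hd z)) (to_seq (tl (hd z)))).
      by rewrite /dadd /four /dmine /m_aux /m_id; computable_tac.
    by rewrite /step3; apply: computable_send;
      rewrite /step3_star /step3_core /i_core /mk_mem /m_ctr
         /m_id /m_nbrs /m_U /m_sel /m_aux; computable_tac.
  have Hv : computable (fun z => step2_votes (hd (hd z)) (to_seq (tl (hd z)))).
    rewrite /step2_votes /dvotes /dfirst /dtop /in_star /dmem /i_prio /i_level
       /i_core /m_aux /m_id /m_U.
    by repeat first [apply: computableb_dlexle | computable_step].
  by rewrite /step2; apply: computable_send;
    rewrite /mk_mem /m_ctr /m_id /m_nbrs /m_U /m_sel /m_aux;
     computable_tac.
have He : computables (fun z => ents (to_seq (tl (hd z)))).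
  by rewrite /ents; computable_tac.
have Hc : computables (fun z => core1 (hd (hd z)) (to_seq (tl (hd z)))).
  by rewrite /core1 /m_id; apply: computable_dcore => //; computable_tac.
apply: computable_if; first by computable_tac.
  have Hl : computable (fun z =>
    dlevel (m_id (hd (hd z))) (ents (to_seq (tl (hd z))))
      (core1 (hd (hd z)) (to_seq (tl (hd z))))).
    by apply: computable_dlevel => //; rewrite /m_id; computable_tac.
  apply: (computable_pair3 (h := step1_go)) => //.
  by rewrite /step1_go; apply: computable_send;
    rewrite /info_of /dpairs /mk_mem /dmem /m_ctr /m_id
     /m_nbrs /m_U /m_sel; computable_tac.
by rewrite /step1_halt /dmem /m_sel /m_nbrs; computable_tac.
Qed.

(** Only a prologue reads the random tape: it flips one coin per entry of the clock and pairs the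
    bits with the input, and a deterministic program does the rest. *)
Lemma spanner_alg_poly_time : exists (c : cmd) (e : nat), forall r x,
  computes_within c r x (spanner_alg x r) ((data_size x).+1 ^ e).
Proof.
have [c [N [T [N0 HT _ Ec]]]] := computable_local_step.
pose flip := CSeq (CFlip 3) (CSeq (CAssign 2 (ECons (EVar 3) (EVar 2)))
  (CAssign 1 (ETl (EVar 1)))).
pose prog := CSeq (CAssign 1 (EHd (EHd (EVar 0)))) (CSeq (CAssign 2 ENil)
  (CSeq (CWhile (EVar 1) flip) (CSeq (CAssign 0 (ECons (EVar 0) (EVar 2))) c))).
pose bits r n := of_seq (map of_bool (draw r n)).
have sbits r n : data_size (bits r n) <= 4 * n + 1.
  rewrite /bits -[in X in _ <= X](size_mkseq r n) -(size_rev (mkseq r n))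
    -/(draw r n).
  by elim: (draw r n) => //= b s IH; have := data_size_of_bool b; lia.
have loop r : forall m i s, to_seq (s 1) = m -> s 2 = bits r i ->
  exists k s', [/\ exec r (CWhile (EVar 1) flip) s i k s' (i + size m),
    s' 0 = s 0, s' 2 = bits r (i + size m) &
    k <= (size m) * (10 * data_size (s 1) + 20 * (i + size m) + 40) + 2].
  elim=> [|a m IH] i s E1 E2.
    exists (eval_cost s (EVar 1)).+1, s; rewrite addn0; split=> //.
      by apply: XWhileF => /=; case: (s 1) E1.
    by rewrite /=; case: (s 1) E1.
  pose s3 := update s 3 (of_bool (r i)).
  pose s4 := update s3 2 (Cons (of_bool (r i)) (bits r i)).
  pose s5 := update s4 1 (tl (s 1)).
  have Eb : Cons (of_bool (r i)) (bits r i) = bits r i.+1.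
    by rewrite /bits /draw /mkseq -addn1 iotaD map_cat rev_cat.
  have [||k [s6 [X6 E60 E62 K6]]] := IH i.+1 s5.
  - by rewrite /s5 /update /=; case: (s 1) E1 => //= ? ? [].
  - by rewrite /s5 /s4 /update /= Eb.
  do 2!eexists; split.
  - apply: XWhileT; first by rewrite /=; case: (s 1) E1.
      apply: XSeq; first exact: XFlip.
      apply: XSeq; first exact: XAssign.
      exact: XAssign.
    rewrite -/s3; cbn [eval].
    have -> : update s3 2 (Cons (s3 3) (s3 2)) = s4.
      by rewrite /s4 -E2 /s3 /update.
    have -> : update s4 1 (tl (s4 1)) = s5 by rewrite /s5 /s4 /s3 /update.
    by rewrite /= addnS -addSn; exact: X6.
  - by rewrite E60.
  - by rewrite E62 addSn addnS.
  - cbn [eval eval_cost data_size]; rewrite -/s3.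
    have -> : s3 3 = of_bool (r i) by [].
    have -> : s3 2 = bits r i by rewrite -E2.
    have -> : update s3 2 (Cons (of_bool (r i)) (bits r i)) 1 = s 1 by [].
    have s51 : s5 1 = tl (s 1) by [].
    move: K6; rewrite s51 => K6.
    have := sbits r i; have := data_size_of_bool (r i); have := data_size_tl (s 1).
    move=> h1 h2 h3.
    have : size m * (10 * data_size (tl (s 1)) + 20 * (i.+1 + size m) + 40) <=
       size m * (10 * data_size (s 1) + 20 * (i + (size m).+1) + 40).
      by rewrite leq_mul2l; apply/orP; right; lia.
    by rewrite /= mulSn; lia.
have [e1 He1] := HT.
have [e2 He2] : poly_bounded (fun x => data_size x * (30 * data_size x + 40) +
  40 * data_size x + 40 +
    (8 * data_size x + 8) ^ e1).
  by poly_bounded_tac.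
exists prog, e2 => r x.
pose s0 := update (fun=> Nil) 0 x.
pose s1 := update s0 1 (hd (hd x)).
pose s2 := update s1 2 Nil.
have [|k3 [s3 [X3 E30 E32 K3]]] := loop r _ 0 s2 erefl; first by [].
pose s4 := update s3 0 (Cons x (s3 2)).
have [k5 [s5 [X5 E5 _ K5]]] := Ec r s4 (0 + size (to_seq (s2 1))).
have E3 : s3 0 = x by rewrite E30.
do 3!eexists; split.
- apply: XSeq; first exact: XAssign.
  apply: XSeq; first exact: XAssign.
  apply: XSeq; first exact: X3.
  apply: XSeq; first exact: XAssign.
  by cbn [eval]; rewrite E3; exact: X5.
- by rewrite E5 /= E32.
- cbn [eval eval_cost data_size]; rewrite E3 E32 add0n.
  apply: leq_trans (He2 x).
  have hx : data_size (hd (hd x)) <= data_size x.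
    exact: leq_trans (data_size_hd _) (data_size_hd _).
  have hs : size (to_seq (hd (hd x))) <= data_size x.
    by apply: leq_trans hx; rewrite -{2}[hd (hd x)]to_seqK ltnW //
      size_le_data_size.
  have hb := sbits r (size (to_seq (hd (hd x)))).
  have h5 : k5 <= (8 * data_size x + 8) ^ e1.
    apply: leq_trans K5 _; apply: leq_trans (He1 _) _.
    case: (e1) => // e'; rewrite leq_exp2r //=.
    by rewrite E32 add0n; move: hb; rewrite /s2 /s1 /update /=; lia.
  have h3 : k3 <= data_size x * (30 * data_size x + 40) + 2.
    apply: leq_trans K3 _; rewrite leq_add2r; apply: leq_mul; first exact: hs.
    by rewrite /s2 /s1 /update /=; lia.
  have := data_size_hd x; move: hb.
  by rewrite /s2 /s1 /update /=; lia.
Qed.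

(** * Cores, levels and votes *)

Section Phase.
Variables (G : sgraph) (U : {set G * G}).
Implicit Types (u v a b x : G) (S T : seq G).

Definition unc a : seq G := [seq b <- neighbours a | (a, b) \in U].

Definition udeg S u : nat := size [seq b <- unc u | b \in S].

Definition peel v k S := [seq u <- S | k <= udeg (v :: S) u].

Definition grow v n (d : nat * seq G) : nat * seq G :=
  if iter n (peel v (d.1 + d.1)) d.2 is _ :: _
  then (d.1 + d.1, iter n (peel v (d.1 + d.1)) d.2) else d.

Definition base v := [seq a <- neighbours v | unc a != [::]].

Definition score1 v := iter (size (base v)) (peel v 1) (base v).

Definition level_star v :=
  iter (size (base v)) (grow v (size (base v))) (1, score1 v).

Definition level v := (level_star v).1.
Definition star v := (level_star v).2.
Definition cstar v := v :: star v.
Definition active v := score1 v != [::].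

Definition feasible v k T :=
  {subset T <= neighbours v} /\ {in T, forall u, k <= udeg (v :: T) u}.

Definition greatest v k S :=
  [/\ feasible v k S, uniq S & forall T, feasible v k T -> {subset T <= S}].

Lemma uniq_neighbours v : uniq (neighbours v).
Proof. exact: enum_uniq. Qed.

Lemma mem_neighbours u v : (v \in neighbours u) = adj u v.
Proof. by rewrite mem_enum. Qed.

Lemma mem_unc a b : (b \in unc a) = adj a b && ((a, b) \in U).
Proof. by rewrite mem_filter mem_neighbours andbC. Qed.

Lemma udeg_sub S T u : {subset S <= T} -> udeg S u <= udeg T u.
Proof.
by move=> ST; rewrite /udeg !size_filter; apply: sub_count => b; exact: ST.
Qed.

Lemma udeg_le_size S u : udeg S u <= size S.
Proof.
apply: uniq_leq_size => [|b]; first by do 2!apply: filter_uniq;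
  exact: uniq_neighbours.
by rewrite mem_filter => /andP[].
Qed.

Lemma peel_sub v k S : {subset peel v k S <= S}.
Proof. by move=> u; rewrite mem_filter => /andP[]. Qed.

Lemma iter_peel_sub v k n S : {subset iter n (peel v k) S <= S}.
Proof. by elim: n => //= n IH u /peel_sub /IH. Qed.

Lemma iter_peel_uniq v k n S : uniq S -> uniq (iter n (peel v k) S).
Proof. by move=> uS; elim: n => //= n IH; apply: filter_uniq. Qed.

(** Every round before the fixed point removes an entry, so [size S] rounds are enough. *)
Lemma iter_peel_fix v k n S : size S <= n ->
  peel v k (iter n (peel v k) S) = iter n (peel v k) S.
Proof.
move=> Sn; suff: peel v k (iter n (peel v k) S) = iter n (peel v k) S \/
    size (iter n (peel v k) S) + n <= size S.
  case=> // H; have : size (iter n (peel v k) S) = 0 by lia.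
  by move/size0nil ->.
elim: n {Sn} => [|n [IH|IH]] /=; first by right; rewrite addn0.
- by left; rewrite IH.
- set R := iter n _ S in IH *.
  have [E|E] := eqVneq (size (peel v k R)) (size R).
    left; congr peel; apply/all_filterP; rewrite all_count -size_filter.
    by rewrite -/(peel v k R) E.
  right; have : size (peel v k R) <= size R by rewrite size_filter count_size.
  by move: E; lia.
Qed.

(** The degrees that peeling tests are counted in a superset of [T], so no element of [T] is ever
    removed. *)
Lemma feasible_iter_peel v k n S T : feasible v k T -> {subset T <= S} ->
  {subset T <= iter n (peel v k) S}.
Proof.
move=> [TN Tk] TS; elim: n => //= n IH u uT.
rewrite mem_filter IH // andbT; apply: leq_trans (Tk u uT) _.
by apply: udeg_sub => b; rewrite !inE => /orP[->//|/IH ->]; rewrite orbT.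
Qed.

Lemma greatest_iter_peel v k n S : uniq S -> size S <= n ->
  {subset S <= neighbours v} ->
  (forall T, feasible v k T -> {subset T <= S}) ->
  greatest v k (iter n (peel v k) S).
Proof.
move=> uS Sn SN H; split; last by move=> T HT; apply: feasible_iter_peel (H _ HT).
- split=> [u /iter_peel_sub /SN //|u].
  by rewrite -{1}(iter_peel_fix v k Sn) mem_filter => /andP[].
- exact: iter_peel_uniq.
Qed.

Lemma feasible_le v k k' T : k' <= k -> feasible v k T -> feasible v k' T.
Proof. by move=> kk' [TN Tk]; split=> // u /Tk; apply: leq_trans. Qed.

Lemma feasible_base v k T : 0 < k -> feasible v k T -> {subset T <= base v}.
Proof.
move=> k0 [TN Tk] u uT; rewrite mem_filter TN // andbT.
have := leq_trans k0 (Tk u uT); rewrite /udeg => H.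
by apply: contraTneq H => ->.
Qed.

Lemma base_sub v : {subset base v <= neighbours v}.
Proof. by move=> u; rewrite mem_filter => /andP[]. Qed.

Lemma base_uniq v : uniq (base v).
Proof. exact/filter_uniq/uniq_neighbours. Qed.

Lemma greatest_score1 v : greatest v 1 (score1 v).
Proof.
apply: greatest_iter_peel => //; first exact: base_uniq.
  exact: base_sub.
by move=> T; apply: feasible_base.
Qed.

(** The invariant is that either every doubling so far succeeded or the next level has no feasible
    set. After [n] successes the next level is [2 ^ n.+1], more than the at most [n + 1] vertices,
    with the centre, to which a leaf can have uncovered edges. *)
Lemma level_star_spec v : active v -> exists i,
  [/\ level v = 2 ^ i, greatest v (2 ^ i) (star v), star v != [::] &
      forall T, feasible v (2 ^ i.+1) T -> T = [::]].
Proof.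
move=> act; rewrite /level /star /level_star; set n := size _.
have H j : exists i c, [/\ iter j (grow v n) (1, score1 v) = (2 ^ i, c),
    greatest v (2 ^ i) c, c != [::] &
    i = j \/ forall T, feasible v (2 ^ i.+1) T -> T = [::]].
  elim: j => [|j [i [c [/= -> [gc uc gT] c0 Hi]]]].
    by exists 0, (score1 v); split=> //=; [exact: greatest_score1 | left].
  have cN : {subset c <= neighbours v} by case: gc.
  have cn : size c <= n.
    apply: uniq_leq_size => //; apply: feasible_base gc; by rewrite expn_gt0.
  have g2 : greatest v (2 ^ i.+1) (iter n (peel v (2 ^ i.+1)) c).
    apply: greatest_iter_peel => // T HT; apply: gT; apply: feasible_le HT.
    by rewrite leq_exp2l.
  rewrite /grow /= addnn -mul2n -expnS.
  case E: (iter n _ c) g2 => [|x s] [g21 g22 g23].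
    exists i, c; split=> //; right=> T /g23; case: (T) => // y t /(_ y).
    by rewrite mem_head => /(_ isT).
  exists i.+1, (x :: s); split=> //.
  case: Hi => [->|Hi]; first by left.
  by have := Hi _ g21.
have [i [c [-> gc c0 Hi]]] := H n; exists i; split=> // T.
case: Hi => [->|]; last exact.
move=> HT; case: T HT => // u T' HT; exfalso; set T := u :: T' in HT.
have [TN Tk] := HT.
have TB : {subset undup T <= base v}.
  by move=> y; rewrite mem_undup; apply: feasible_base HT _; rewrite expn_gt0.
have := Tk u (mem_head _ _); apply/negP; rewrite -ltnNge.
apply: (@leq_ltn_trans (udeg (v :: undup T) u)).
  by apply: udeg_sub => b; rewrite !inE mem_undup.
apply: leq_ltn_trans (udeg_le_size _ _) _ => /=.
apply: leq_ltn_trans (_ : n.+1 < _); last by rewrite expnS;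
  have := ltn_expl n (ltnSn 1); lia.
by rewrite ltnS; apply: uniq_leq_size => //; exact: (undup_uniq (u :: T')).
Qed.

Lemma active_feasible v : active v <-> exists k T,
  [/\ 0 < k, T != [::] & feasible v k T].
Proof.
split=> [act|[k [T [k0 T0 HT]]]].
  by exists 1, (score1 v); split=> //; case: (greatest_score1 v).
have [_ _ /(_ T (feasible_le k0 HT))] := greatest_score1 v.
by case: T T0 {HT} => // u T _ /(_ u (mem_head _ _)); rewrite /active; case: score1.
Qed.

End Phase.

Lemma unc_mono (G : sgraph) (U U' : {set G * G}) a :
  U' \subset U -> {subset unc U' a <= unc U a}.
Proof. by move=> /subsetP s b; rewrite !mem_unc => /andP[-> /s]. Qed.

Lemma udeg_mono (G : sgraph) (U U' : {set G * G}) S u :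
  U' \subset U -> udeg U' S u <= udeg U S u.
Proof.
move=> s; apply: uniq_leq_size => [|b]; first by do 2!apply: filter_uniq;
  exact: uniq_neighbours.
rewrite !(mem_filter (mem S)) => /andP[bS bu]; rewrite bS; exact: unc_mono bu.
Qed.

Lemma feasible_mono (G : sgraph) (U U' : {set G * G}) v k T :
  U' \subset U -> feasible U' v k T -> feasible U v k T.
Proof.
by move=> s [TN Tk]; split=> // u /Tk /leq_trans; apply; exact: udeg_mono.
Qed.

Lemma active_mono (G : sgraph) (U U' : {set G * G}) v :
  U' \subset U -> active U' v -> active U v.
Proof.
move=> s /active_feasible [k [T [k0 T0 HT]]]; apply/active_feasible.
by exists k, T; split=> //; apply: feasible_mono HT.
Qed.

Fixpoint blexle (s t : seq bool) : bool :=
  match s, t with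
  | [::], _ => true
  | _ :: _, [::] => false
  | a :: s', b :: t' => if a == b then blexle s' t' else b
  end.

Section Votes.
Variables (G : sgraph) (U : {set G * G}) (prio : G -> seq bool).
Implicit Types (a b v x : G).

Definition voters a := [seq x <- a :: neighbours a | active U x].

Definition vtop a := [seq x <- voters a |
  all (fun y => level U y <= level U x) (voters a)].

Definition cands a b :=
  [seq x <- vtop a | (a \in cstar U x) && (b \in cstar U x)].

(** A list, since nothing is assumed about [prio]; for injective priorities it has at most one
    entry, and [mine] counts only ballots equal to [[:: v]]. *)
Definition vote a b := [seq x <- cands a b |
  all (fun y => blexle (prio y) (prio x)) (cands a b)].

Definition mine v := flatten
  [seq [seq b <- unc U a | active U a && (vote a b == [:: v])]
  | a <- v :: neighbours v].

Definition pairs v := flatten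
  [seq [seq b <- unc U a | b \in cstar U v] | a <- cstar U v].

Definition added v := active U v && (size (pairs v) <= 8 * size (mine v)).

Definition nextU := [set e in U |
  ~~ [exists x, [&& added x, e.1 \in cstar U x & e.2 \in cstar U x]]].

Definition gain v := if added v then star U v else [::].

End Votes.

Lemma data_eqP a b : reflect (a = b) (data_eqb a b).
Proof.
apply: (iffP idP) => [|->]; last by elim: b => //= x -> y ->.
elim: a b => [|a IHa c IHc] [|b d] //= /andP[/IHa-> /IHc->] //.
Qed.

Lemma of_bool_inj : injective of_bool.
Proof. by case; case. Qed.

Lemma of_seq_inj : injective of_seq.
Proof. exact: can_inj of_seqK. Qed.

Lemma dlexle_map s t : dlexle (map of_bool s) (map of_bool t) = blexle s t.
Proof. by elim: s t => [|a s IH] [|b t] //=; rewrite IH; case: a; case: b. Qed.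

Lemma adjacent_feasible (G : sgraph) (U : {set G * G}) (u b : G) :
  (b, u) \in U -> adj u b -> feasible U u 1 [:: b].
Proof.
move=> bU uU; split=> [x|x]; rewrite inE => /eqP->; first by rewrite mem_neighbours.
rewrite /udeg size_filter -has_count; apply/hasP; exists u;
  last by rewrite inE eqxx.
by rewrite mem_unc adj_sym uU.
Qed.

(** If [(u, b)] is uncovered then [b] alone is a 1-core of [u]. A vertex that stops therefore has no
    uncovered edge left, and its neighbours may treat its silence as an empty list. *)
Lemma inactive_unc (G : sgraph) (U : {set G * G}) (u : G) :
  (forall a b, (a, b) \in U -> (b, a) \in U) -> ~~ active U u -> unc U u = [::].
Proof.
move=> symU; case E: (unc U u) => [|b s] // /negP[].
have : b \in unc U u by rewrite E mem_head.
rewrite mem_unc => /andP[ub /symU bU]; apply/active_feasible.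
by exists 1, [:: b]; split=> //; apply: adjacent_feasible.
Qed.

(** * The operations on trees compute cores, levels and votes *)

Section Encoding.
Variables (G : sgraph) (id : G -> seq bool).
Hypothesis id_inj : injective id.
Let I := of_id id.

Lemma of_id_inj : injective I.
Proof. by move=> u v /of_seq_inj /(inj_map of_bool_inj) /id_inj. Qed.

Lemma data_eqb_id a b : data_eqb (I a) (I b) = (a == b).
Proof. by apply/data_eqP/eqP => [/of_id_inj|->]. Qed.

Lemma dmem_map a s : dmem (I a) (map I s) = (a \in s).
Proof. by elim: s => //= b s; rewrite /dmem /= inE data_eqb_id => ->. Qed.

Section State.
Variable U : {set G * G}.

Definition ent u := Cons (I u) (of_seq (map I (unc U u))).

Lemma map_hd_ent S : map hd (map ent S) = map I S.
Proof. by rewrite -map_comp. Qed.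

Lemma dpeel_ent v k S :
  dpeel (I v) (nseq k Nil) (map ent S) = map ent (peel U v k S).
Proof.
rewrite /dpeel filter_map; congr map; apply: eq_filter => u /=.
rewrite size_nseq of_seqK filter_map size_map map_hd_ent.
by congr (_ <= size _); apply: eq_filter => b; exact: (dmem_map b (v :: S)).
Qed.

Lemma dcore_ent v k (n : seq data) S :
  dcore (I v) (nseq k Nil) n (map ent S) = map ent (iter (size n) (peel U v k) S).
Proof.
rewrite /dcore; suff -> : iter (size n) (fun d =>
  of_seq (dpeel (I v) (nseq k Nil) (to_seq d)))
    (of_seq (map ent S)) = of_seq (map ent (iter (size n) (peel U v k) S)) by
      rewrite of_seqK.
by elim: (size n) => //= m ->; rewrite of_seqK dpeel_ent.
Qed.

Definition enc_level (d : nat * seq G) :=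
  Cons (of_seq (nseq d.1 Nil)) (of_seq (map ent d.2)).

Lemma dgrow_ent v n d : dgrow (I v) n (enc_level d) =
  enc_level (grow U v (size n) d).
Proof.
rewrite /dgrow /= !of_seqK -nseqD dcore_ent /grow.
by case: (iter _ _ _).
Qed.

Lemma dlevel_ent v : dlevel (I v) (map ent (base U v)) (map ent (score1 U v)) =
  enc_level (level_star U v).
Proof.
rewrite /dlevel /level_star -[Cons _ _]/(enc_level (1, score1 U v)) size_map.
by elim: {1 2}(size _) => //= m ->; rewrite dgrow_ent size_map.
Qed.

Lemma dpairs_ent m v : m_id m = I v -> m_U m = of_seq (map I (unc U v)) ->
  dpairs m (enc_level (level_star U v)) = map I (pairs U v).
Proof.
rewrite /dpairs => -> ->.
have -> : to_seq (tl (enc_level (level_star U v))) = map ent (star U v).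
  exact: of_seqK.
rewrite map_hd_ent -[_ :: map ent _]/(map ent (cstar U v)) /pairs.
elim: {1 3}(cstar U v) => // u s IH.
rewrite !map_cons /flatten [RHS]map_cat; congr (_ ++ _); last exact: IH.
rewrite [to_seq _]of_seqK filter_map; congr map; apply: eq_filter => b.
by rewrite -(dmem_map b (cstar U v)).
Qed.

Variable prio : G -> seq bool.

Definition info v := Cons (I v) (Cons (of_seq (map of_bool (prio v)))
  (Cons (of_seq (nseq (level U v) Nil)) (of_seq (map I (star U v))))).

Lemma in_star_info a x : in_star (I a) (info x) = (a \in cstar U x).
Proof. by rewrite /in_star [to_seq _]of_seqK; exact: (dmem_map a (cstar U x)). Qed.

Lemma dvotes_info a us :
  dvotes (I a) (map I us) (map info (voters U a)) =
  [seq of_seq (map I (vote U prio a b)) | b <- us].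
Proof.
rewrite /dvotes -map_comp; apply: eq_map => b /=; congr of_seq.
have -> : dtop (map info (voters U a)) = map info (vtop U a).
  rewrite /dtop filter_map; congr map; apply: eq_filter => x /=.
  by rewrite all_map; apply: eq_all => y /=; rewrite !of_seqK !size_nseq.
rewrite filter_map.
rewrite (_ : filter _ _ = cands U a b); last first.
  by apply: eq_filter => x /=; rewrite !in_star_info.
rewrite /dfirst filter_map -map_comp; congr map; apply: eq_filter => x /=.
by rewrite all_map; apply: eq_all => y /=; rewrite !of_seqK dlexle_map.
Qed.

End State.
End Encoding.

(** * Executions *)

Section Run.
Variables (G : sgraph) (id : G -> seq bool).
Hypothesis id_inj : injective id.
Let I := of_id id.
Notation encs s := (of_seq (map I s)).

(** A running vertex sends the same message on all ports, so the numbering of the ports never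
    matters; a stopped one sends nothing. *)
Definition conf (live : pred G) (mem msg : G -> data) (out : G -> seq data)
    (c : G -> vconf) := forall v,
  if live v then c v = VConf (mem v) [seq msg v | _ <- neighbours v] None
  else decision (c v) = Some (out v) /\ outbox (c v) = [::].

Definition inbox (live : pred G) (msg : G -> data) v :=
  [seq if live u then msg u else Nil | u <- neighbours v].

Lemma conf_input live mem msg out c v : conf live mem msg out c -> live v ->
  local_input c v = Cons (mem v) (of_seq (inbox live msg v)).
Proof.
move=> H lv; rewrite /local_input; have := H v; rewrite lv => -> /=.
congr Cons; congr of_seq; apply/eq_in_map => u; rewrite mem_neighbours => vu.
rewrite /message; have := H u; case: ifP => _ [].
  move=> -> /=; rewrite (nth_map u) // index_mem mem_neighbours adj_sym //.
by move=> _ ->; rewrite nth_nil.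
Qed.

Lemma decode_send m s msg : decode (send m (encs s) msg) =
  VConf m [seq msg | _ <- s] None.
Proof. by rewrite /send /decode /= !of_seqK -map_comp. Qed.

Lemma conf_round (live live' : pred G) (mem mem' msg msg' : G -> data)
    (out out' : G -> seq data) r c :
  conf live mem msg out c -> (forall v, live' v -> live v) ->
  (forall v, live v ->
    local_step (mem v) (of_seq (map of_bool
      (draw (r v) (size (to_seq (hd (mem v)))))))
      (inbox live msg v) =
    if live' v then send (mem' v) (encs (neighbours v)) (msg' v)
    else Cons (mem v) (Cons Nil (Cons Nil (of_seq (out' v))))) ->
  (forall v, ~~ live v -> out' v = out v) ->
  conf live' mem' msg' out' (round spanner_alg r c).
Proof.
move=> H ll' Hs Ho v; have := H v; rewrite /round; case: ifP => lv.
  move=> Ev; have := conf_input H lv; rewrite Ev /= => ->.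
  rewrite /spanner_alg /= of_seqK Hs //; case: (live' v);
    first by rewrite decode_send.
  by rewrite /decode /= of_seqK.
have -> : live' v = false by apply: contraFF lv; exact: ll'.
by case=> -> _ /=; rewrite Ho ?lv.
Qed.

Variable w : coins G.

Definition prio_at t v := draw (w t v) t ++ id v.

Definition phase_time p := (p * 4).+1.

Fixpoint state p : {set G * G} * (G -> seq G) :=
  if p is q.+1 then
    (nextU (state q).1 (prio_at (phase_time q)),
     fun v => (state q).2 v ++ gain (state q).1 (prio_at (phase_time q)) v)
  else ([set e | adj e.1 e.2], fun=> [::]).

Definition uncovered p := (state p).1.
Definition selected p := (state p).2.

(** Stopping is decided in the first round of a phase, so a vertex that became inactive during phase
    [q] is still running at the start of phase [q.+1]. *)
Definition live p v := if p is q.+1 then active (uncovered q) v else true.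

Lemma uncovered_sym p a b : (a, b) \in uncovered p -> (b, a) \in uncovered p.
Proof.
elim: p => [|p IH]; first by rewrite !inE /= adj_sym.
rewrite /uncovered /= -/(uncovered p) !inE => /andP[/IH -> /= H].
by apply: contra H => /existsP[x /and3P[? ? ?]]; apply/existsP; exists x;
  apply/and3P.
Qed.

Lemma uncovered_sub p : uncovered p.+1 \subset uncovered p.
Proof. by apply/subsetP => e; rewrite inE => /andP[]. Qed.

Definition ticks t := of_seq (nseq t tick).

Definition state_mem t stp p aux v :=
  mk_mem (ticks t) stp (I v) (encs (neighbours v)) (encs (unc (uncovered p) v))
    (encs (selected p v)) aux.

Definition out_of p v := [seq of_bool (u \in selected p v) | u <- neighbours v].

(** [mem1] describes the memory at the start of phase [p], and [mem2], [mem3]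
    and [mem4] after its first three rounds. *)
Definition mem1 p := state_mem (phase_time p) Nil p Nil.

Definition aux2 p v :=
  Cons (info id (uncovered p) (prio_at (phase_time p)) v)
    (of_seq (dpairs (mem1 p v) (enc_level id (uncovered p)
      (level_star (uncovered p) v)))).

Definition mem2 p v := state_mem (phase_time p).+1 (of_seq [:: Nil]) p (aux2 p v) v.

Definition ballots p v := of_seq
  [seq encs (vote (uncovered p) (prio_at (phase_time p)) v b) |
    b <- unc (uncovered p) v].

Definition mem3 p v :=
  state_mem (phase_time p).+2 (of_seq [:: Nil; Nil]) p
    (Cons (aux2 p v) (ballots p v)) v.

Definition new_star p v :=
  if added (uncovered p) (prio_at (phase_time p)) v
  then encs (cstar (uncovered p) v) else Nil.

Definition mem4 p v :=
  mk_mem (ticks (phase_time p).+3) (of_seq [:: Nil; Nil; Nil]) (I v)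
    (encs (neighbours v)) (encs (unc (uncovered p) v)) (encs (selected p.+1 v))
      (new_star p v).

Lemma inbox_ents p v : (forall u, ~~ live p u -> unc (uncovered p) u = [::]) ->
  ents (inbox (live p) (ent id (uncovered p)) v) =
    map (ent id (uncovered p)) (base (uncovered p) v).
Proof.
move=> H; rewrite /ents /inbox /base; elim: (neighbours v) => //= u s ->.
by have [_|nl] := boolP (live p u);
  [rewrite /=; case: (unc _ u) | rewrite (H _ nl)].
Qed.

Lemma live_active p v : active (uncovered p) v -> live p v.
Proof. by case: p => //= p; apply: active_mono; exact: uncovered_sub. Qed.

Lemma not_live_unc p v : ~~ live p v -> unc (uncovered p) v = [::].
Proof.
move=> H; apply: inactive_unc; first exact: uncovered_sym.
by apply: contra H; exact: live_active.
Qed.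

Lemma local_step_start p v : live p v ->
  local_step (mem1 p v) (of_seq (map of_bool (draw (w (phase_time p) v)
      (size (to_seq (hd (mem1 p v))))))) (inbox (live p) (ent id (uncovered p)) v) =
  if active (uncovered p) v then send (mem2 p v) (encs (neighbours v))
    (info id (uncovered p) (prio_at (phase_time p)) v)
  else Cons (mem1 p v) (Cons Nil (Cons Nil (of_seq (out_of p v)))).
Proof.
move=> lv.
have -> : size (to_seq (hd (mem1 p v))) = phase_time p.
  by rewrite [to_seq _]of_seqK size_nseq.
set bits := of_seq _; set msgs := inbox _ _ _.
rewrite -[LHS]/(step1 (mem1 p v) bits msgs) /step1.
have Ee : ents msgs = map (ent id (uncovered p)) (base (uncovered p) v).
  by apply: inbox_ents => u; exact: not_live_unc.
have Ec : core1 (mem1 p v) msgs =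
  map (ent id (uncovered p)) (score1 (uncovered p) v).
  by rewrite /core1 Ee -[[:: Nil]]/(nseq 1 Nil) [m_id _]/(I v) dcore_ent //
    size_map.
rewrite Ec Ee [m_id _]/(I v) dlevel_ent //.
have -> : is_cons (of_seq (map (ent id (uncovered p)) (score1 (uncovered p) v)))
  = active (uncovered p) v.
  by rewrite /active; case: score1.
case: ifP => _.
  rewrite /step1_go.
  have -> : info_of (mem1 p v) bits
    (enc_level id (uncovered p) (level_star (uncovered p) v)) =
      info id (uncovered p) (prio_at (phase_time p)) v.
    rewrite /info_of /info; congr (Cons _ (Cons (of_seq _) (Cons _ (of_seq _)))).
      by rewrite /bits of_seqK [m_id _]/(I v) /I /of_id of_seqK -map_cat.
    by rewrite [to_seq _]of_seqK map_hd_ent.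
  by [].
congr (Cons _ (Cons _ (Cons _ (of_seq _)))).
rewrite [to_seq (m_nbrs _)]of_seqK [to_seq _]of_seqK -map_comp;
  apply: eq_map => u /=.
by rewrite dmem_map.
Qed.

Lemma conf2 p : conf (live p) (mem1 p) (ent id (uncovered p)) (out_of p)
    (run spanner_alg id w (phase_time p)) ->
  conf (active (uncovered p)) (mem2 p)
    (info id (uncovered p) (prio_at (phase_time p)))
    (out_of p) (run spanner_alg id w (phase_time p).+1).
Proof.
move=> H; apply: conf_round H _ _ _ => //; first exact: live_active.
by move=> v lv; exact: local_step_start.
Qed.

Lemma conf3 p :
  conf (active (uncovered p)) (mem2 p)
    (info id (uncovered p) (prio_at (phase_time p)))
    (out_of p) (run spanner_alg id w (phase_time p).+1) ->
  conf (active (uncovered p)) (mem3 p) (ballots p)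
    (out_of p) (run spanner_alg id w (phase_time p).+2).
Proof.
move=> H; apply: conf_round H _ _ _ => // v lv; rewrite lv.
set bits := of_seq _; set msgs := inbox _ _ _.
rewrite -[LHS]/(step2 (mem2 p v) msgs) /step2.
suff -> : step2_votes (mem2 p v) msgs = ballots p v by [].
rewrite /step2_votes /ballots; congr of_seq.
rewrite [m_id _]/(I v) [to_seq _]of_seqK -dvotes_info //; congr dvotes.
rewrite -[hd (m_aux _)]/(info id (uncovered p) (prio_at (phase_time p)) v).
rewrite /voters /= lv /=; congr cons; rewrite /msgs /inbox.
by elim: (neighbours v) => //= u s ->; case: (active _ u).
Qed.

Lemma size_mine p v : active (uncovered p) v ->
  size (dmine (mem3 p v) (inbox (active (uncovered p)) (ballots p) v)) =
  size (mine (uncovered p) (prio_at (phase_time p)) v).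
Proof.
move=> lv; rewrite /dmine /mine [m_id _]/(I v) -[tl (m_aux _)]/(ballots p v).
have -> : ballots p v :: inbox (active (uncovered p)) (ballots p) v =
    [seq if active (uncovered p) u then ballots p u else Nil |
      u <- v :: neighbours v].
  by rewrite /= lv.
elim: (v :: neighbours v) => // u s IH.
rewrite !map_cons /flatten [foldr _ _ (_ :: _)]/= [in RHS]/= filter_cat
  !size_cat IH; congr (_ + _).
case: (active _ u) => /=; last by rewrite filter_pred0.
rewrite of_seqK filter_map size_map; congr size; apply: eq_filter => b /=.
apply/data_eqP/eqP => [E|-> //].
by apply: (inj_map (of_id_inj id_inj)); apply: of_seq_inj.
Qed.

Lemma dadd_added p v : active (uncovered p) v ->
  dadd (mem3 p v) (inbox (active (uncovered p)) (ballots p) v) =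
  added (uncovered p) (prio_at (phase_time p)) v.
Proof.
move=> lv; rewrite /dadd /added lv andTb.
rewrite [to_seq (tl _)]of_seqK dpairs_ent // size_map; congr (_ <= _).
rewrite -size_mine //; set s := dmine _ _.
by rewrite /four !size_cat; lia.
Qed.

Lemma conf4 p :
  conf (active (uncovered p)) (mem3 p) (ballots p)
    (out_of p) (run spanner_alg id w (phase_time p).+2) ->
  conf (active (uncovered p)) (mem4 p) (new_star p)
    (out_of p) (run spanner_alg id w (phase_time p).+3).
Proof.
move=> H; apply: conf_round H _ _ _ => // v lv; rewrite lv.
set bits := of_seq _; set msgs := inbox _ _ _.
rewrite -[LHS]/(step3 (mem3 p v) msgs) /step3.
have -> : step3_star (mem3 p v) msgs = new_star p v.
  by rewrite /step3_star dadd_added.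
rewrite dadd_added // /mem4 /selected /= -/(selected p) -/(uncovered p) /gain.
congr (send (mk_mem _ _ _ _ _ _ _)); case: ifP => _; last by rewrite cats0.
by rewrite !of_seqK map_cat.
Qed.

Lemma star_neighbours (U : {set G * G}) v : active U v ->
  {subset star U v <= neighbours v}.
Proof. by move=> /level_star_spec [i [_ [[]]]]. Qed.

Lemma new_star_dmem p a x : dmem (I a) (to_seq (new_star p x)) =
  added (uncovered p) (prio_at (phase_time p)) x && (a \in cstar (uncovered p) x).
Proof. by rewrite /new_star; case: ifP => // _; rewrite of_seqK dmem_map. Qed.

(** A star that covers a pair at [v] is centred at [v] or at a neighbour of [v], so one round of
    messages tells [v] what has been covered. *)
Lemma unc_next p v : unc (uncovered p.+1) v =
  [seq b <- unc (uncovered p) v |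
    ~~ has (fun st => dmem (I v) (to_seq st) && dmem (I b) (to_seq st))
         [seq new_star p u | u <- v :: neighbours v]].
Proof.
rewrite /unc -filter_predI; apply: eq_filter => b.
rewrite /uncovered [state p.+1]/= -/(uncovered p) inE andbC /=; congr (_ && _).
congr (~~ _); rewrite -[_ ||
  _]/(has _ [seq new_star p u | u <- v :: neighbours v]) has_map.
apply/existsP/hasP => [[x /and3P[ax vx bx]]|[x _ /=]]; last first.
  by rewrite !new_star_dmem => /andP[/andP[ax vx] /andP[_ bx]]; exists x;
    rewrite ax vx.
exists x; last by rewrite /= !new_star_dmem ax vx bx.
move: vx; rewrite !inE => /orP[/eqP->|]; first by rewrite eqxx.
move=> /star_neighbours; rewrite mem_neighbours mem_neighbours adj_sym => -> //;
  first by rewrite orbT.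
by case/andP: ax.
Qed.

Lemma selected_inactive p v : ~~ active (uncovered p) v ->
  selected p.+1 v = selected p v.
Proof.
by move=> /negbTE nv; rewrite /selected /= -/(uncovered p) /gain /added nv cats0.
Qed.

Lemma conf5 p :
  conf (active (uncovered p)) (mem4 p) (new_star p)
    (out_of p) (run spanner_alg id w (phase_time p).+3) ->
  conf (live p.+1) (mem1 p.+1) (ent id (uncovered p.+1))
    (out_of p.+1) (run spanner_alg id w (phase_time p.+1)).
Proof.
move=> H; apply: conf_round H _ _ _ => // v lv; last first.
  by rewrite /out_of selected_inactive.
rewrite /= lv; set bits := of_seq _; set msgs := inbox _ _ _.
rewrite -[LHS]/(step4 (mem4 p v) msgs) /step4.
suff -> : step4_U (mem4 p v) msgs = encs (unc (uncovered p.+1) v) by [].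
rewrite /step4_U unc_next [to_seq (m_U _)]of_seqK; congr of_seq.
rewrite filter_map; congr map; apply: eq_filter => b /=; congr (~~ _).
rewrite -[m_id _]/(I v) -[m_aux _]/(new_star p v); congr (_ || has _ _).
rewrite /msgs /inbox; apply: eq_map => u.
by rewrite /new_star /added; case: (active _ u).
Qed.

Lemma conf1 p : conf (live p) (mem1 p) (ent id (uncovered p)) (out_of p)
    (run spanner_alg id w (phase_time p)).
Proof.
elim: p => [|p /conf2/conf3/conf4/conf5 //].
move=> v; rewrite /live /run /round /= /spanner_alg /= /local_step.
have -> : is_cons (hd (hd (hd (Cons (of_id id v) (encs (neighbours v)))))) = false.
  by rewrite /= /of_id; case: (id v) => // [[]].
have Eu : unc (uncovered 0) v = neighbours v.
  by apply/all_filterP/allP => b; rewrite mem_neighbours inE.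
by rewrite /step0 decode_send /mem1 /state_mem /ent Eu.
Qed.

Lemma halted_inactive p v : ~~ active (uncovered p) v ->
  halted spanner_alg id w (phase_time p).+1 v.
Proof.
by move=> /negbTE nv; have := conf2 (conf1 p) v; rewrite nv /halted => -[-> _].
Qed.

Lemma active_unc (U : {set G * G}) v : active U v -> exists e, e \in U.
Proof.
move=> act; have [i [_ [[TN Tk] _ _] S0 _]] := level_star_spec act.
case: (star U v) S0 Tk => // u s _ /(_ u (mem_head _ _)).
rewrite /udeg; case E: [seq _ <- _ | _] => [|b t]; first by rewrite leqn0 expn_eq0.
have : b \in [seq b <- unc U u | b \in v :: u :: s] by rewrite E mem_head.
by rewrite mem_filter mem_unc => /andP[_ /andP[_ ubU]] _; exists (u, b).
Qed.

Lemma terminated_uncovered p : uncovered p = set0 ->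
  terminated spanner_alg id (phase_time p).+1 w.
Proof.
move=> U0; apply/forallP => v; apply: halted_inactive;
  apply/negP => /active_unc [e].
by rewrite U0 inE.
Qed.

Lemma output_selected p : uncovered p = set0 ->
  output spanner_alg id w (phase_time p).+1 =
  [set [set x.1; x.2] | x : G * G & adj x.1 x.2 && (x.2 \in selected p x.1)].
Proof.
move=> U0.
have E x : adj x.1 x.2 && selects spanner_alg id w (phase_time p).+1 x.1 x.2 =
    adj x.1 x.2 && (x.2 \in selected p x.1).
  case: x => a b /=; case ab: (adj a b) => //=; rewrite /selects.
  have na : active (uncovered p) a = false.
    by apply: negbTE; apply/negP => /active_unc [e]; rewrite U0 inE.
  have := conf2 (conf1 p) a; rewrite na => -[-> _] /=.
  rewrite /out_of (nth_map a) ?index_mem ?mem_neighbours // nth_index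
    ?mem_neighbours //.
  by case: (b \in _).
by apply/setP => e; apply/imsetP/imsetP => -[x xP ->]; exists x => //; move: xP;
  rewrite !inE E.
Qed.
End Run.

(** * The lexicographic order on priorities *)

Lemma blexle_refl s : blexle s s.
Proof. by elim: s => //= a s ->; rewrite eqxx. Qed.

Lemma blexle_total s t : blexle s t || blexle t s.
Proof.
by elim: s t => [|a s IH] [|b t] //=; rewrite eq_sym; case: eqP => [_|];
  [exact: IH | case: a; case: b].
Qed.

Lemma blexle_anti s t : blexle s t -> blexle t s -> s = t.
Proof.
elim: s t => [|a s IH] [|b t] //=; rewrite (eq_sym b).
by case: eqP => [->|] h1 h2 //; [rewrite (IH t) | case: a b h1 h2 => [] []].
Qed.

Lemma blexle_trans t s u : blexle s t -> blexle t u -> blexle s u.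
Proof.
elim: t s u => [|b t IH] [|a s] [|c u] //=.
have [->|ab] := eqVneq a b; first by have [_|bc] := eqVneq b c; [exact: IH|].
have [<-|bc] := eqVneq b c; first by rewrite (negbTE ab).
by move: ab bc; case: a; case: b; case: c.
Qed.

Lemma leq_size_sumn (T : eqType) (f : T -> nat) k s :
  {in s, forall a, k <= f a} -> k * size s <= sumn (map f s).
Proof.
elim: s => [|a s IH] H; first by rewrite muln0.
rewrite mulnS leq_add ?H ?mem_head //.
by apply: IH => b bs; rewrite H // inE bs orbT.
Qed.

(** * Pairs spanned by a star, and cores of a prescribed level *)

Section Pairs.
Variables (G : sgraph) (U : {set G * G}).
Hypothesis symU : forall a b, (a, b) \in U -> (b, a) \in U.
Hypothesis adjU : forall a b, (a, b) \in U -> adj a b.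

Lemma size_pairs (s : seq G) (P : G -> pred G) : uniq s ->
  size (flatten [seq [seq b <- unc U a | P a b] | a <- s]) =
  #|[set e in U | (e.1 \in s) && P e.1 e.2]|.
Proof.
move=> us; pose l := [seq (a, b) | a <- s, b <- [seq b <- unc U a | P a b]].
have -> : size (flatten [seq [seq b <- unc U a | P a b] | a <- s]) = size l.
  rewrite size_allpairs_dep size_flatten /shape -map_comp; congr sumn.
have ul : uniq l.
  apply: allpairs_uniq_dep => //; first by move=> a _; do 2!apply: filter_uniq;
    exact: uniq_neighbours.
  by move=> [a b] [c d] _ _ /= [-> ->].
rewrite -(card_uniqP ul); apply: eq_card => -[a b]; rewrite inE /=.
apply/allpairsPdep/and3P => [[x [y [xs]]]|[abU aS Pab]].
  by rewrite mem_filter mem_unc => /and3P[Pxy _ xyU] [-> ->].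
by exists a, b; rewrite mem_filter mem_unc Pab (adjU abU) abU.
Qed.

Lemma udeg_card S u : udeg U S u = #|[set b | ((u, b) \in U) && (b \in S)]|.
Proof.
have us : uniq [seq b <- unc U u | b \in S] by do 2!apply: filter_uniq;
  exact: uniq_neighbours.
rewrite /udeg -(card_uniqP us); apply: eq_card => b.
rewrite inE mem_filter mem_unc andbC; case ub: ((u, b) \in U); rewrite ?andbF //=.
by rewrite (adjU ub).
Qed.

(** Unlike [star], whose level may fall from phase to phase, this core at a fixed level is monotone
    in [U], so that a potential can follow it through the execution. *)
Definition kcore v k := iter (size (base U v)) (peel U v k) (base U v).

Lemma greatest_kcore v k : 0 < k -> greatest U v k (kcore v k).
Proof.
move=> k0; apply: greatest_iter_peel => //; [exact: base_uniq|exact: base_sub|].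
by move=> T; apply: feasible_base.
Qed.

Lemma greatest_eq v k S T : greatest U v k S -> greatest U v k T -> S =i T.
Proof.
move=> [fS _ gS] [fT _ gT] x; apply/idP/idP; [exact: gT fS x | exact: gS fT x].
Qed.

Definition kpairs k x : {set G * G} :=
  [set e in U | (e.1 \in x :: kcore x k) && (e.2 \in x :: kcore x k)].

Definition cpairs x : {set G * G} :=
  [set e in U | [&& active U x, e.1 \in cstar U x & e.2 \in cstar U x]].

Lemma notin_star x : active U x -> x \notin star U x.
Proof.
by move=> act; apply/negP => /(star_neighbours act); rewrite mem_neighbours adj_irr.
Qed.

Lemma uniq_cstar x : active U x -> uniq (cstar U x).
Proof.
move=> act; rewrite /= notin_star //.
by have [i [_ [_ ]]] := level_star_spec act.
Qed.

Lemma size_pairs_cpairs x : active U x -> size (pairs U x) = #|cpairs x|.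
Proof.
move=> act; rewrite /pairs (@size_pairs (cstar U x) (fun _ b =>
  b \in cstar U x)) ?uniq_cstar //.
by apply: eq_card => e; rewrite !inE act.
Qed.

(** Each leaf is the first end of at least [level U x] of the pairs. *)
Lemma level_star_pairs x : active U x -> level U x * size (star U x) <= #|cpairs x|.
Proof.
move=> act; rewrite -size_pairs_cpairs // size_flatten /shape -map_comp /=.
apply: leq_trans (leq_addl _ _).
have [i [-> [[_ Tk] _ _] _ _]] := level_star_spec act.
exact: leq_size_sumn.
Qed.

Lemma level_gt0 x : active U x -> 0 < level U x.
Proof. by move=> /level_star_spec [i [-> _ _ _]]; rewrite expn_gt0. Qed.

(** Only powers of two are tried, so a feasible [k] may exceed the level, but by less than a factor
    of two. *)
Lemma level_max x k T : active U x -> 0 < k -> feasible U x k T -> T != [::] ->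
  k < (level U x).*2.
Proof.
move=> act k0 fT; rewrite ltnNge -mul2n; have [i [-> _ _ H]] := level_star_spec act.
by rewrite -expnS; apply: contra => ki; rewrite (H T) //; exact: feasible_le fT.
Qed.

Lemma active_kcore k x : 0 < k -> (kcore x k != [::]) -> active U x.
Proof.
move=> k0 ne; apply/active_feasible; exists k, (kcore x k); split=> //.
by have [] := greatest_kcore x k0.
Qed.

Lemma kcore_level x : active U x -> kcore x (level U x) =i star U x.
Proof.
move=> act; have [i [Ei gs _ _]] := level_star_spec act.
by apply: (greatest_eq (k := level U x));
  [exact/greatest_kcore/level_gt0 | rewrite Ei].
Qed.

Lemma kcore_nil_level k x : 0 < k -> active U x -> (kcore x k != [::]) ->
  k < (level U x).*2.
Proof.
by move=> k0 act ne; apply: level_max ne => //; have [] := greatest_kcore x k0.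
Qed.

Lemma kpairs_nil k x : kcore x k = [::] -> kpairs k x = set0.
Proof.
move=> E; apply/setP => -[a b]; rewrite !inE /= E !in_nil !orbF.
apply/negP => /and3P[/adjU ab /eqP Ea /eqP Eb].
by move: ab; rewrite Ea Eb adj_irr.
Qed.

Lemma kpairs_level x : active U x -> kpairs (level U x) x = cpairs x.
Proof.
move=> act; apply/setP => e; rewrite !inE act /=.
by rewrite !(kcore_level act).
Qed.

Lemma cpairs_neq0 x : active U x -> cpairs x != set0.
Proof.
move=> act; rewrite -card_gt0; apply: leq_trans (level_star_pairs act).
have [i [_ _ s0 _]] := level_star_spec act.
by rewrite muln_gt0 level_gt0 //; case: (star U x) s0.
Qed.

Lemma pair_active a b : (a, b) \in U -> active U a.
Proof.
move=> abU; apply/active_feasible; exists 1, [:: b]; split=> //.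
by apply: adjacent_feasible (adjU abU); exact: symU.
Qed.
End Pairs.

(** The core for [U'] is feasible for [U] and thus contained in the greatest such set. *)
Lemma kpairs_mono (G : sgraph) (U U' : {set G * G}) k x : 0 < k -> U' \subset U ->
  kpairs U' k x \subset kpairs U k x.
Proof.
move=> k0 s; apply/subsetP => e; rewrite !inE => /and3P[/(subsetP s) -> h1 h2] /=.
have [f1 _ _] := greatest_kcore U' x k0; have [_ _ g2] := greatest_kcore U x k0.
have sub := g2 _ (feasible_mono s f1).
by case/orP: h1 => [->|/sub ->]; case/orP: h2 => [->|/sub ->]; rewrite ?orbT.
Qed.

(** * Votes and bought stars as sets of pairs *)

Section Voting.
Variables (G : sgraph) (U : {set G * G}) (prio : G -> seq bool).
Hypothesis symU : forall a b, (a, b) \in U -> (b, a) \in U.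
Hypothesis adjU : forall a b, (a, b) \in U -> adj a b.
Hypothesis prio_inj : injective prio.

Definition cand (e : G * G) : {set G} := [set x | x \in cands U e.1 e.2].

Definition first_in (D : {set G}) x := (x \in D) &&
  [forall y in D, blexle (prio y) (prio x)].

Definition ballot v : {set G * G} := [set e in U | first_in (cand e) v].

Lemma vote_first a b v : (vote U prio a b == [:: v]) = first_in (cand (a, b)) v.
Proof.
have uc : uniq (cands U a b).
  do 3!apply: filter_uniq; rewrite /= uniq_neighbours mem_neighbours adj_irr //.
rewrite /vote; apply/eqP/andP => [E|[vc /forall_inP vm]].
  have : v \in vote U prio a b by rewrite /vote E mem_head.
  rewrite mem_filter => /andP[/allP vm vc]; split; first by rewrite inE.
  by apply/forall_inP => y; rewrite inE => /vm.
rewrite inE /= in vc.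
have -> : [seq x <- cands U a b |
  all (fun y => blexle (prio y) (prio x)) (cands U a b)] =
   [seq x <- cands U a b | pred1 v x].
  apply: eq_in_filter => x xc /=; apply/allP/eqP => [xm|-> y yc];
    last by rewrite vm // inE.
  by apply: prio_inj; apply: blexle_anti; [rewrite vm ?inE | exact: xm].
by rewrite filter_pred1_uniq.
Qed.

Lemma mem_cand e x : (x \in cand e) = [&& (x == e.1) || adj e.1 x, active U x,
  all (fun y => level U y <= level U x) (voters U e.1),
    e.1 \in cstar U x & e.2 \in cstar U x].
Proof.
rewrite inE mem_filter mem_filter mem_filter (in_cons _ (neighbours e.1))
  mem_neighbours.
have H (p q r s t : bool) : (s && t) && (r && (q && p)) = [&& p, q, r, s & t].
  by case: p q r s t => [] [] [] [] [].
exact: H.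
Qed.

Lemma size_mine_ballot v : size (mine U prio v) = #|ballot v|.
Proof.
rewrite /mine (@size_pairs _ _ adjU _ (fun a b =>
  active U a && (vote U prio a b == [:: v]))).
  apply: eq_card => -[a b]; rewrite !inE /= vote_first.
  case abU: ((a, b) \in U) => //=; rewrite (pair_active symU adjU abU) /=.
  apply/andb_idl => /andP[]; rewrite mem_cand /= => /andP[].
  by rewrite mem_neighbours adj_sym eq_sym.
by rewrite /= uniq_neighbours mem_neighbours adj_irr.
Qed.

Lemma addedE v : added U prio v = active U v && (#|cpairs U v| <= 8 * #|ballot v|).
Proof.
by rewrite /added; case act: (active U v) => //=;
  rewrite size_mine_ballot size_pairs_cpairs.
Qed.

Lemma ballot_cpairs v : ballot v \subset cpairs U v.
Proof.
apply/subsetP => e; rewrite inE => /andP[eU /andP[]].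
by rewrite mem_cand [e \in cpairs _ _]inE eU => /and5P[_ -> _ -> ->].
Qed.

Lemma ballot_disjoint e v v' : e \in ballot v -> e \in ballot v' -> v = v'.
Proof.
rewrite !inE => /andP[_ /andP[vc /forall_inP vm]]
  /andP[_ /andP[v'c /forall_inP v'm]].
by apply: prio_inj; apply: blexle_anti; [exact: v'm | exact: vm].
Qed.

(** The voter compares levels over its whole closed neighbourhood before it asks which stars span
    the edge. Hence the bound also applies to a vertex [x] whose current star does not span [e],
    such as the centre in the optimum to which [e] is assigned. *)
Lemma ballot_level e v x : e \in ballot v -> active U x ->
  (x == e.1) || adj e.1 x -> level U x <= level U v.
Proof.
rewrite !inE => /andP[_ /andP[]]; rewrite mem_cand =>
  /and5P[_ _ /allP H _ _] _ act xe.
by apply: H; rewrite mem_filter act inE mem_neighbours.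
Qed.

Lemma added_next e v : added U prio v -> e \in cpairs U v -> e \notin nextU U prio.
Proof.
rewrite inE => av /and4P[eU _ e1 e2]; rewrite inE eU /= negbK.
by apply/existsP; exists v; rewrite av e1 e2.
Qed.

(** If each vote at level [k] pays [8 / k], the votes for a bought star pay for all its leaves. *)
Lemma gain_cost v : added U prio v -> level U v * size (star U v) <= 8 *
  #|ballot v|.
Proof.
rewrite addedE => /andP[act]; apply: leq_trans; exact: level_star_pairs.
Qed.

End Voting.

(** * Stars of globally maximal level *)

Section MaxLevel.
Variables (G : sgraph) (U : {set G * G}) (prio : G -> seq bool).
Hypothesis symU : forall a b, (a, b) \in U -> (b, a) \in U.
Hypothesis adjU : forall a b, (a, b) \in U -> adj a b.
Hypothesis prio_inj : injective prio.
Variable i : nat.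
Hypothesis level_le : forall x, active U x -> level U x <= 2 ^ i.

Definition centres (e : G * G) : {set G} := [set x | e \in kpairs U (2 ^ i) x].

(** A nonempty core at [2 ^ i] forces a level above [2 ^ i / 2]; being a power of two and at most
    [2 ^ i], the level equals [2 ^ i]. *)
Lemma kpairs_max e x :
  (e \in kpairs U (2 ^ i) x) = [&& active U x,
    level U x == 2 ^ i & e \in cpairs U x].
Proof.
have i0 : 0 < 2 ^ i by rewrite expn_gt0.
apply/idP/and3P => [ex|[act /eqP lx ex]]; last by rewrite -lx kpairs_level.
have ne : kcore U x (2 ^ i) != [::].
  by apply: contraTneq ex => /(kpairs_nil adjU) ->; rewrite inE.
have act := active_kcore i0 ne.
have lx : level U x = 2 ^ i.
  have := kcore_nil_level i0 act ne; have := level_le act.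
  have [j [-> _ _ _]] := level_star_spec act.
  rewrite leq_exp2l // -mul2n -expnS ltn_exp2l // ltnS => ji ij.
  by congr (2 ^ _); apply/eqP; rewrite eqn_leq ji ij.
by rewrite act lx eqxx -kpairs_level // lx.
Qed.

(** If some star of the maximal level spans [e], its centre is visible to the voter, so the local
    comparison of levels agrees with the global one. The number of candidates is then known
    exactly. *)
Lemma candE e : e \in U -> centres e != set0 -> cand U e = centres e.
Proof.
move=> eU /set0Pn [z]; rewrite inE kpairs_max => /and3P[actz /eqP lz ez].
have near x : active U x -> e.1 \in cstar U x -> (x == e.1) || adj e.1 x.
  move=> act; rewrite inE => /orP[/eqP->|/(star_neighbours act)];
    first by rewrite eqxx.
  by rewrite mem_neighbours adj_sym orbC => ->.
have inC x : active U x -> (e \in cpairs U x) = (e.1 \in cstar U x) &&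
  (e.2 \in cstar U x).
  by move=> act; rewrite inE eU act.
apply/setP => x; rewrite [in RHS]inE kpairs_max mem_cand.
apply/and5P/and3P => [[_ act /allP H e1 e2]|[act /eqP lx ex]].
  rewrite act inC // e1 e2 eqn_leq level_le //= -lz H //.
  move: ez; rewrite inC // => /andP[ez1 _].
  by rewrite mem_filter actz inE mem_neighbours near.
move: ex; rewrite inC // => /andP[e1 e2]; rewrite act e1 e2 near //; split=> //.
by apply/allP => y; rewrite mem_filter => /andP[acty _]; rewrite lx level_le.
Qed.

Lemma first_in_seq (s : seq G) : s != [::] ->
  exists2 v, v \in s & {in s, forall y, blexle (prio y) (prio v)}.
Proof.
elim: s => // a [|b s] IH _.
  by exists a; rewrite ?mem_head // => y; rewrite inE => /eqP->; exact: blexle_refl.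
have [//|v vs H] := IH.
have [av|va] := orP (blexle_total (prio a) (prio v)).
  exists v; first by rewrite inE vs orbT.
  by move=> y; rewrite inE => /orP[/eqP->|/H].
exists a; first exact: mem_head.
move=> y; rewrite inE => /orP[/eqP->|/H yv]; first exact: blexle_refl.
exact: blexle_trans yv va.
Qed.

Lemma first_in_exists (D : {set G}) : D != set0 -> exists v, first_in prio D v.
Proof.
move=> D0; have [|v vD H] := @first_in_seq (enum D).
  by apply: contraNneq D0 => E; rewrite -cards_eq0 cardE E.
exists v; rewrite /first_in -mem_enum vD; apply/forall_inP => y;
  rewrite -mem_enum; exact: H.
Qed.

(** Among the vertices of maximal level, the one of highest priority gets the votes of all pairs of
    its star. *)
Lemma exists_added x : active U x -> level U x = 2 ^ i -> exists v, added U prio v.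
Proof.
move=> actx lx; pose D := [set y | active U y && (level U y == 2 ^ i)].
have [|v /andP[]] := @first_in_exists D.
  by apply/set0Pn; exists x; rewrite inE actx lx eqxx.
rewrite inE => /andP[act /eqP lv] /forall_inP H; exists v.
rewrite addedE // act; apply: leq_trans (leq_pmull _ _) => //;
  apply: subset_leq_card.
apply/subsetP => e ev; have eU : e \in U by move: ev; rewrite inE => /andP[].
have vc : v \in centres e by rewrite inE kpairs_max act lv eqxx.
rewrite inE eU candE //; last by apply/set0Pn; exists v.
rewrite /first_in vc; apply/forall_inP => y; rewrite inE kpairs_max =>
  /and3P[acty ly _].
by apply: H; rewrite inE acty.
Qed.

End MaxLevel.

Lemma exists_max_level (G : sgraph) (U : {set G * G}) x0 : active U x0 ->
  exists i x, [/\ active U x, level U x = 2 ^ i &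
    forall y, active U y -> level U y <= 2 ^ i].
Proof.
move=> act0; case: (arg_maxnP (level U) act0) => x act H.
by have [i [E _ _ _]] := level_star_spec act; exists i, x; rewrite -E.
Qed.

Lemma nextU_proper (G : sgraph) (U : {set G * G}) (prio : G -> seq bool) :
  (forall a b, (a, b) \in U -> (b, a) \in U) ->
    (forall a b, (a, b) \in U -> adj a b) ->
  injective prio -> U != set0 -> nextU U prio \proper U.
Proof.
move=> symU adjU prio_inj /set0Pn [[a b] abU].
have [i [x [act lx lmax]]] := exists_max_level (pair_active symU adjU abU).
have [v av] := exists_added symU adjU prio_inj lmax act lx.
have actv : active U v by case/andP: av.
apply/properP; split; first by apply/subsetP => e; rewrite inE => /andP[].
have /set0Pn [e ev] := cpairs_neq0 adjU actv; exists e; last exact: added_next ev.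
by move: ev; rewrite inE => /andP[].
Qed.

Lemma size_draw r n : size (draw r n) = n.
Proof. by rewrite size_rev size_mkseq. Qed.

(** * Termination for every outcome of the coins *)

Section Termination.
Variables (G : sgraph) (id : G -> seq bool).
Hypothesis id_inj : injective id.
Variable w : coins G.

Lemma prio_at_inj t : injective (prio_at id w t).
Proof.
move=> u v; rewrite /prio_at => /eqP; rewrite eqseq_cat ?size_draw //.
by move=> /andP[_ /eqP /id_inj].
Qed.

Lemma uncovered_adj p a b : (a, b) \in uncovered id w p -> adj a b.
Proof.
elim: p => [|p IH]; first by rewrite inE.
by move=> /(subsetP (uncovered_sub id w p)) /IH.
Qed.

Lemma uncovered_proper p : uncovered id w p != set0 ->
  uncovered id w p.+1 \proper uncovered id w p.
Proof.
apply: nextU_proper; [exact: uncovered_sym | exact: uncovered_adj |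
  exact: prio_at_inj].
Qed.

Lemma card_uncovered p : uncovered id w p = set0 \/ #|uncovered id w p|
  + p <= #|G| ^ 2.
Proof.
elim: p => [|p [IH|IH]].
- by right; rewrite addn0 (leq_trans (max_card _)) // card_prod mulnn.
- by left; apply/eqP; rewrite -subset0 -IH uncovered_sub.
have [E|ne] := eqVneq (uncovered id w p) set0.
  by left; apply/eqP; rewrite -subset0 -E uncovered_sub.
by right; have := proper_card (uncovered_proper ne); lia.
Qed.

Lemma uncovered_final : uncovered id w (#|G| ^ 2).+1 = set0.
Proof. by have [//|] := card_uncovered (#|G| ^ 2).+1; lia. Qed.

Lemma active_bound p v : active (uncovered id w p) v -> p <= #|G| ^ 2.
Proof.
move=> /active_unc [e eU]; have [U0|] := card_uncovered p; last by lia.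
by move: eU; rewrite U0 inE.
Qed.

End Termination.

(** * Polynomial local computation *)

Section SizeBound.
Variable X : nat.
Hypothesis X10 : 10 <= X.

(** All bounds are powers of [X], so that a list or a pair costs a bounded
    increase of the exponent. *)
Definition small a d := data_size d < X ^ a.

Lemma small_le a b d : a <= b -> small a d -> small b d.
Proof.
by move=> ab; rewrite /small => /leq_trans; apply; rewrite leq_exp2l //; lia.
Qed.

Lemma small_cons a b c x y : small a x -> small b y -> a < c -> b < c ->
  small c (Cons x y).
Proof.
move=> sx sy ac bc; have {sx} := small_le (ltac:(lia) : a <= c.-1) sx.
have {sy} := small_le (ltac:(lia) : b <= c.-1) sy.
case: c ac bc => // c _ _ /=; rewrite /small /= expnS => h1 h2.
have : 2 * X ^ c <= X * X ^ c by rewrite leq_mul2r; apply/orP; right; lia.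
by lia.
Qed.

Lemma small_seq a b c s : size s <= X ^ a ->
  (forall d, List.In d s -> small b d) ->
  a + b < c -> small c (of_seq s).
Proof.
move=> sa sb abc; apply: (@small_le (a + b).+1) => //.
have : data_size (of_seq s) <= 1 + size s * X ^ b.
  elim: s {sa} sb => //= d s IH sb.
  have := IH (fun x xs => sb x (or_intror xs)); have := sb d (or_introl erefl).
  by rewrite /small mulSn; lia.
have : size s * X ^ b <= X ^ (a + b) by rewrite expnD leq_mul2r sa orbT.
have : 0 < X ^ (a + b) by rewrite expn_gt0; lia.
rewrite /small expnS => h1 h2 h3.
have : 2 * X ^ (a + b) <= X * X ^ (a + b) by rewrite leq_mul2r; apply/orP;
  right; lia.
by lia.
Qed.

Lemma small_map (T : Type) (f : T -> data) a b c s : size s <= X ^ a ->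
  (forall x, small b (f x)) -> a + b < c -> small c (of_seq (map f s)).
Proof.
move=> sa fb; apply: small_seq; first by rewrite size_map.
by move=> d /List.in_map_iff [x [<- _]].
Qed.

Lemma small_const a d : data_size d < 10 -> 0 < a -> small a d.
Proof.
move=> d10 a0; rewrite /small; apply: leq_trans d10 _; apply: leq_trans X10 _.
by case: a a0 => // a _; rewrite expnS leq_pmulr // expn_gt0; lia.
Qed.

End SizeBound.

Section InputBound.
Variables (G : sgraph) (id : G -> seq bool).
Hypothesis id_inj : injective id.
Variable w : coins G.
Let X := instance_size id + 10.
Notation I := (of_id id).
Notation encs s := (of_seq (map I s)).

Let X10 : 10 <= X. Proof. exact: leq_addl. Qed.

Let cardX : #|G| + 10 <= X.
Proof. by rewrite /X /instance_size; lia. Qed.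

Lemma small_id v : small X 3 (I v).
Proof.
apply: (small_map X10 (a := 1) (b := 1)) => //; last first.
  by move=> b; apply: small_const => //; have := data_size_of_bool b; lia.
rewrite expn1 /X /instance_size.
by have := leq_bigmax v (F := fun v => size (id v)); lia.
Qed.

Lemma small_encs a c s : size s <= X ^ a -> a + 3 < c -> small X c (encs s).
Proof. by move=> sa; apply: small_map => //; exact: small_id. Qed.

Lemma size_neighbours (v : G) : (size (neighbours v)).+1 <= X.
Proof. by rewrite -cardE; have := max_card [pred u | adj v u]; lia. Qed.

Lemma size_star (U : {set G * G}) v : active U v -> size (cstar U v) <= X.
Proof.
move=> act; apply: leq_trans (size_neighbours v); rewrite /= ltnS.
apply: uniq_leq_size; last exact: star_neighbours.
by have := uniq_cstar act => /andP[].
Qed.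

Lemma size_unc (U : {set G * G}) v : size (unc U v) <= X.
Proof.
by rewrite size_filter (leq_trans (count_size _ _)) // ltnW // size_neighbours.
Qed.

Lemma level_le_X (U : {set G * G}) v : active U v -> level U v <= X.
Proof.
move=> act; apply: leq_trans (size_star act).
have [i [-> [[_ Tk] _ _] s0 _]] := level_star_spec act.
case E: (star U v) s0 Tk => [//|a s] _ Tk.
by apply: leq_trans (Tk a (mem_head _ _)) _; rewrite /cstar E; exact: udeg_le_size.
Qed.

Lemma size_vote (U : {set G * G}) prio a b : size (vote U prio a b) <= X.
Proof.
apply: leq_trans (size_neighbours a).
rewrite size_filter (leq_trans (count_size _ _)) // size_filter
  (leq_trans (count_size _ _)) //.
by rewrite size_filter (leq_trans (count_size _ _)) // size_filter count_size.
Qed.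

Lemma size_pairs_X (U : {set G * G}) v : (forall a b, (a, b) \in U -> adj a b) ->
  active U v -> size (pairs U v) <= X ^ 2.
Proof.
move=> adjU act; rewrite size_pairs_cpairs //; apply: leq_trans (max_card _) _.
by rewrite card_prod -mulnn leq_mul //; lia.
Qed.

Lemma size_selected p v : size (selected id w p v) <= p * X.
Proof.
elim: p => // p IH; rewrite /selected /= -/(selected id w p) size_cat mulSn addnC.
rewrite leq_add // /gain; case: ifP => // /andP[act _].
exact: leq_trans (leqnSn _) (size_star act).
Qed.

Lemma phase_X p : p <= (#|G| ^ 2).+2 -> phase_time p + 3 <= X ^ 3 /\ p * X <= X ^ 3.
Proof.
move=> pn; have h : (#|G| + 10) ^ 2 <= X ^ 2 by rewrite leq_exp2r.
have X2 : (#|G| ^ 2).+2 * 4 + 4 <= X ^ 2 * 4.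
  by rewrite sqrnD in h; lia.
have X3 : X ^ 2 * 10 <= X ^ 3 by rewrite (expnSr X 2) leq_mul2l X10 orbT.
split; first by rewrite /phase_time; lia.
by rewrite (expnSr X 2) leq_mul2r; apply/orP; right; lia.
Qed.

(** A running vertex is in one of quadratically many phases, so its unary clock and the priorities
    have polynomial length. *)
Lemma live_bound p v : live id w p v -> p <= (#|G| ^ 2).+1.
Proof. by case: p => // p /(active_bound id_inj). Qed.

Lemma small_ticks t : t <= X ^ 3 -> small X 5 (ticks t).
Proof.
move=> tX; apply: (small_seq X10 (a := 3) (b := 1)) => //;
  first by rewrite size_nseq.
move=> d dt; suff -> : d = tick by exact: small_const.
by elim: t {tX} dt => //= t IH [].
Qed.

Lemma small_mk_mem t stp (us ss : seq G) aux v a : t <= X ^ 3 ->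
  data_size stp < 10 -> size us <= X -> size ss <= X ^ 3 -> small X a aux ->
    10 <= a ->
  small X (a + 6) (mk_mem (ticks t) stp (I v) (encs (neighbours v)) (encs us)
    (encs ss) aux).
Proof.
move=> tX stp10 su ss3 sa a10; rewrite /mk_mem.
have st := small_ticks tX; have sn : size (neighbours v) <= X by exact:
  ltnW (size_neighbours v).
apply: (small_cons X10 (b := a + 5) st) => //; try lia.
apply: (small_cons X10 (b := a + 4) (small_const X10 stp10 (ltn0Sn 0))) => //;
  try lia.
apply: (small_cons X10 (b := a + 3) (small_id v)) => //; try lia.
apply: (small_cons X10 (a := 5) (b := a + 2)) => //; try lia.
  by apply: (small_encs (a := 1)); rewrite ?expn1.
apply: (small_cons X10 (a := 5) (b := a + 1)) => //; try lia.
  by apply: (small_encs (a := 1)); rewrite ?expn1.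
apply: (small_cons X10 (a := 8) (b := a)) => //; try lia.
by apply: (small_encs (a := 3)).
Qed.

Lemma small_state_mem t stp p aux v a : t <= X ^ 3 -> p <= (#|G| ^ 2).+1 ->
  data_size stp < 10 -> small X a aux -> 10 <= a ->
  small X (a + 6) (state_mem id w t stp p aux v).
Proof.
move=> tX pX stp10 sa a10; apply: small_mk_mem => //; first exact: size_unc.
exact: leq_trans (size_selected p v) (proj2 (phase_X (leqW pX))).
Qed.

Lemma small_info p v : live id w p v -> active (uncovered id w p) v ->
  small X 9 (info id (uncovered id w p) (prio_at id w (phase_time p)) v).
Proof.
move=> lv act; have pX := live_bound lv.
apply: (small_cons X10 (b := 8) (small_id v)) => //.
apply: (small_cons X10 (a := 6) (b := 7)) => //.
  apply: (small_map X10 (a := 4) (b := 1)) => //; last first.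
    by move=> b; apply: small_const => //; have := data_size_of_bool b; lia.
  rewrite size_cat size_draw; have [h _] := phase_X (leqW pX).
  have hi : size (id v) <= X.
    by rewrite /X /instance_size;
      have := leq_bigmax v (F := fun v => size (id v)); lia.
  have h1 : X <= X ^ 3 by rewrite -[X in X <= _]expn1 leq_exp2l; lia.
  have : X ^ 3 * 10 <= X ^ 4 by rewrite (expnSr X 3) leq_mul2l X10 orbT.
  by lia.
apply: (small_cons X10 (a := 3) (b := 5)) => //.
  apply: (small_seq X10 (a := 1) (b := 1)) => //;
    first by rewrite size_nseq expn1 level_le_X.
  by move=> d dt; apply: small_const => //; elim: (level _ _) dt => //= m IH [<-|].
apply: (small_encs (a := 1)) => //.
by rewrite expn1 ltnW // (size_star act).
Qed.

Lemma small_aux2 p v : live id w p v -> active (uncovered id w p) v ->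
  small X 10 (aux2 id w p v).
Proof.
move=> lv act; apply: (small_cons X10 (a := 9) (b := 6)) => //;
  first exact: small_info.
rewrite dpairs_ent //; apply: (small_encs (a := 2)) => //.
by apply: size_pairs_X => //; exact: uncovered_adj.
Qed.

Lemma small_ballots p v : small X 7 (ballots id w p v).
Proof.
apply: (small_map X10 (a := 1) (b := 5)) => //; first by rewrite expn1 size_unc.
by move=> b; apply: (small_encs (a := 1)) => //; rewrite expn1 size_vote.
Qed.

Lemma small_new_star p v : small X 5 (new_star id w p v).
Proof.
rewrite /new_star; case: ifP => [/andP[act _]|_]; last exact: small_const.
by apply: (small_encs (a := 1)) => //; rewrite expn1 size_star.
Qed.

Lemma small_inbox (live : pred G) msg v a : (forall u, live u ->
  small X a (msg u)) -> 0 < a ->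
  small X a.+2 (of_seq (inbox live msg v)).
Proof.
move=> H a0; apply: (small_map X10 (a := 1) (b := a)) => //.
  by rewrite expn1 ltnW // size_neighbours.
by move=> u; case: ifP => [/H //|_]; exact: small_const.
Qed.

Lemma phase_time_decomp t : t = 0 \/ exists p,
  [\/ t = phase_time p, t = (phase_time p).+1,
  t = (phase_time p).+2 | t = (phase_time p).+3].
Proof.
case: t => [|t]; [by left | right; exists (t %/ 4)]; rewrite /phase_time.
have := ltn_pmod t (ltn0Sn 3); have := divn_eq t 4.
case: (t %% 4) => [|[|[|[|//]]]] E _.
- by apply: Or41; lia.
- by apply: Or42; lia.
- by apply: Or43; lia.
- by apply: Or44; lia.
Qed.

Lemma small_local_input t v : ~~ halted spanner_alg id w t v ->
  small X 18 (local_input (run spanner_alg id w t) v).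
Proof.
have stop (live : pred G) mem msg out c : conf live mem msg out c ->
  ~~ isSome (decision (c v)) -> live v.
  by move=> /(_ v); case: (live v) => // -[-> _].
rewrite /halted; have [->|[p [] ->]] := phase_time_decomp t.
- move=> _ /=; apply: (small_cons X10 (a := 6) (b := 3)) => //.
    apply: (small_cons X10 (a := 3) (b := 5) (small_id v)) => //.
    by apply: (small_encs (a := 1)) => //; rewrite expn1 ltnW // size_neighbours.
  apply: (small_map X10 (a := 1) (b := 1)) => //;
    first by rewrite expn1 ltnW // size_neighbours.
  by move=> u; rewrite /message nth_nil; exact: small_const.
- move=> /(stop _ _ _ _ _ (conf1 id_inj w p)) lv; have pX := live_bound lv.
  rewrite (conf_input (conf1 id_inj w p) lv).
  apply: (small_cons X10 (a := 16) (b := 9)) => //.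
    apply: (@small_state_mem _ _ _ _ _ 10) => //; last exact: small_const.
    by have [] := phase_X (leqW pX); lia.
  apply: small_inbox => // u _;
    apply: (small_cons X10 (a := 3) (b := 5) (small_id u)) => //.
  by apply: (small_encs (a := 1)) => //; rewrite expn1 size_unc.
- have C := conf2 id_inj (conf1 id_inj w p).
  move=> /(stop _ _ _ _ _ C) act; have lv := live_active act;
    have pX := live_bound lv.
  rewrite (conf_input C act).
  apply: (small_cons X10 (a := 16) (b := 11)) => //.
    apply: (@small_state_mem _ _ _ _ _ 10) => //; last exact: small_aux2.
    by have [] := phase_X (leqW pX); lia.
  by apply: small_inbox => // u actu; apply: small_info => //; exact: live_active.
- have C := conf3 id_inj (conf2 id_inj (conf1 id_inj w p)).
  move=> /(stop _ _ _ _ _ C) act; have lv := live_active act;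
    have pX := live_bound lv.
  rewrite (conf_input C act).
  apply: (small_cons X10 (a := 17) (b := 9)) => //.
    apply: (@small_state_mem _ _ _ _ _ 11) => //.
      by have [] := phase_X (leqW pX); lia.
    by apply: (small_cons X10 (small_aux2 lv act) (small_ballots p v)).
  by apply: small_inbox => // u _; exact: small_ballots.
- have C := conf4 id_inj (conf3 id_inj (conf2 id_inj (conf1 id_inj w p))).
  move=> /(stop _ _ _ _ _ C) act; have lv := live_active act;
    have pX := live_bound lv.
  rewrite (conf_input C act).
  apply: (small_cons X10 (a := 16) (b := 9)) => //; last first.
    apply: (@small_le X X10 7) => //; apply: small_inbox => // u _;
      exact: small_new_star.
  have [h1 _] := phase_X (leqW pX); have [_ h2] :=
    phase_X (pX : p.+1 <= (#|G| ^ 2).+2).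
  rewrite /mem4; cbv zeta; apply: (@small_mk_mem _ _ _ _ _ v 10) => //;
    first by lia.
  - exact: size_unc.
  - exact: leq_trans (size_selected p.+1 v) h2.
  - by apply: (@small_le X X10 5) => //; exact: small_new_star.
Qed.

End InputBound.

Lemma spanner_alg_polynomial : polynomial_local_computation spanner_alg.
Proof.
have [c [e H]] := spanner_alg_poly_time.
(* The strict inequality in [small] absorbs the successor: [(data_size x).+1] is at most the 18th
   power of [instance_size id + 10]. *)
exists c, (('X + 10%:R%:P) ^+ (18 * e))%R => G id w t v _ id_inj nh x.
have [k [s [j [X E K]]]] := H (w t v) x.
exists k, s, j; split=> //; apply: leq_trans K _.
rewrite horner_exp hornerD hornerX hornerC !natrXE natrDE natn expnM.
have := small_local_input id_inj nh; rewrite /small -/x => sx.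
by case: (e) => // e'; rewrite leq_exp2r.
Qed.

(** * Approximation ratio *)

Section Spanner.
Variables (G : sgraph) (id : G -> seq bool).
Hypothesis id_inj : injective id.
Variable w : coins G.

Lemma set2_eq (T : finType) (a b c d : T) : [set a; b] = [set c; d] ->
  (a, b) = (c, d) \/ (a, b) = (d, c).
Proof.
move=> E; have : a \in [set c; d] by rewrite -E set21.
have : b \in [set c; d] by rewrite -E set22.
have : c \in [set a; b] by rewrite E set21.
have : d \in [set a; b] by rewrite E set22.
by rewrite !inE => /orP[]/eqP h1 /orP[]/eqP h2 /orP[]/eqP h3 /orP[]/eqP h4;
  subst; auto.
Qed.

Lemma edgesE (u v : G) : ([set u; v] \in edges G) = adj u v.
Proof.
apply/imsetP/idP => [[[a b]]|uv]; last by exists (u, v); rewrite ?inE.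
by rewrite inE /= => ab /set2_eq [] [-> ->] //; rewrite adj_sym.
Qed.

Lemma selected_neighbours p x : {subset selected id w p x <= neighbours x}.
Proof.
elim: p => // p IH u; rewrite /selected /= mem_cat => /orP[/IH //|].
by rewrite /gain; case: ifP => // /andP[act _] /(star_neighbours act).
Qed.

Lemma covered_selected p a b : adj a b -> (a, b) \notin uncovered id w p ->
  exists x, a \in x :: selected id w p x /\ b \in x :: selected id w p x.
Proof.
move=> ab; elim: p => [|p IH]; first by rewrite inE ab.
rewrite /uncovered /= -/(uncovered id w p) inE negb_and negbK.
rewrite /selected /= -/(selected id w p).
case/orP => [/IH [x [ax bx]]|/existsP[x /and3P[addx ax bx]]]; exists x.
  rewrite -!cat_cons !mem_cat ax bx //.
rewrite /gain addx; move: ax bx; rewrite !inE !mem_cat.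
by do 2!move=> /orP[->|->]; rewrite ?orbT.
Qed.

Lemma output_edges p : uncovered id w p = set0 ->
  forall a b, ([set a; b] \in output spanner_alg id w (phase_time p).+1) =
    (b \in selected id w p a) || (a \in selected id w p b).
Proof.
move=> U0 a b; rewrite output_selected //.
have nb x y : y \in selected id w p x -> adj x y.
  by move=> /selected_neighbours; rewrite mem_neighbours.
apply/imsetP/orP => [[[x y]]|[ab|ba]].
- by rewrite inE /= => /andP[_ xy] /set2_eq [] [-> ->]; [left|right].
- by exists (a, b); rewrite // inE /= ab nb.
- by exists (b, a); rewrite ?inE /= ?ba ?nb // setUC.
Qed.

Lemma output_spanner p : uncovered id w p = set0 ->
  two_spanner (output spanner_alg id w (phase_time p).+1).
Proof.
move=> U0; have OE := output_edges U0; split.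
  apply/subsetP => e /imsetP[[a b]]; rewrite inE /= => /andP[ab _] ->.
  by rewrite edgesE.
move=> u v; rewrite edgesE => uv.
have nuv : u == v = false by apply: contraTF uv => /eqP ->; rewrite adj_irr.
have [|x []] := covered_selected (p := p) uv; first by rewrite U0 inE.
rewrite !inE => /orP[/eqP ux|ux] /orP[/eqP vx|vx].
- by move: nuv; rewrite ux vx eqxx.
- by exists [:: v]; rewrite /= /edge_rel OE ux vx.
- by exists [:: v]; rewrite /= /edge_rel OE vx ux orbT.
- by exists [:: x; v]; rewrite /= /edge_rel !OE ux vx !orbT.
Qed.

Lemma card_output p : uncovered id w p = set0 ->
  #|output spanner_alg id w (phase_time p).+1| <= \sum_v size (selected id w p v).
Proof.
move=> U0; rewrite output_selected //.
apply: leq_trans (leq_imset_card _ _) _.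
rewrite -sum1_card (eq_bigl (fun x => adj x.1 x.2 &&
  (x.2 \in selected id w p x.1))); last first.
  by move=> x; rewrite !inE.
rewrite -(pair_big_dep xpredT (fun a b => adj a b && (b \in selected id w p a))
  (fun _ _ => 1)) /=.
apply: leq_sum => a _; rewrite sum1_card.
apply: leq_trans (card_size _); apply: subset_leq_card.
by apply/subsetP => b; rewrite unfold_in => /andP[].
Qed.

End Spanner.

(** * Dense neighbourhoods contain cores *)

Section Peeling.
Variables (G : sgraph) (U : {set G * G}).
Hypothesis symU : forall a b, (a, b) \in U -> (b, a) \in U.
Hypothesis adjU : forall a b, (a, b) \in U -> adj a b.

Definition inner (T : {set G}) : {set G * G} :=
  [set e in U | (e.1 \in T) && (e.2 \in T)].

Lemma inner1 v : inner [set v] = set0.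
Proof.
apply/setP => -[a b]; rewrite !inE /=; apply/negP =>
  /and3P[/adjU ab /eqP Ea /eqP Eb].
by move: ab; rewrite Ea Eb adj_irr.
Qed.

Lemma inner_del (T : {set G}) u : u \in T ->
  #|inner T| <= #|inner (T :\ u)| + 2 * #|[set b | ((u, b) \in U) && (b \in T)]|.
Proof.
move=> uT; set D := [set b | _].
have : inner T \subset inner (T :\ u) :|: (pair u @: D :|: (fun b => (b, u)) @: D).
  apply/subsetP => -[a b]; rewrite !inE /= => /and3P[abU aT bT].
  have [au|nau] := eqVneq a u.
    by apply/orP; right; apply/orP; left; apply/imsetP; exists b;
      rewrite ?inE -?au ?abU.
  have [bu|nbu] := eqVneq b u; last by rewrite abU aT bT.
  apply/orP; right; apply/orP; right; apply/imsetP; exists a; last by rewrite bu.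
  by rewrite inE -bu symU.
move=> /subset_leq_card /leq_trans; apply.
apply: leq_trans (leq_card_setU _ _) _; rewrite leq_add2l mul2n -addnn.
by apply: leq_trans (leq_card_setU _ _) _; rewrite leq_add // leq_imset_card.
Qed.

(** Deleting a vertex of low degree from a dense set keeps it dense. *)
Lemma dense_feasible v k (T : {set G}) : {in T, forall u, adj v u} -> T != set0 ->
  2 * k * #|T| <= #|inner (v |: T)| -> 0 < k ->
  exists S, S != [::] /\ feasible U v k S.
Proof.
move=> TN T0 dT k0; have [n] := ubnP #|T|.
elim: n T TN T0 dT => // n IH T TN T0 dT; rewrite ltnS => Tn.
have sE u : udeg U (v :: enum T) u = #|[set b | ((u, b) \in U) && (b \in v |: T)]|.
  by rewrite udeg_card //; apply: eq_card => b; rewrite !inE mem_enum.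
have [ok|] := boolP [forall u in T, k <= udeg U (v :: enum T) u].
  exists (enum T); split; first by rewrite -size_eq0 -cardE cards_eq0.
  split=> [u|u]; rewrite mem_enum; first by move=> /TN; rewrite mem_neighbours.
  by move=> uT; apply: (forall_inP ok).
move=> /forall_inPn [u uT]; rewrite -ltnNge sE => du.
have uv : u != v by apply: contraTneq (TN u uT) => ->; rewrite adj_irr.
have := @inner_del (v |: T) u; rewrite inE uT orbT => /(_ isT).
have -> : (v |: T) :\ u = v |: (T :\ u).
  by apply/setP => y; rewrite !inE; have [->|] := eqVneq y u;
    rewrite //= (negbTE uv).
move=> dd; have cT := cardsD1 u T; rewrite uT in cT.
(* The last leaf cannot have low degree: [v] alone spans no pair, so deleting the leaf would lose at
   least [2 * k] pairs, while it loses fewer. *)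
have [E|ne] := eqVneq (T :\ u) set0.
  have c1 : #|T| = 1 by rewrite cT E cards0.
  move: dd; rewrite E setU0 inner1 cards0 => dd.
  by rewrite c1 muln1 in dT; lia.
apply: (IH (T :\ u)) => //.
- by move=> y; rewrite !inE => /andP[_ /TN].
- have c1 : #|T| = #|T :\ u|.+1 by [].
  by rewrite c1 mulnS in dT; lia.
- by move: Tn; rewrite cT.
Qed.

End Peeling.

(** * The logarithmic potential *)

Section Potential.
Variable R : realType.
Local Open Scope ring_scope.
Implicit Types (s j : R).

(** The integral of the rate [40 * s / (s + t)] for [t] from 0 to [j]: the total price if the pairs
    of a star were covered one at a time. It vanishes for [s = 0]. *)
Definition pot s j : R := 40 * (s * ln (1 + j / s)).

Lemma ln_le_sub1 (x : R) : 0 < x -> ln x <= x - 1.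
Proof.
by move=> x0; have := @le_ln1Dx R (x - 1); rewrite addrCA subrr addr0; apply; lra.
Qed.

(** The rate decreases in [t], so charging every pair covered in the phase at the rate for [j] costs
    at most the integral from [j'] to [j]. *)
Lemma pot_step s j j' : 0 <= s -> 0 <= j' -> j' <= j ->
  (j - j') * (40 * s / (s + j)) <= pot s j - pot s j'.
Proof.
rewrite le_eqVlt => /orP[/eqP<- _ _|s0 j'0 jj'];
  first by rewrite /pot !mul0r !mulr0 mul0r mulr0 subrr.
have sj : 0 < s + j by lra.
have sj' : 0 < s + j' by lra.
have E t : 1 + t / s = (s + t) / s by rewrite mulrDl divff ?gt_eqF.
rewrite /pot !E !ln_div ?posrE //.
have H := @ln_le_sub1 ((s + j') / (s + j)) (divr_gt0 sj' sj).
rewrite ln_div ?posrE // in H.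
have -> : (j - j') * (40 * s / (s + j)) = 40 * s * (1 - (s + j') / (s + j)).
  by field; rewrite gt_eqF.
have -> : 40 * (s * (ln (s + j) - ln s)) - 40 * (s * (ln (s + j') - ln s)) =
   40 * s * (ln (s + j) - ln (s + j')) by ring.
by apply: ler_wpM2l; [lra | lra].
Qed.

(** A tangent of the logarithm at [b]. The bound is linear in [s] and [j], so with one [b] for all
    stars only the totals of [s] and [j] matter. *)
Lemma pot_bound s j b : 0 < b -> 0 <= s -> 0 <= j ->
  pot s j <= 40 * (s * ln b + (s + j) / b).
Proof.
move=> b0; rewrite le_eqVlt => /orP[/eqP<- j0|s0 j0].
  by rewrite /pot !mul0r mulr0 !add0r mulr_ge0 // divr_ge0 // ltW.
rewrite /pot ler_wpM2l //.
have x0 : 0 < 1 + j / s by rewrite ltr_wpDr // divr_ge0 // ltW.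
have := ln_le_sub1 (divr_gt0 x0 b0); rewrite ln_div ?posrE // => H.
have : ln (1 + j / s) <= ln b + (1 + j / s) / b by lra.
move=> /(ler_wpM2l (ltW s0)) /le_trans; apply.
rewrite mulrDr lerD2l le_eqVlt; apply/orP; left; apply/eqP.
by field; rewrite !gt_eqF.
Qed.

End Potential.

(** * Charging the bought stars to a given 2-spanner *)

Section Ratio.
Variables (R : realType) (G : sgraph) (H : {set {set G}}).
Hypothesis HS : two_spanner H.

Definition leaves v : {set G} := [set u | [set v; u] \in H].

(** An edge may be spanned by several stars of [H]; one is chosen, so that the sets [owned] are
    disjoint. By [ownerP] the choice is genuine for edges. *)
Definition owner (e : G * G) : G :=
  odflt e.1 [pick v | (e.1 \in v |: leaves v) && (e.2 \in v |: leaves v)].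

Lemma leaves_adj v u : u \in leaves v -> adj v u.
Proof. by rewrite inE -edgesE; apply/subsetP; case: HS. Qed.

Lemma ownerP a b : adj a b ->
  (a \in owner (a, b) |: leaves (owner (a, b))) /\
    (b \in owner (a, b) |: leaves (owner (a, b))).
Proof.
move=> ab; rewrite /owner; case: pickP => [v /andP[] //|none]; exfalso.
have [_ /(_ a b)] := HS; rewrite edgesE => /(_ ab) [p [pP lP sp]].
case: p pP lP sp => [|x [|y [|z p]]] //=.
- by move=> _ E; move: ab; rewrite E adj_irr.
- rewrite andbT => ax xb _; have := none a.
  by rewrite !inE eqxx /= -xb -[_ \in H]/(edge_rel H a x) ax orbT.
move=> /and3P[ax xy _] yb _; have := none x.
by rewrite !inE -yb /= -(setUC [set a] [set x]) -[[set a] :|: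
  [set x] \in H]/(edge_rel H a x) ax
  -[[set x; y] \in H]/(edge_rel H x y) xy !orbT.
Qed.

Section Phase.
Variables (U : {set G * G}) (prio : G -> seq bool).
Hypothesis symU : forall a b, (a, b) \in U -> (b, a) \in U.
Hypothesis adjU : forall a b, (a, b) \in U -> adj a b.
Hypothesis prio_inj : injective prio.

Definition owned (W : {set G * G}) v : {set G * G} := [set e in W | owner e == v].

Lemma owned_inner v : owned U v \subset inner U (v |: leaves v).
Proof.
apply/subsetP => -[a b]; rewrite !inE /= => /andP[abU /eqP <-]; rewrite abU.
by have [] := ownerP (adjU abU); rewrite !inE => -> ->.
Qed.

(** Otherwise [dense_feasible] gives the owner a feasible set at twice the level of [x], hence a
    level above that of [x]. But the owner is the voter or a neighbour of it, contrary to
    [ballot_level]. *)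
Lemma owned_bound e x : e \in ballot U prio x ->
  #|owned U (owner e)| <= 4 * level U x * #|leaves (owner e)|
    /\ 0 < #|leaves (owner e)|.
Proof.
move=> ex; have eU : e \in U by move: ex; rewrite inE => /andP[].
set v := owner e.
have eown : e \in owned U v by rewrite inE eU eqxx.
have actx : active U x.
  by move/(subsetP (ballot_cpairs _ _ _)): ex; rewrite inE => /and3P[].
have T0 : leaves v != set0.
  apply/eqP => E; have := subsetP (owned_inner v) _ eown.
  by rewrite E setU0 (inner1 adjU) inE.
split; last by rewrite card_gt0.
rewrite leqNgt; apply/negP => lt.
have l0 := level_gt0 actx.
have [|||S [S0 fS]] := @dense_feasible _ _ symU adjU v (2 * level U x)
  (leaves v) _ T0 _ _.
- by move=> u; exact: leaves_adj.
- apply: leq_trans (subset_leq_card (owned_inner v)).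
  by rewrite mulnA; exact: ltnW.
- by rewrite muln_gt0.
have actv : active U v.
  by apply/active_feasible; exists (2 * level U x), S; rewrite muln_gt0 l0.
have := level_max actv _ fS S0; rewrite muln_gt0 l0 => /(_ isT).
have : level U v <= level U x; last by lia.
apply: ballot_level ex actv _.
move: eU; rewrite /v; case: (e) => a b abU; have [] := ownerP (adjU abU).
rewrite !inE => /orP[/eqP <-|va] _; first by rewrite eqxx.
by rewrite adj_sym leaves_adj ?orbT // inE.
Qed.

Local Open Scope ring_scope.

Definition rate v : R := 40 * #|leaves v|%:R / (#|leaves v|%:R + #|owned U v|%:R).

Lemma rate_ge0 v : 0 <= rate v.
Proof. by rewrite /rate divr_ge0 // ?mulr_ge0 ?addr_ge0. Qed.

(** The constant 40 is 8 times 5: from [j <= 4 * l * s] and [1 <= l] follows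
    [s + j <= 5 * l * s]. *)
Lemma price_rate e x : e \in ballot U prio x ->
  8 / (level U x)%:R <= rate (owner e).
Proof.
move=> ex; have [ob l0] := owned_bound ex.
have actx : active U x.
  by move/(subsetP (ballot_cpairs _ _ _)): ex; rewrite inE => /and3P[].
have lx : 0 < (level U x)%:R :> R by rewrite ltr0n level_gt0.
have s0 : 0 < #|leaves (owner e)|%:R :> R by rewrite ltr0n.
have l1 : 1 <= (level U x)%:R :> R by rewrite ler1n level_gt0.
have : #|owned U (owner e)|%:R <= 4 * (level U x)%:R * #|leaves (owner e)|%:R :> R.
  by rewrite -!natrM ler_nat.
rewrite /rate; move: s0; set s := _%:R; set j := #|owned _ _|%:R;
  set l := _%:R in lx l1 * => s0 jb.
have j0 : 0 <= j by rewrite /j.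
rewrite ler_pdivrMr // mulrAC ler_pdivlMr; last by lra.
have : s <= l * s by rewrite ler_peMl // ltW.
lra.
Qed.

(** A pair pays only when the star it votes for is bought, and that star then covers it. So the
    payers of one owner are among its pairs that leave [U], each paying at most [rate]. *)
Lemma phase_cost :
  \sum_v (size (gain U prio v))%:R <=
  \sum_v (pot #|leaves v|%:R #|owned U v|%:R - pot #|leaves v|%:R #|owned
    (nextU U prio) v|%:R) :> R.
Proof.
pose price e : R := \sum_(v | added U prio v && (e \in ballot U prio v)) 8 /
  (level U v)%:R.
apply: (@le_trans _ _ (\sum_(e in U) price e)).
  rewrite /price (exchange_big_dep (added U prio)) /=; last by move=> e v _ /andP[].
  rewrite [leRHS]big_mkcond; apply: ler_sum => v _; rewrite /gain;
    case: ifP => // av.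
  rewrite (eq_bigl (mem (ballot U prio v))) => [|e]; last first.
    by rewrite /= ?av /= andb_idl // inE => /andP[].
  have act : active U v by case/andP: av.
  have l0 : 0 < (level U v)%:R :> R by rewrite ltr0n level_gt0.
  rewrite sumr_const -[leRHS]mulr_natr mulrAC ler_pdivlMr // mulrC -!natrM ler_nat.
  exact: (gain_cost symU adjU prio_inj).
rewrite (partition_big owner xpredT) //=; apply: ler_sum => v _.
have own (W : {set G * G}) e : (e \in W) && (owner e == v) =
  (e \in owned W v) by rewrite inE.
rewrite (eq_bigl (mem (owned U v))) => [|e]; last exact: own.
apply: (@le_trans _ _ (\sum_(e in owned U v)
  (if e \notin nextU U prio then rate v else 0))).
  apply: ler_sum => e; rewrite -[(mem _) _]/(e \in owned U v) -own =>
    /andP[eU /eqP <-]; rewrite /price.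
  case: (boolP (e \in nextU U prio)) => [en|_] /=.
    rewrite big_pred0 // => x; apply/negbTE/andP =>
      -[ax /(subsetP (ballot_cpairs _ _ _))].
    by move=> /(added_next ax); rewrite en.
  have [[x /andP[ax ex]]|none] :=
    pselect (exists x, added U prio x && (e \in ballot U prio x)).
    rewrite (big_pred1 x) ?price_rate // => y /=.
    apply/andP/eqP => [[_ ey]|-> //]; exact: ballot_disjoint prio_inj _ _ _ ey ex.
  by rewrite big_pred0 ?rate_ge0 // => x; apply: contra_notF none => h; exists x.
rewrite -big_mkcondr /= (eq_bigl (mem (owned U v :\: owned (nextU U prio) v)));
  last first.
  move=> e; rewrite !inE; case: (e \in U) => //=.
  by case: (owner e == v); rewrite ?andbF ?andbT //=.
have sub : owned (nextU U prio) v \subset owned U v.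
  by apply/subsetP => e; rewrite !inE => /andP[/andP[-> _] ->].
rewrite sumr_const cardsD (setIidPr sub) -[leLHS]mulr_natl natrB
  ?subset_leq_card //.
by apply: pot_step; rewrite ?ler0n // ler_nat subset_leq_card.
Qed.
End Phase.

Local Open Scope ring_scope.

Lemma card_incident (P : pred (G * G)) (F : {set {set G}}) :
  (forall x, P x -> [set x.1; x.2] \in F) -> (#|[set x | P x]| <= 2 * #|F|)%N.
Proof.
move=> PF; rewrite -sum1_card (partition_big (fun x => [set x.1; x.2]) (mem F))
  /=; last first.
  by move=> x; rewrite inE => /PF.
rewrite mulnC -sum_nat_const; apply: leq_sum => f _; rewrite sum1_card.
have [[[a b] /andP[_ /eqP ab]]|none] :=
  pselect (exists x : G * G, (x \in [set x | P x]) && ([set x.1; x.2] == f)).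
  apply: (@leq_trans #|[set (a, b); (b, a)]|); last by rewrite cards2;
    case: (_ != _).
  apply: subset_leq_card; apply/subsetP => -[c d];
    rewrite unfold_in => /andP[_ /eqP].
  rewrite -ab /= => /set2_eq [] ->; rewrite !inE eqxx ?orbT //.
by rewrite eq_card0 // => x; apply: contra_notF none => h; exists x.
Qed.

Variables (id : G -> seq bool) (w : coins G).
Hypothesis id_inj : injective id.
Local Notation Un p := (uncovered id w p).

Lemma total_cost p :
  \sum_v (size (selected id w p v))%:R +
    \sum_v pot #|leaves v|%:R #|owned (Un p) v|%:R <=
  \sum_v pot #|leaves v|%:R #|owned (Un 0) v|%:R :> R.
Proof.
elim: p => [|p IH]; first by rewrite big1 ?add0r // => v _.
apply: le_trans IH.
have := @phase_cost (Un p) (prio_at id w (phase_time p)) (@uncovered_sym _ id w p)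
  (@uncovered_adj _ id w p) (@prio_at_inj _ _ id_inj w _).
rewrite sumrB -/(Un p.+1).
have -> : \sum_v (size (selected id w p.+1 v))%:R =
  \sum_v (size (selected id w p v))%:R +
    \sum_v (size (gain (Un p) (prio_at id w (phase_time p)) v))%:R :> R.
  by rewrite -big_split /=; apply: eq_bigr => v _; rewrite -natrD -size_cat.
lra.
Qed.

End Ratio.

Lemma connected_neighbour (G : sgraph) (v : G) : connected_graph G -> 1 < #|G| ->
  exists u, adj v u.
Proof.
move=> [_ conn] n1.
have [u uv] : exists u, u != v.
  have : 0 < #|[set: G] :\ v| by have := cardsD1 v [set: G]; rewrite inE cardsT;
    lia.
  by rewrite card_gt0 => /set0Pn [u]; rewrite !inE andbT; exists u.
have /connectP [[|x p] /=] := conn v u; first by move=> _ E; rewrite E eqxx in uv.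
by case/andP => vx _ _; exists x.
Qed.

Lemma edges_spanner (G : sgraph) : two_spanner (edges G).
Proof.
split=> // u v uv; exists [:: v]; split=> //=.
by rewrite /edge_rel uv.
Qed.

Lemma min_spannerP (G : sgraph) : exists H : {set {set G}},
  two_spanner H /\ #|H| = min_two_spanner G.
Proof.
rewrite /min_two_spanner; case: arg_minnP; first by apply/asboolP;
  exact: edges_spanner.
by move=> H /asboolP HS _; exists H.
Qed.

(** * The approximation ratio *)

Section SpannerRatio.
Variables (R : realType) (G : sgraph) (id : G -> seq bool) (w : coins G).
Hypothesis id_inj : injective id.
Hypothesis conn : connected_graph G.
Variable p : nat.
Hypothesis U0 : uncovered id w p = set0.
Local Open Scope ring_scope.
Local Notation n := (#|G|%:R : R).
Local Notation m := (#|edges G|%:R : R).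

Lemma ln_max_bound (x : R) : 0 <= x -> ln (1 + x) <= 2 * Num.max 1 (ln x).
Proof.
move=> x0; have M1 : 1 <= Num.max 1 (ln x) by rewrite le_max lexx.
have l2 : ln 2 <= 1 :> R by have := @ln_le_sub1 R 2 (ltr0n _ 2); lra.
have [x1|x1] := leP x 1.
  have : ln (1 + x) <= ln 2 by rewrite ler_ln ?posrE; lra.
  lra.
have xp : 0 < x by lra.
have : ln (1 + x) <= ln (2 * x) by rewrite ler_ln ?posrE; lra.
rewrite lnM ?posrE //.
have : ln x <= Num.max 1 (ln x) by rewrite le_max lexx orbT.
lra.
Qed.

(** With [h] edges in a minimum spanner and [b = 1 + m / n], the initial potential is at most [40 *
    (2 * h * ln b + (2 * h + 2 * m) / b)]. Every vertex has an edge in the spanner, so [n <= 2 * h]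
    and the fraction is at most [6 * h]. As [ln b] is at most twice the maximum, this gives
    [160 + 240 = 400]. *)
Lemma spanner_ratio :
  #|output spanner_alg id w (phase_time p).+1|%:R <=
    400 * Num.max 1 (ln (m / n)) * (min_two_spanner G)%:R :> R.
Proof.
have [H [HS Hmin]] := min_spannerP G.
have [n0 _] := conn.
have M1 : 1 <= Num.max 1 (ln (m / n)) by rewrite le_max lexx.
(* A single vertex has no edge, and [n <= 2 * h] fails for it. *)
have [n1|n1] := leqP #|G| 1.
  have -> : output spanner_alg id w (phase_time p).+1 = set0.
    apply/setP => e; rewrite [RHS]inE; apply/negP => /imsetP[[a b]];
      rewrite inE /= => /andP[ab _].
    have ne : a != b by apply: contraTneq ab => ->; rewrite adj_irr.
    have : (#|[set a; b]| <= #|G|)%N by exact: max_card.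
    by rewrite cards2 ne; lia.
  by rewrite cards0 !mulr_ge0 //; lra.
have co : #|output spanner_alg id w (phase_time p).+1|%:R <=
    \sum_v (size (selected id w p v))%:R :> R.
  by rewrite -natr_sum ler_nat; exact: card_output.
have np : 0 < n by rewrite ltr0n.
pose b : R := 1 + m / n.
have b1 : 1 <= b by rewrite lerDl divr_ge0.
have b0 : 0 < b by lra.
have S2 : \sum_v #|leaves H v|%:R <= 2 * #|H|%:R :> R.
  rewrite -natr_sum -natrM ler_nat.
  apply: leq_trans (@card_incident G (fun x => [set x.1; x.2] \in H) H _) => //.
  rewrite -[leqRHS]sum1_card (eq_bigl (fun x => [set x.1; x.2] \in H));
    last by move=> x; rewrite inE.
  rewrite -(pair_big_dep xpredT (fun a b => [set a; b] \in H) (fun _ _ => 1%N)) /=.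
  by apply: leq_sum => v _; rewrite sum1_card leq_eqVlt; apply/orP; left;
    apply/eqP/eq_card => u; rewrite [LHS]inE.
have S1 : n <= 2 * #|H|%:R.
  apply: le_trans S2; rewrite -natr_sum ler_nat -sum1_card; apply: leq_sum => v _.
  have [u vu] := connected_neighbour v conn n1.
  have [_ /(_ v u)] := HS; rewrite edgesE => /(_ vu) [[|x q] [pP lP _]].
    by move: vu; rewrite -lP /= adj_irr.
  by rewrite card_gt0; apply/set0Pn; exists x; rewrite inE; case/andP: pP.
have T2 : \sum_v #|owned H (uncovered id w 0) v|%:R <= 2 * m.
  rewrite -natr_sum -natrM ler_nat.
  apply: leq_trans (@card_incident G (fun x => adj x.1 x.2) (edges G) _);
    last first.
    by move=> x; rewrite edgesE.
  rewrite -[leqRHS]sum1_card (partition_big (owner H) xpredT) //=.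
  by apply: leq_sum => v _; rewrite sum1_card leq_eqVlt; apply/orP; left;
    apply/eqP/eq_card => e; rewrite [LHS]inE [e \in uncovered _ _ _]inE
    [RHS]unfold_in inE.
have h0 : 0 <= #|H|%:R :> R by [].
have := @total_cost R G H HS id w id_inj p.
have -> : \sum_v pot #|leaves H v|%:R #|owned H (uncovered id w p) v|%:R = 0 :> R.
  rewrite big1 // => v _; rewrite (_ : owned _ _ _ = set0) ?cards0.
    by rewrite /pot mul0r addr0 ln1 !mulr0.
  by apply/setP => e; rewrite !inE U0 inE.
rewrite addr0 => tc.
have pb : \sum_v pot #|leaves H v|%:R #|owned H (uncovered id w 0) v|%:R <=
   40 * (2 * #|H|%:R * ln b + (2 * #|H|%:R + 2 * m) / b).
  apply: (@le_trans _ _ (\sum_v 40 *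
    (#|leaves H v|%:R * ln b + (#|leaves H v|%:R +
    #|owned H (uncovered id w 0) v|%:R) / b))).
    by apply: ler_sum => v _; apply: pot_bound.
  rewrite -mulr_sumr ler_wpM2l // big_split /= -!mulr_suml big_split /=.
  by rewrite lerD // ?ler_wpM2r ?ln_ge0 ?invr_ge0 ?lerD // ltW.
have mb : (2 * #|H|%:R + 2 * m) / b <= 6 * #|H|%:R.
  rewrite ler_pdivrMr // /b.
  have m0 : 0 <= m by [].
  have : 2 * m <= 4 * #|H|%:R * (m / n).
    rewrite mulrA ler_pdivlMr // mulrAC ler_wpM2r //; lra.
  have : 0 <= #|H|%:R * (m / n) by rewrite mulr_ge0 // divr_ge0.
  lra.
have lb := ln_max_bound (divr_ge0 (ler0n R #|edges G|) (ler0n R #|G|)).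
rewrite -/b in lb; rewrite -Hmin.
set M := Num.max _ _ in lb M1 *.
have : #|H|%:R * ln b <= #|H|%:R * (2 * M) by rewrite ler_wpM2l.
have : #|H|%:R <= #|H|%:R * M :> R by rewrite ler_peMr.
lra.
Qed.
End SpannerRatio.

Lemma blexle_cat a b c d : size a = size b -> a != b ->
  blexle (a ++ c) (b ++ d) = blexle a b.
Proof.
elim: a b => [|x a IH] [|y b] //= [sab].
by have [->|] := eqVneq x y; rewrite ?eqseq_cons ?eqxx //=; exact: IH.
Qed.

(** * Number of rounds *)

Section Slice.
Variables (G : sgraph) (id : G -> seq bool).
Hypothesis id_inj : injective id.
Variables (K t : nat).
Hypothesis tK : t <= K.

Definition slice := {ffun G * 'I_K -> bool}.
Implicit Types (g : slice) (D : {set G}).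

Definition coin g v : nat -> bool :=
  fun i => if insub i is Some i' then g (v, i') else false.

Definition bits g v := draw (coin g v) t.
Definition sprio g v := bits g v ++ id v.
Definition distinct : {set slice} := [set g | injectiveb (bits g)].

Lemma sprio_inj g : injective (sprio g).
Proof.
move=> u v /eqP; rewrite /sprio eqseq_cat ?size_draw //.
by move=> /andP[_ /eqP /id_inj].
Qed.

Lemma bitsP g g' u v : (forall i : 'I_K, i < t -> g (u, i) = g' (v, i)) <->
  bits g u = bits g' v.
Proof.
rewrite /bits /draw; split=> [H|/(can_inj revK) E i it].
  congr rev; apply/eq_in_map => i; rewrite mem_iota /= add0n => it.
  have iK := leq_trans it tK.
  by rewrite /coin insubT /=; exact: H.
have := congr1 (fun s => nth false s i) E; rewrite !nth_mkseq // /coin valK //.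
Qed.

(** When no random parts collide, the identifiers never decide a comparison; the winner depends on
    the coins alone, which are exchangeable between vertices. *)
Lemma bits_first g D v : g \in distinct ->
  first_in (sprio g) D v = (v \in D) && [forall y in D,
    blexle (bits g y) (bits g v)].
Proof.
rewrite inE => /injectiveP inj; congr (_ && _); apply: eq_forallb => y.
case: (y \in D) => //=; have [->|yv] := eqVneq y v; first by rewrite !blexle_refl.
by rewrite blexle_cat ?size_draw // (inj_eq inj).
Qed.

Definition swap u v g : slice := [ffun x => g (tperm u v x.1, x.2)].

Lemma swapK u v : involutive (swap u v).
Proof. by move=> g; apply/ffunP => -[x i]; rewrite !ffunE /= tpermK. Qed.

Lemma bits_swap u v g x : bits (swap u v g) x = bits g (tperm u v x).
Proof. by apply/bitsP => i _; rewrite ffunE. Qed.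

Lemma swap_distinct u v g : (swap u v g \in distinct) = (g \in distinct).
Proof.
rewrite !inE; apply/injectiveP/injectiveP => inj x y.
  move=> E; have := inj (tperm u v x) (tperm u v y).
  by rewrite !bits_swap !tpermK => /(_ E) /perm_inj.
by rewrite !bits_swap => /inj /perm_inj.
Qed.

Definition winners D v : {set slice} := [set g in distinct |
  first_in (sprio g) D v].

(** Swapping the coins of [u] and [v] turns a win of [u] into a win of [v]. *)
Lemma card_winners_eq D u v : u \in D -> v \in D -> #|winners D u|
  <= #|winners D v|.
Proof.
move=> uD vD; rewrite -(card_imset _ (can_inj (swapK u v))).
apply: subset_leq_card; apply/subsetP => z /imsetP[g];
  rewrite inE => /andP[gd gu] ->.
rewrite inE swap_distinct gd bits_first ?swap_distinct // vD /=.
move: gu; rewrite bits_first // => /andP[_ /forall_inP H].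
apply/forall_inP => y yD; rewrite !bits_swap tpermR; apply: H.
by case: tpermP => // [->|->].
Qed.

(** Every outcome has exactly one winner in [D], and by symmetry all members win equally often. *)
Lemma card_winners D v : v \in D -> #|D| * #|winners D v| = #|distinct|.
Proof.
move=> vD.
transitivity (\sum_(u in D) #|winners D u|).
  rewrite -sum_nat_const; apply: eq_bigr => u uD; apply/eqP.
  by rewrite eqn_leq !card_winners_eq.
transitivity (\sum_(u in D) \sum_(g in distinct | first_in (sprio g) D u) 1).
  by apply: eq_bigr => u _; rewrite sum1_card; apply: eq_card => g; rewrite inE.
rewrite (exchange_big_dep (mem distinct)) /=; last by move=> ? ? _ /andP[].
rewrite -sum1_card; apply: eq_bigr => g gd.
have [|x fx] := @first_in_exists _ (sprio g) D; first by apply/set0Pn; exists v.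
rewrite (big_pred1 x) // => y; rewrite /= gd /=.
apply/andP/eqP => [[yD fy]|->]; last by rewrite fx; case/andP: fx.
case/andP: fx => xD /forall_inP xm; case/andP: fy => _ /forall_inP ym.
by apply: (@sprio_inj g); apply: blexle_anti; [exact: xm | exact: ym].
Qed.

Definition overwrite u (h : {ffun 'I_t -> bool}) g : slice :=
  [ffun x : G * 'I_K => if x.1 == u then
     if insub (x.2 : nat) is Some i then h i else g x else g x].

(* Overwriting the coins of [u] loses nothing if they equal those of [v]. *)
Lemma card_collision u v : u != v ->
  #|[set g : slice | bits g u == bits g v]| * 2 ^ t <= #|{: slice}|.
Proof.
move=> uv; set E := [set g | _].
have -> : 2 ^ t = #|[set: {ffun 'I_t -> bool}]|.
  by rewrite cardsT card_ffun card_bool card_ord.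
rewrite -cardsX.
have inj : {in setX E [set: {ffun 'I_t -> bool}] &,
  injective (fun x => overwrite u x.2 x.1)}.
  move=> [g h] [g' h']; rewrite !inE !andbT /= => /eqP /bitsP gE /eqP /bitsP g'E eq.
  have at_ x i : overwrite u h g (x, i) = overwrite u h' g' (x, i) by rewrite eq.
  have gg x i : x != u -> g (x, i) = g' (x, i).
    by move=> xu; have := at_ x i; rewrite !ffunE /= (negbTE xu).
  congr pair; apply/ffunP.
    move=> [x i]; have [->|] := eqVneq x u; last exact: gg.
    have [it|ti] := ltnP i t; last first.
      by have := at_ u i; rewrite !ffunE /= eqxx insubF // ltnNge ti.
    by rewrite gE // g'E // gg // eq_sym.
  move=> i; have iK := leq_trans (ltn_ord i) tK.
  by have := at_ u (Ordinal iK); rewrite !ffunE /= eqxx valK.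
rewrite -(card_in_imset inj); exact: max_card.
Qed.

(** A union bound: fewer than [#|G| ^ 2] pairs of distinct vertices, or none at all, each colliding
    in at most one of [2 ^ t] outcomes. *)
Lemma card_distinct : 2 * #|G| ^ 2 <= 2 ^ t -> #|{: slice}| <= 2 * #|distinct|.
Proof.
move=> n2.
suff H : #|~: distinct| * 2 ^ t <= #|G| ^ 2 * #|{: slice}|.
  have c : #|distinct| + #|~: distinct| = #|{: slice}| by rewrite cardsC.
  have : #|~: distinct| * (2 * #|G| ^ 2) <= #|G| ^ 2 * #|{: slice}|.
    by apply: leq_trans H; rewrite leq_mul2l n2 orbT.
  rewrite mulnA (mulnC (#|G| ^ 2)) leq_mul2r => /orP[/eqP n0|]; last by lia.
  have -> : distinct = [set: slice].
    apply/setP => g; rewrite !inE; apply/injectiveP => u.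
    have : 0 < #|G| by apply/card_gt0P; exists u.
    by move/eqP: n0; rewrite expn_eq0 andbT => /eqP ->.
  by rewrite cardsT leq_pmull.
have sub : ~: distinct \subset \bigcup_(x : G * G | x.1 != x.2) [set g : slice |
  bits g x.1 == bits g x.2].
  apply/subsetP => g; rewrite !inE => /injectivePn [u [v uv E]].
  by apply/bigcupP; exists (u, v); rewrite // inE /= E.
apply: leq_trans (_ : (\sum_(x : G * G | x.1 != x.2) #|[set g : slice |
  bits g x.1 == bits g x.2]|) * 2 ^ t <= _).
  rewrite leq_mul2r; apply/orP; right; apply: leq_trans (subset_leq_card sub) _.
  elim/big_rec2: _ => [|x m A _ h]; first by rewrite cards0.
  by apply: leq_trans (leq_card_setU _ _) _; rewrite leq_add2l.
rewrite big_distrl /=; apply: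
  (@leq_trans (\sum_(x : G * G | x.1 != x.2) #|{: slice}|)).
  by apply: leq_sum => x; exact: card_collision.
rewrite sum_nat_const leq_mul2r; apply/orP; right.
by apply: leq_trans (max_card _) _; rewrite card_prod mulnn.
Qed.

End Slice.

(** * Expected drop of the weight at the maximal level *)

Section Drop.
Variables (R : realFieldType) (G : sgraph) (id : G -> seq bool).
Hypothesis id_inj : injective id.
Variables (K t : nat).
Hypothesis tK : t <= K.
Hypothesis coins_enough : 2 * #|G| ^ 2 <= 2 ^ t.
Variable U : {set G * G}.
Hypothesis symU : forall a b, (a, b) \in U -> (b, a) \in U.
Hypothesis adjU : forall a b, (a, b) \in U -> adj a b.
Variable i : nat.
Hypothesis level_le : forall x, active U x -> level U x <= 2 ^ i.
Implicit Types (g : slice G K) (v : G) (e f : G * G).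

(** [Phi_k] of the overview for [k = 2 ^ j], counted by stars; [weight_cover] counts it by pairs. *)
Definition weight (W : {set G * G}) j := \sum_x #|kpairs W (2 ^ j) x|.

Let C v := kpairs U (2 ^ i) v.
Let D e := centres U i e.
Let d e := #|D e|.
Let I := @distinct G K t.
Let prio g := sprio id t g.
Let F v e g : bool := first_in (prio g) (D e) v.

Lemma mem_D e v : (v \in D e) = (e \in C v).
Proof. by rewrite inE. Qed.

Lemma C_sub v : C v \subset U.
Proof. by apply/subsetP => e; rewrite inE => /andP[]. Qed.

Lemma weight_cover : weight U i = \sum_(e in U) d e.
Proof.
rewrite /weight; transitivity (\sum_x \sum_(e in U | x \in D e) 1).
  apply: eq_bigr => x _; rewrite sum1_card; apply: eq_card => e.
  by rewrite [RHS]unfold_in mem_D -/(C x) andb_idl // => /(subsetP (C_sub x)).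
rewrite (exchange_big_dep (mem U)) /=; last by move=> ? ? _ /andP[].
apply: eq_bigr => e eU; rewrite sum1_card; apply: eq_card => x.
by rewrite unfold_in /= eU.
Qed.

(** Here [d e] still refers to the cores before the phase; the new cores are smaller, hence an
    inequality. *)
Lemma weight_next g : weight (nextU U (prio g)) i <=
  \sum_(e in nextU U (prio g)) d e.
Proof.
set W := nextU _ _; have WU : W \subset U by apply/subsetP => e;
  rewrite inE => /andP[].
rewrite /weight; apply: (@leq_trans (\sum_x \sum_(e in W | x \in D e) 1)).
  apply: leq_sum => x _; rewrite sum1_card; apply: subset_leq_card.
  apply/subsetP => e ex; rewrite unfold_in mem_D.
  rewrite (subsetP (kpairs_mono x _ WU)) ?expn_gt0 // andbT.
  by move: ex; rewrite inE => /andP[].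
rewrite (exchange_big_dep (mem W)) /=; last by move=> ? ? _ /andP[].
apply: leq_sum => e eW; rewrite sum1_card; apply: subset_leq_card.
by apply/subsetP => x; rewrite unfold_in => /andP[].
Qed.

Lemma ballotE g v e : e \in C v -> (e \in ballot U (prio g) v) = F v e g.
Proof.
move=> ev; have eU := subsetP (C_sub v) _ ev.
rewrite inE eU /= /F (candE adjU level_le) //; apply/set0Pn; exists v.
by rewrite -/(D e) mem_D.
Qed.

Local Open Scope ring_scope.

(** [X] counts the votes of the pairs of [v]; [Y] weighs each by [d e], the inverse of its
    probability, so that every pair contributes 1 to the expectation. *)
Let X v g : R := \sum_(e in C v) (F v e g)%:R.
Let Y v g : R := \sum_(e in C v) (d e)%:R * (F v e g)%:R.

(** [v] is first in both candidate sets exactly when it is first in their union. This takes the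
    place of independence. *)
Lemma sum_winners v e f : e \in C v -> f \in C v ->
  \sum_(g in I) (F v e g && F v f g)%:R = #|winners id K t (D e :|: D f) v|%:R :> R.
Proof.
move=> ev fv; rewrite -natr_sum; congr (_%:R);
  rewrite -sum1_card [RHS]big_mkcond [LHS]big_mkcond.
apply: eq_bigr => g _ /=; rewrite [in RHS]inE -/I; case: (g \in I) => //=.
have -> : first_in (sprio id t g) (D e :|: D f) v = F v e g && F v f g;
  last by case: (_ && _).
have ve : v \in D e by rewrite mem_D.
have vf : v \in D f by rewrite mem_D.
rewrite /F /first_in in_setU ve vf /=.
apply/forall_inP/andP => [H|[/forall_inP He /forall_inP Hf] y].
  by split; apply/forall_inP => y yD; apply: H; rewrite in_setU yD ?orbT.
by rewrite in_setU => /orP[/He|/Hf].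
Qed.

Lemma d_gt0 v e : e \in C v -> 0 < (d e)%:R :> R.
Proof. by move=> ev; rewrite ltr0n; apply/card_gt0P; exists v; rewrite mem_D. Qed.

Lemma winners_bound v e f : e \in C v -> f \in C v ->
  #|I|%:R / ((d e)%:R + (d f)%:R) <= #|winners id K t (D e :|: D f) v|%:R :> R.
Proof.
move=> ev fv; have d1 := d_gt0 ev; have d2 := d_gt0 fv.
have vD : v \in D e :|: D f by rewrite in_setU mem_D ev.
rewrite ler_pdivrMr ?addr_gt0 // -natrD -natrM ler_nat mulnC.
rewrite -(card_winners id_inj tK vD).
by rewrite leq_mul2r leq_card_setU orbT.
Qed.

Lemma sum_Y v : \sum_(g in I) Y v g = #|I|%:R * #|C v|%:R.
Proof.
rewrite /Y exchange_big /= mulr_natr -sumr_const; apply: eq_bigr => e ev.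
rewrite -mulr_sumr; have -> : \sum_(g in I) (F v e g)%:R =
  \sum_(g in I) (F v e g && F v e g)%:R :> R.
  by apply: eq_bigr => g _; rewrite andbb.
rewrite sum_winners // setUid -natrM (card_winners id_inj tK) // mem_D //.
Qed.

(* Symmetrizing in [e] and [f] turns [d e / (d e + d f)] into [1 / 2]. *)
Lemma sum_XY v : #|I|%:R * #|C v|%:R ^+ 2 / 2 <= \sum_(g in I) X v g * Y v g.
Proof.
have -> : \sum_(g in I) X v g * Y v g =
    \sum_(e in C v) \sum_(f in C v) (d e)%:R * #|winners id K t (D e :|: D f) v|%:R.
  rewrite (eq_bigr (fun g => \sum_(e in C v) \sum_(f in C v) (d e)%:R *
    (F v e g && F v f g)%:R)).
    rewrite exchange_big /=; apply: eq_bigr => e ev.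
    rewrite exchange_big /=; apply: eq_bigr => f fv.
    by rewrite -mulr_sumr sum_winners.
  move=> g _; rewrite mulrC /X /Y big_distrl /=; apply: eq_bigr => e _.
  rewrite big_distrr /=; apply: eq_bigr => f _.
  by rewrite -mulrA; congr (_ * _); rewrite -natrM mulnb.
pose S := \sum_(e in C v) \sum_(f in C v) (d e)%:R *
  (#|I|%:R / ((d e)%:R + (d f)%:R)) : R.
apply: (@le_trans _ _ S); last first.
  by apply: ler_sum => e ev; apply: ler_sum => f fv;
    rewrite ler_wpM2l ?winners_bound.
have E : S + S = #|I|%:R * #|C v|%:R ^+ 2.
  have S' : S = \sum_(e in C v) \sum_(f in C v) (d f)%:R *
    (#|I|%:R / ((d f)%:R + (d e)%:R)).
    by rewrite /S exchange_big.
  have -> : #|I|%:R * #|C v|%:R ^+ 2 = \sum_(e in C v) \sum_(f in C v) #|I|%:R :> R.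
    by rewrite !sumr_const -mulrnA -[RHS]mulr_natr natrM expr2.
  rewrite {2}S' /S -big_split /=; apply: eq_bigr => e ev.
  rewrite -big_split /=; apply: eq_bigr => f fv.
  have d1 := d_gt0 ev; have d2 := d_gt0 fv.
  by field; rewrite !gt_eqF ?addr_gt0.
lra.
Qed.

Lemma Y_ge0 v g : 0 <= Y v g.
Proof. by apply: sumr_ge0 => e _; rewrite mulr_ge0. Qed.

(** Let [C] be the number of pairs and average over [distinct]. [X] is at most [C], and below
    [C / 8] if the star is not bought, so the mean of [X * Y] is at most [C] times the mean of [Y]
    over purchases plus [C / 8] times the mean [C] of [Y]. By [sum_XY] it is at least [C ^ 2 / 2],
    and [1 / 2 - 1 / 8 = 3 / 8]. *)
Lemma sum_Y_added v :
  3 / 8 * (#|I|%:R * #|C v|%:R) <= \sum_(g in I | added U (prio g) v) Y v g.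
Proof.
have [C0|Cn] := posnP #|C v|.
  rewrite C0 !mulr0; apply: sumr_ge0 => g _; exact: Y_ge0.
have [e0 e0v] : exists e, e \in C v by apply/card_gt0P.
have [actv /eqP lv _] : [/\ active U v, level U v == (2 ^ i)%N & e0 \in cpairs U v].
  by apply/and3P; rewrite -(kpairs_max adjU level_le).
have Cc : C v = cpairs U v by rewrite /C -lv kpairs_level.
have c0 : 0 < #|C v|%:R :> R by rewrite ltr0n.
have XB g : X v g = #|ballot U (prio g) v|%:R.
  rewrite /X -natr_sum; congr (_%:R);
    rewrite -sum1_card [RHS]big_mkcond [LHS]big_mkcond.
  apply: eq_bigr => e _ /=; case: ifP => ev; first by rewrite ballotE //;
    case: (F _ _ _).
  case: ifP => // /(subsetP (ballot_cpairs _ _ _)); by rewrite -Cc ev.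
have XC g : X v g <= #|C v|%:R.
  by rewrite XB ler_nat Cc subset_leq_card // ballot_cpairs.
have step g : X v g * Y v g <= #|C v|%:R *
  (if added U (prio g) v then Y v g else 0) +
    #|C v|%:R / 8 * Y v g.
  have y0 := Y_ge0 v g; case: ifPn => add.
    have : X v g * Y v g <= #|C v|%:R * Y v g by rewrite ler_wpM2r.
    have : 0 <= #|C v|%:R / 8 * Y v g by rewrite mulr_ge0 // divr_ge0.
    lra.
  rewrite mulr0 add0r ler_wpM2r // XB.
  have := addedE symU adjU (@sprio_inj G id id_inj K t g) v.
  rewrite -/(prio g) (negbTE add) actv /= => /esym/negbT; rewrite -ltnNge -Cc => h.
  have : 8 * #|ballot U (prio g) v|%:R <=
    #|C v|%:R :> R by rewrite -natrM ler_nat ltnW.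
  lra.
have := sum_XY v.
have : \sum_(g in I) X v g * Y v g <=
   #|C v|%:R * \sum_(g in I | added U (prio g) v) Y v g + #|C v|%:R / 8 *
     (#|I|%:R * #|C v|%:R).
  apply: le_trans (ler_sum _ (fun g _ => step g)) _.
  by rewrite big_split /= -!mulr_sumr sum_Y big_mkcondr.
move=> h1 h2; have {h1 h2} h := le_trans h2 h1.
rewrite -(ler_pM2l c0); move: h; set A := \sum_(g in I | _) _; set Q := #|I|%:R;
  set P := #|C v|%:R.
by rewrite expr2; lra.
Qed.

(** A pair that votes for a bought star is covered and votes for no other, so its [d e] is counted
    at most once in the sum and is absent from the remaining weight. *)
Lemma phase_drop g : g \in I ->
  \sum_v (if added U (prio g) v then Y v g else 0) +
    (weight (nextU U (prio g)) i)%:R <= (weight U i)%:R.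
Proof.
move=> gI; set W := nextU U (prio g).
have WU : W \subset U by apply/subsetP => e; rewrite inE => /andP[].
have -> : (weight U i)%:R = \sum_(e in U :\: W) (d e)%:R +
  \sum_(e in W) (d e)%:R :> R.
  rewrite weight_cover natr_sum (big_setID W) /= (setIidPr WU) addrC //.
apply: lerD; last by rewrite -natr_sum ler_nat weight_next.
rewrite -big_mkcond /=.
rewrite (eq_bigr (fun v => \sum_(e in U | F v e g && (e \in C v)) (d e)%:R));
  last first.
  move=> v _; rewrite /Y [LHS]big_mkcond [RHS]big_mkcond; apply: eq_bigr => e _ /=.
  case: ifPn => ev; last by rewrite !andbF.
  by rewrite (subsetP (C_sub v)) //= andbT; case: (F _ _ _); rewrite ?mulr1 ?mulr0.
rewrite (exchange_big_dep (mem (U :\: W))) /=; last first.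
  move=> v e av /and3P[eU Fe ev]; rewrite inE eU andbT.
  apply: added_next av _; apply: (subsetP (ballot_cpairs U (prio g) v)).
  by rewrite ballotE.
apply: ler_sum => e; rewrite inE => /andP[eW eU].
have [[x /andP[ax Fx]]|none] :=
  pselect (exists x, added U (prio g) x && (F x e g && (e \in C x))).
  rewrite (big_pred1 x) // => y /=; rewrite eU /=.
  apply/idP/eqP => [/and3P[_ Fy ey]|->]; last by rewrite ax.
  case/andP: Fx => Fx ex.
  apply: (ballot_disjoint (@sprio_inj G id id_inj K t g) (U := U) (e := e));
    by rewrite ballotE.
rewrite big_pred0 // => x; apply/negbTE/negP => /andP[ax /and3P[_ Fx ex]].
by apply: none; exists x; rewrite ax Fx.
Qed.

(** Distinct outcomes lose 3/8 of the weight on average and are at least half of all; the others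
    lose nothing in the worst case. This leaves [1 - 3 / 16]. *)
Lemma expected_weight :
  16 * \sum_g (weight (nextU U (prio g)) i)%:R <= 13 *
    (#|{: slice G K}|%:R * (weight U i)%:R) :> R.
Proof.
have mono g : (weight (nextU U (prio g)) i)%:R <= (weight U i)%:R :> R.
  rewrite ler_nat; apply: leq_sum => x _; apply/subset_leq_card/kpairs_mono.
    by rewrite expn_gt0.
  by apply/subsetP => e; rewrite inE => /andP[].
have wU : (weight U i)%:R = \sum_v #|C v|%:R :> R by rewrite -natr_sum.
have h1 : 3 / 8 * (#|I|%:R * (weight U i)%:R) <=
    \sum_(g in I) \sum_v (if added U (prio g) v then Y v g else 0).
  rewrite exchange_big /= wU !mulr_sumr; apply: ler_sum => v _.
  by rewrite -big_mkcondr; exact: sum_Y_added.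
have h2 : \sum_(g in I) \sum_v (if added U (prio g) v then Y v g else 0) +
    \sum_(g in I) (weight (nextU U (prio g)) i)%:R <= #|I|%:R *
      (weight U i)%:R :> R.
  rewrite -big_split /= mulr_natl -sumr_const; apply: ler_sum => g gI;
    exact: phase_drop.
have h3 : \sum_(g in ~: I) (weight (nextU U (prio g)) i)%:R <= #|~: I|%:R *
  (weight U i)%:R :> R.
  by rewrite mulr_natl -sumr_const; apply: ler_sum.
have h4 : #|I|%:R + #|~: I|%:R = #|{: slice G K}|%:R :> R by rewrite -natrD cardsC.
have h5 : #|{: slice G K}|%:R <= 2 * #|I|%:R :> R.
  by rewrite -natrM ler_nat; exact: card_distinct.
have h6 : \sum_g (weight (nextU U (prio g)) i)%:R =
  \sum_(g in I) (weight (nextU U (prio g)) i)%:R +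
   \sum_(g in ~: I) (weight (nextU U (prio g)) i)%:R :> R.
  rewrite (bigID (mem I)) /=; congr (_ + _); apply: eq_bigl => g;
    by rewrite in_setC.
have w0 : 0 <= (weight U i)%:R :> R by [].
have h7 : #|{: slice G K}|%:R * (weight U i)%:R <= 2 * #|I|%:R *
  (weight U i)%:R :> R by rewrite ler_wpM2r.
have h8 : #|~: I|%:R * (weight U i)%:R = #|{: slice G K}|%:R *
  (weight U i)%:R - #|I|%:R * (weight U i)%:R :> R.
  by rewrite -h4; ring.
rewrite h6; lra.
Qed.

End Drop.

(** * One potential for all levels *)

Section Energy.
Variables (G : sgraph) (W : nat).
Hypothesis bigW : #|G| ^ 3 < W.
Let L := trunc_log 2 (max_degree G).

(** The weight at the highest level dominates those of all lower levels. *)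
Definition energy (U : {set G * G}) := \sum_(j < L.+1) W ^ j * weight U j.

Lemma weight_le (U : {set G * G}) j : weight U j <= #|G| ^ 3.
Proof.
rewrite expnS -mulnn -card_prod -sum_nat_const; apply: leq_sum => x _;
  exact: max_card.
Qed.

(** All levels below [i] together have at most the energy of a single pair at level [i]. *)
Lemma geometric i : \sum_(j < i) W ^ j * #|G| ^ 3 <= W ^ i.
Proof.
elim: i => [|i IH]; first by rewrite big_ord0.
rewrite big_ord_recr /=; apply: leq_trans (leq_add IH (leqnn _)) _.
by rewrite -mulnS [W ^ i.+1]expnSr leq_mul2l bigW orbT.
Qed.

Lemma energy_le U : energy U <= W ^ L.+1.
Proof.
apply: leq_trans (geometric _); apply: leq_sum => j _.
by rewrite leq_mul2l weight_le orbT.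
Qed.

Lemma weight_mono (U U' : {set G * G}) j : U' \subset U ->
  weight U' j <= weight U j.
Proof.
by move=> s; apply: leq_sum => x _; apply/subset_leq_card/kpairs_mono;
  rewrite ?expn_gt0.
Qed.

Lemma degree_le (v : G) : size (neighbours v) <= max_degree G.
Proof. by rewrite -cardE; exact: (leq_bigmax v). Qed.

Section Graphs.
Variable U : {set G * G}.
Hypothesis symU : forall a b, (a, b) \in U -> (b, a) \in U.
Hypothesis adjU : forall a b, (a, b) \in U -> adj a b.

(** A leaf has at least [level U x] neighbours. This is where the logarithm of the maximum degree
    enters, as the number of levels. *)
Lemma level_exponent x i : active U x -> level U x = 2 ^ i -> i <= L.
Proof.
move=> act li; have [j [lj [[_ Tk] _ _] s0 _]] := level_star_spec act.
case E: (star U x) s0 Tk => [//|a s] _ Tk.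
have := Tk a (mem_head _ _); rewrite -lj li => h.
have h2 : 2 ^ i <= max_degree G.
  apply: leq_trans h _; apply: leq_trans (degree_le a).
  by rewrite /udeg size_filter (leq_trans (count_size _ _)) // size_filter
    count_size.
exact: trunc_log_max.
Qed.

(** For an uncovered [(a, b)], the 1-core of [a] contains [b]. As the energy is an integer, its
    expectation bounds the probability that something is uncovered. *)
Lemma energy_gt0 : U != set0 -> 0 < energy U.
Proof.
move=> /set0Pn [[a b] abU]; rewrite /energy (bigD1 ord0) //= expn0 mul1n addn_gt0.
apply/orP; left; rewrite /weight (bigD1 a) //= addn_gt0; apply/orP; left.
apply/card_gt0P; exists (a, b).
rewrite inE abU /= mem_head inE; apply/orP; right.
have [_ _ H] := @greatest_kcore _ U a 1 isT.
by apply: (H [:: b]); rewrite ?mem_head //; apply: adjacent_feasible (adjU abU);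
  exact: symU.
Qed.

Lemma weight_above i j : (forall x, active U x -> level U x <= 2 ^ i) ->
  i < j -> weight U j = 0.
Proof.
move=> lm ij; apply: big1 => x _; have j0 : 0 < 2 ^ j by rewrite expn_gt0.
have [E|ne] := eqVneq (kcore U x (2 ^ j)) [::]; first by rewrite kpairs_nil ?cards0.
have act := active_kcore j0 ne; have := kcore_nil_level j0 act ne; have := lm _ act.
have : 2 ^ i.+1 <= 2 ^ j by rewrite leq_exp2l.
by rewrite expnS; lia.
Qed.

End Graphs.

Section Step.
Variables (R : realFieldType) (id : G -> seq bool).
Hypothesis id_inj : injective id.
Variables (K t : nat).
Hypothesis tK : t <= K.
Hypothesis coins_enough : 2 * #|G| ^ 2 <= 2 ^ t.
Variable U : {set G * G}.
Hypothesis symU : forall a b, (a, b) \in U -> (b, a) \in U.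
Hypothesis adjU : forall a b, (a, b) \in U -> adj a b.
Local Open Scope ring_scope.

(** The maximal level carries at least half of the energy and loses 3/16 in expectation, and no
    other level grows: [1 - 3 / 32 = 29 / 32]. *)
Lemma energy_drop :
  32 * \sum_(g : slice G K) (energy (nextU U (sprio id t g)))%:R <=
  29 * (#|{: slice G K}|%:R * (energy U)%:R) :> R.
Proof.
have nU (g : slice G K) : nextU U (sprio id t g) \subset U by apply/subsetP =>
  e; rewrite inE => /andP[].
have [U0|ne] := eqVneq U set0.
  have E0 : energy set0 = 0%N.
    apply: big1 => j _; rewrite [weight _ _]big1 ?muln0 // => x _.
    by apply/eqP; rewrite cards_eq0; apply/eqP/setP => e; rewrite !inE.
  rewrite big1 ?mulr0 ?mulr_ge0 // => g _.
  have sub : nextU U (sprio id t g) \subset set0 by rewrite -U0; exact: nU.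
  by move: sub; rewrite subset0 => /eqP ->; rewrite E0.
have [[a b] abU] := set0Pn _ ne.
have [i [x [act lx lm]]] := exists_max_level (pair_active symU adjU abU).
have iL : (i < L.+1)%N by rewrite ltnS; exact: level_exponent act lx.
have ew := @expected_weight R G id id_inj K t tK coins_enough U symU adjU i lm.
pose Wi : R := (W ^ i)%:R.
have Wi0 : 0 <= Wi by [].
have w1 : (0 < weight U i)%N.
  rewrite /weight (bigD1 x) //= addn_gt0 -lx kpairs_level // card_gt0.
  by rewrite cpairs_neq0.
have en (g : slice G K) : (energy (nextU U (sprio id t g)))%:R <=
    (energy U)%:R - Wi * (weight U i)%:R + Wi *
      (weight (nextU U (sprio id t g)) i)%:R :> R.
  rewrite /energy (bigD1 (Ordinal iL)) //= [in leRHS](bigD1 (Ordinal iL)) //=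
    !natrD !natrM.
  have : (\sum_(j < L.+1 | j != Ordinal iL) W ^ j *
    weight (nextU U (sprio id t g)) j)%:R <=
     (\sum_(j < L.+1 | j != Ordinal iL) W ^ j * weight U j)%:R :> R.
    by rewrite ler_nat; apply: leq_sum => j _; rewrite leq_mul2l weight_mono ?orbT.
  rewrite -/Wi; lra.
have small : (energy U <= 2 * (W ^ i * weight U i))%N.
  rewrite /energy -(big_mkord xpredT (fun j => W ^ j * weight U j)%N).
  rewrite (big_cat_nat (n := i.+1)) //= [X in (_ + X)%N]big_nat_cond
    [X in (_ + X)%N]big1.
    rewrite addn0 big_nat_recr //= mul2n -addnn leq_add2r.
    apply: (@leq_trans (W ^ i)); last by rewrite leq_pmulr.
    apply: leq_trans (geometric i); rewrite big_mkord; apply: leq_sum => j _.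
    by rewrite leq_mul2l weight_le orbT.
  by move=> j; rewrite andbT => /andP[ij _];
    rewrite (weight_above adjU lm ij) muln0.
have {}small : (energy U)%:R <= 2 * (Wi * (weight U i)%:R) :> R.
  by rewrite -!natrM ler_nat.
have : \sum_(g : slice G K) (energy (nextU U (sprio id t g)))%:R <=
   #|{: slice G K}|%:R * ((energy U)%:R - Wi * (weight U i)%:R) +
   Wi * \sum_(g : slice G K) (weight (nextU U (sprio id t g)) i)%:R :> R.
  apply: le_trans (ler_sum _ (fun g _ => en g)) _.
  by rewrite big_split /= -mulr_sumr sumr_const -[_ *+ _]mulr_natl.
have c0 : 0 <= #|{: slice G K}|%:R :> R by [].
have := ler_wpM2l Wi0 ew; have := ler_wpM2l c0 small.
set A := \sum_g (energy _)%:R; set B := \sum_g (weight _ _)%:R.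
set c := #|_|%:R; set u := (weight _ _)%:R; set E := (energy _)%:R.
lra.
Qed.
End Step.
End Energy.

(** * Resampling the coins of one round *)

Section Splice.
Variables (G : sgraph) (K : nat) (s : 'I_K).
Local Notation outcome := {ffun 'I_K * G * 'I_K -> bool}.

Definition splice (f : outcome) (g : slice G K) : outcome :=
  [ffun x => if x.1.1 == s then g (x.1.2, x.2) else f x].
Definition slice_at (f : outcome) : slice G K := [ffun y => f (s, y.1, y.2)].
(** Resampling the coins of one round, as an involution. *)
Definition exchange (z : outcome * slice G K) := (splice z.1 z.2, slice_at z.1).

Lemma exchangeK : involutive exchange.
Proof.
move=> [f g]; congr pair; apply/ffunP.
  by move=> [[s' v] i]; rewrite !ffunE /=; case: eqP => [->|_];
    rewrite ?ffunE ?eqxx.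
by move=> [v i]; rewrite !ffunE /= eqxx.
Qed.

(** Redrawing the coins of round [s] does not change the average. This replaces conditioning on the
    other rounds. *)
Lemma sum_splice (R : realFieldType) (Q : outcome -> nat) :
  (#|{: slice G K}|%:R * \sum_f (Q f)%:R =
    \sum_f \sum_g (Q (splice f g))%:R :> R)%R.
Proof.
transitivity (\sum_f \sum_(g : slice G K) (Q f)%:R : R)%R.
  rewrite mulr_sumr; apply: eq_bigr => f _.
  by rewrite sumr_const mulr_natl.
by rewrite !pair_big /= (reindex_inj (inv_inj exchangeK)).
Qed.

Lemma coin_splice f g (t : nat) v i : t = s ->
  extend (splice f g) t v i = coin g v i.
Proof.
move=> ->; rewrite /extend /coin valK; case: insubP => //= u _ _.
by rewrite ffunE /= eqxx.
Qed.

Lemma extend_splice f g (t : nat) v i : t != s ->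
  extend (splice f g) t v i = extend f t v i.
Proof.
move=> ts; rewrite /extend; case: insubP => //= u _ ut; case: insubP => //= u' _ _.
by rewrite ffunE /= -val_eqE /= ut (negbTE ts).
Qed.
End Splice.

(** Makes the coins of round [phase_time p] fresh with respect to the state at the start of phase
    [p]. *)
Lemma state_agree (G : sgraph) (id : G -> seq bool) (w w' : coins G) p :
  (forall t v i, t < phase_time p -> w t v i = w' t v i) ->
    state id w p = state id w' p.
Proof.
elim: p => [//|p IH] H; rewrite [LHS]/= [RHS]/=.
have E : prio_at id w (phase_time p) = prio_at id w' (phase_time p).
  apply/funext => v; rewrite /prio_at /draw; congr (rev _ ++ _).
  by apply/eq_map => i; apply: H; rewrite /phase_time; lia.
by rewrite E IH // => t v i tp; apply: H; move: tp; rewrite /phase_time; lia.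
Qed.

(** * Decay of the expected energy *)

Section Expectation.
Variables (R : realFieldType) (G : sgraph) (id : G -> seq bool).
Hypothesis id_inj : injective id.
Variables (W K : nat).
Hypothesis bigW : #|G| ^ 3 < W.
Local Open Scope ring_scope.
Local Notation outcome := {ffun 'I_K * G * 'I_K -> bool}.

Definition total_energy p : R :=
  \sum_(f : outcome) (energy W (uncovered id (extend f) p))%:R.

Lemma total_energy_step p : (phase_time p < K)%N ->
  (2 * #|G| ^ 2 <= 2 ^ phase_time p)%N ->
  32 * total_energy p.+1 <= 29 * total_energy p.
Proof.
move=> pK n2; pose s := Ordinal pK.
have c0 : 0 < #|{: slice G K}|%:R :> R.
  by rewrite ltr0n; apply/card_gt0P; exists [ffun => false].
rewrite -(ler_pM2l c0) [leLHS]mulrCA [leRHS]mulrCA.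
rewrite [X in 32 * X](sum_splice s R (fun f =>
  energy W (uncovered id (extend f) p.+1))).
rewrite /total_energy !mulr_sumr; apply: ler_sum => f _.
have ed := @energy_drop G W bigW R id id_inj K (phase_time p) (ltnW pK) n2
  (uncovered id (extend f) p) (@uncovered_sym _ id (extend f) p)
    (@uncovered_adj _ id (extend f) p).
suff E g : uncovered id (extend (splice s f g)) p.+1 =
    nextU (uncovered id (extend f) p) (sprio id (phase_time p) g).
  by rewrite (eq_bigr _ (fun g _ => congr1 (fun x => (energy W x)%:R) (E g))).
have E1 : uncovered id (extend (splice s f g)) p = uncovered id (extend f) p.
  rewrite /uncovered (@state_agree _ _ _ (extend f)) // => t v i tp.
  by apply: extend_splice; rewrite /= neq_ltn tp.
have E2 : prio_at id (extend (splice s f g)) (phase_time p) =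
  sprio id (phase_time p) g.
  apply/funext => v; rewrite /prio_at /sprio /bits /draw; congr (rev _ ++ _).
  by apply/eq_map => i; apply: coin_splice.
by rewrite -[LHS]/(nextU (uncovered id (extend (splice s f g)) p)
  (prio_at id (extend (splice s f g)) (phase_time p))) E1 E2.
Qed.

(* [(29 / 32) ^ 8 <= 1 / 2] *)
Lemma total_energy_bound p0 q : (phase_time (p0 + 8 * q) < K)%N ->
  (2 * #|G| ^ 2 <= 2 ^ phase_time p0)%N ->
  2 ^+ q * total_energy (p0 + 8 * q) <= #|{: outcome}|%:R *
    (W ^ (trunc_log 2 (max_degree G)).+1)%:R.
Proof.
move=> qK n2.
have step k : (phase_time (p0 + k) < K)%N -> 32 * total_energy (p0 + k).+1 <=
  29 * total_energy (p0 + k).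
  move=> kK; apply: total_energy_step => //; apply: leq_trans n2 _.
  by rewrite leq_exp2l // /phase_time; lia.
elim: q qK => [|q IH] qK.
  rewrite expr0 mul1r muln0 addn0 mulr_natl -sumr_const; apply: ler_sum => f _.
  by rewrite ler_nat energy_le.
have pt k : (k < 8)%N -> (phase_time (p0 + (8 * q + k)) < K)%N.
  by move=> k8; apply: leq_ltn_trans qK; rewrite /phase_time; lia.
have {}IH := IH (ltac:(rewrite -[(8 * q)%N]addn0; exact: pt)).
apply: le_trans IH; rewrite exprSr -mulrA ler_wpM2l ?exprn_ge0 //.
have -> : (p0 + 8 * q.+1)%N = (p0 + (8 * q + 8))%N by rewrite mulnS; lia.
have e0 k : 0 <= total_energy k by exact: sumr_ge0.
have s0 := step _ (pt 0 isT); have s1 := step _ (pt 1 isT);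
  have s2 := step _ (pt 2 isT).
have s3 := step _ (pt 3 isT); have s4 := step _ (pt 4 isT);
  have s5 := step _ (pt 5 isT).
have s6 := step _ (pt 6 isT); have s7 := step _ (pt 7 isT).
rewrite -!addnS in s0 s1 s2 s3 s4 s5 s6 s7.
rewrite addn0 in s0.
have := e0 (p0 + 8 * q)%N.
lra.
Qed.

End Expectation.

(** * Termination by a given round depends on finitely many coins *)

Section CoinLocality.
Variables (G : sgraph) (id : G -> seq bool).
Local Notation longest := (\max_(v : G) size (id v)).

Lemma local_step_ctr m b msgs :
  size (to_seq (hd (hd (local_step m b msgs)))) <= (size (to_seq (hd m))).+1.
Proof.
rewrite /local_step; case: ifP => // _; case: ifP => _; last first.
  by rewrite /step1; case: ifP => //= _; exact: leqnSn.
by case: ifP => // _; case: ifP.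
Qed.

(** Initially the place of the clock holds the identifier, whose length also counts as a number of
    coins; hence the summand [longest]. *)
Lemma run_ctr (w : coins G) t v :
  size (to_seq (hd (memory (run spanner_alg id w t v)))) <= t + longest.
Proof.
elim: t v => [|t IH] v.
  by rewrite /= /of_id of_seqK size_map; exact: (leq_bigmax v).
rewrite [run _ _ _ t.+1]/= /round; case: (decision _) => [o|].
  by apply: leq_trans (IH v) _; rewrite leq_add2r.
by apply: leq_trans (local_step_ctr _ _ _) _; rewrite addSn ltnS; exact: IH.
Qed.

Lemma run_agree (w w' : coins G) K t : t + longest <= K -> agree_upto K w w' ->
  run spanner_alg id w t = run spanner_alg id w' t.
Proof.
move=> tK ag; elim: t tK => [//|t IH] tK; rewrite [LHS]/= [RHS]/= -IH; last by lia.
apply/funext => v; rewrite /round; case: (decision _) => [//|]; congr decode.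
rewrite /spanner_alg; congr local_step; congr of_seq; congr map; rewrite /draw;
  congr rev.
apply/eq_in_map => i; rewrite mem_iota => /= ix; apply: ag; first by lia.
have ri := run_ctr w t v; have {ix} := leq_trans ix ri; lia.
Qed.

Lemma terminated_agree (w w' : coins G) K t : t + longest <= K ->
  agree_upto K w w' ->
  terminated spanner_alg id t w = terminated spanner_alg id t w'.
Proof.
by move=> tK ag; apply: eq_forallb => v; rewrite /halted (run_agree tK ag).
Qed.

End CoinLocality.

(** With degrees at most one, [v] and its neighbour are all that can be reached. The bound keeps the
    logarithm of the maximum degree away from 0. *)
Lemma max_degree_ge2 (G : sgraph) : connected_graph G -> 2 < #|G|
  -> 1 < max_degree G.
Proof.
move=> conn n3; have [n0 cn] := conn; rewrite ltnNge; apply/negP => d1.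
have [v _] := card_gt0P n0.
have [u vu] := connected_neighbour v conn (ltnW n3).
have one (x y z : G) : adj x y -> adj x z -> y = z.
  have dx : #|[pred y | adj x y]| <= max_degree G by exact: (leq_bigmax x).
  have /card_le1_eqP H := leq_trans dx d1.
  by move=> xy xz; apply: H; rewrite inE.
have clos : {subset [set: G] <= [set v; u]}.
  move=> x _; have /connectP [p] := cn v x.
  have : v \in [set v; u] by rewrite !inE eqxx.
  elim: p {1 3 4}v => [|y p IH] z zin /=; first by move=> _ ->.
  case/andP => zy; apply: IH.
  move: zin zy; rewrite !inE => /orP[/eqP->|/eqP->].
    by move=> /(one _ _ _ vu) ->; rewrite eqxx orbT.
  by rewrite adj_sym in vu; move=> /(one _ _ _ vu) ->; rewrite eqxx.
have : #|[set: G]| <= #|[set v; u]| by apply: subset_leq_card; apply/subsetP.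
rewrite cardsT cards2 => h; have := leq_trans n3 h.
by case: (_ != _).
Qed.

Lemma max_degree_lt (G : sgraph) : 0 < #|G| -> max_degree G < #|G|.
Proof.
move=> n0; rewrite -(prednK n0) ltnS; apply/bigmax_leqP => v _;
  rewrite -ltnS prednK //.
by apply/proper_card/properP; split;
  [exact/subsetP | exists v; rewrite ?inE ?adj_irr].
Qed.

(** * The number of rounds in terms of logarithms *)

Section Rounds.
Variable R : realType.
Local Open Scope ring_scope.

Lemma ln2_ge_half : 1 / 2 <= ln 2 :> R.
Proof.
have := @ln_le_sub1 R (2^-1) ltac:(lra); rewrite lnV ?posrE //; lra.
Qed.

Lemma up_log_ln n : (1 < n)%N -> (up_log 2 n)%:R <= 4 * ln n%:R :> R.
Proof.
move=> n1; have h2 := ln2_ge_half; have n0 : 0 < n%:R :> R by rewrite ltr0n ltnW.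
have l2 : ln 2 <= ln n%:R :> R by rewrite ler_ln ?posrE // ler_nat.
have k1 : 2 ^+ (up_log 2 n).-1 <= n%:R :> R.
  by rewrite -natrX ler_nat ltnW // up_log_gtn.
have h : ln (2 ^+ (up_log 2 n).-1) <=
  ln n%:R :> R by rewrite ler_ln ?posrE ?exprn_gt0.
rewrite lnXn // -[ln _ *+ _]mulr_natl in h.
have u0 : (0 < up_log 2 n)%N by rewrite up_log_gt0.
have e : (up_log 2 n)%:R = (up_log 2 n).-1%:R + 1 :> R by rewrite natr1 prednK.
have : (up_log 2 n).-1%:R * (1 / 2) <= (up_log 2 n).-1%:R *
  ln 2 :> R by rewrite ler_wpM2l.
lra.
Qed.

Lemma trunc_log_ln n : (0 < n)%N -> (trunc_log 2 n)%:R <= 2 * ln n%:R :> R.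
Proof.
move=> n0; have n0' : 0 < n%:R :> R by rewrite ltr0n.
have k1 : 2 ^+ trunc_log 2 n <= n%:R :> R by rewrite -natrX ler_nat trunc_logP.
have h : ln (2 ^+ trunc_log 2 n) <=
  ln n%:R :> R by rewrite ler_ln ?posrE ?exprn_gt0.
rewrite lnXn // -[ln _ *+ _]mulr_natl in h.
have : (trunc_log 2 n)%:R * (1 / 2) <= (trunc_log 2 n)%:R * ln 2 :> R.
  by rewrite ler_wpM2l // ln2_ge_half.
lra.
Qed.

(** The first summand makes priorities collide with probability at most [1 / 2];
    after that, eight phases halve the expected energy. *)
Definition phase_count (c n D : nat) : nat :=
  (up_log 2 n + 8 * (c * up_log 2 n + (3 * up_log 2 n + 1) * (trunc_log 2 D).+1))%N.

(** From three vertices on, both logarithms are at least [ln 2], so their product absorbs the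
    lower-order terms. For fewer vertices the product may vanish, and the constant 1 in the maximum
    is used. *)
Lemma phase_count_bound c (G : sgraph) : connected_graph G ->
  (phase_time (phase_count c #|G| (max_degree G))).+1%:R <=
  (2000 + 600 * c%:R) * Num.max 1 (ln #|G|%:R * ln (max_degree G)%:R) :> R.
Proof.
move=> conn; have [n0 _] := conn; have cc : 0 <= c%:R :> R by [].
set M := Num.max _ _; have M1 : 1 <= M by rewrite le_max lexx.
rewrite /phase_time /phase_count; set L := trunc_log _ _; set u := up_log _ _.
have -> : (((u + 8 * (c * u + (3 * u + 1) * L.+1)) * 4).+2)%:R =
   ((u%:R + 8 * (c%:R * u%:R + (3 * u%:R + 1) * (L%:R + 1))) * 4) + 2 :> R.
  by rewrite -!natr1 !(natrM, natrD); ring.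
have [n2|n3] := leqP #|G| 2.
  have u1 : (u <= 1)%N by apply: up_log_min.
  have L0 : L = 0%N.
    rewrite /L; have := max_degree_lt n0 => d;
      have : (max_degree G < 2)%N by apply: leq_trans d n2.
    by case: (max_degree G) => [|[|]].
  have u1' : u%:R <= 1 :> R by rewrite -(ler_nat R) in u1.
  have u0' : 0 <= u%:R :> R by [].
  rewrite L0; have : c%:R * u%:R <= c%:R :> R by rewrite ler_piMr.
  have : (2000 + 600 * c%:R) * 1 <= (2000 + 600 * c%:R) *
    M by rewrite ler_wpM2l //; lra.
  lra.
have D2 := max_degree_ge2 conn n3.
have ub : u%:R <= 4 * ln #|G|%:R :> R by apply: up_log_ln; exact: ltnW.
have Lb : L%:R <= 2 * ln (max_degree G)%:R :> R by apply: trunc_log_ln; exact: ltnW.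
have h2 := ln2_ge_half.
have a2 : ln 2 <= ln #|G|%:R :> R by rewrite ler_ln ?posrE ?ltr0n // ler_nat ltnW.
have b2 : ln 2 <= ln (max_degree G)%:R :> R by rewrite ler_ln ?posrE ?ltr0n
  ?ler_nat // ltnW.
have MM : ln #|G|%:R * ln (max_degree G)%:R <= M by rewrite le_max lexx orbT.
move: ub Lb a2 b2 MM; set a := ln #|G|%:R; set b := ln (max_degree G)%:R =>
  ub Lb a2 b2 MM.
have u0 : 0 <= u%:R :> R by []. have L0 : 0 <= L%:R :> R by [].
have Lb1 : L%:R + 1 <= 4 * b by lra.
have b1 : 1 <= 2 * b by lra. have a1 : 1 <= 2 * a by lra.
have p1 : u%:R * (L%:R + 1) <= 4 * a * (4 * b) by apply: ler_pM => //; lra.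
have p2 : u%:R * 1 <= 4 * a * (2 * b) by apply: ler_pM => //; lra.
have p3 : c%:R * (u%:R * 1) <= c%:R * (4 * a * (2 * b)) by rewrite ler_wpM2l.
have p4 : 1 * (L%:R + 1) <= 2 * a * (4 * b) by apply: ler_pM => //; lra.
have p5 : 1 * 1 <= 2 * a * (2 * b) by apply: ler_pM => //; lra.
have : (2000 + 600 * c%:R) * (a * b) <= (2000 + 600 * c%:R) *
  M by rewrite ler_wpM2l //; lra.
have : 0 <= c%:R * (a * b) by rewrite !mulr_ge0 //; lra.
have : 0 <= a * b by rewrite mulr_ge0 //; lra.
lra.
Qed.

End Rounds.

(** * Termination with high probability *)

Section Probability.
Variables (R : realType) (G : sgraph) (id : G -> seq bool).
Hypothesis id_inj : injective id.
Hypothesis conn : connected_graph G.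
Variable c : nat.
Local Open Scope ring_scope.

Let P := phase_count c #|G| (max_degree G).
Let T := (phase_time P).+1.
Let K := (T + \max_(v : G) size (id v))%N.
Local Notation outcome := {ffun 'I_K * G * 'I_K -> bool}.

(** Markov's inequality: an outcome that has not terminated has energy at least 1. Of the [q]
    halvings, [(3 * u + 1) * L.+1] make up for the initial energy [W ^ L.+1], and [c * u] for the
    factor [#|G| ^ c]. *)
Lemma termination_probability :
  1 - 1 / #|G|%:R ^+ c <=
    #|[set f : outcome | terminated spanner_alg id T (extend f)]|%:R / #|{:
      outcome}|%:R :> R.
Proof.
have [n0 _] := conn.
set u := up_log 2 #|G|; set L := trunc_log 2 (max_degree G).
pose q := (c * u + (3 * u + 1) * L.+1)%N.
have PE : P = (u + 8 * q)%N by [].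
(* A power of two above [#|G| ^ 3], so that [W ^ L.+1] corresponds to a whole number of halvings. *)
pose W := (2 ^ (3 * u + 1))%N.
have nu : (#|G| <= 2 ^ u)%N by exact: up_logP.
have bigW : (#|G| ^ 3 < W)%N.
  have h : (#|G| ^ 3 <= (2 ^ u) ^ 3)%N by rewrite leq_exp2r.
  rewrite /W expnD expn1 mulnC mulSn mul1n; apply: leq_ltn_trans h _.
  by rewrite -expnM mulnC -addn1 leq_add2l expn_gt0.
(* From phase [u] on, at least [4 * u + 1] coins are drawn, and [2 * u + 1] would do. *)
have enough : (2 * #|G| ^ 2 <= 2 ^ phase_time u)%N.
  have h : (#|G| ^ 2 <= (2 ^ u) ^ 2)%N by rewrite leq_exp2r.
  rewrite /phase_time (expnS 2) leq_mul2l /=; apply: leq_trans h _.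
  by rewrite -expnM leq_exp2l // leq_mul2l orbT.
have PK : (phase_time (u + 8 * q) < K)%N by rewrite -PE /K /T ltnS leq_addr.
have tb := @total_energy_bound R G id id_inj W K bigW u q PK enough.
have o0 : 0 < #|{: outcome}|%:R :> R.
  by rewrite ltr0n; apply/card_gt0P; exists [ffun => false].
pose bad := [set f : outcome | ~~ terminated spanner_alg id T (extend f)].
have badE : #|bad|%:R <= total_energy R id W K (u + 8 * q).
  rewrite /total_energy -natr_sum ler_nat -sum1_card [leqRHS](bigID (mem bad)) /=.
  apply: leq_trans (leq_addr _ _); apply: leq_sum => f; rewrite inE => nt.
  apply: energy_gt0; [exact: uncovered_sym | exact: uncovered_adj |].
  by apply: contraNneq nt => U0; exact: terminated_uncovered.
have tot : #|[set f : outcome | terminated spanner_alg id T (extend f)]|%:R =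
  #|{: outcome}|%:R - #|bad|%:R :> R.
  rewrite -(cardsC bad) natrD addrC addKr; congr (_%:R); apply: eq_card => f.
  by rewrite !inE negbK.
have nc : 0 < #|G|%:R ^+ c :> R by rewrite exprn_gt0 // ltr0n.
suff main : #|bad|%:R * #|G|%:R ^+ c <= #|{: outcome}|%:R :> R.
  have E (a b : R) : (1 - 1 / a) * b =
    b - b / a by rewrite mulrBl !mul1r [b / a]mulrC.
  by rewrite tot ler_pdivlMr // E lerD2l lerN2 ler_pdivlMr.
have q2 : 0 < 2 ^+ q :> R by rewrite exprn_gt0.
have WE : (W ^ L.+1)%:R * #|G|%:R ^+ c <= 2 ^+ q :> R.
  have qE : q = ((3 * u + 1) * L.+1 + c * u)%N by exact: addnC.
  rewrite -!natrX -natrM ler_nat qE expnD expnM -/W leq_mul2l; apply/orP; right.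
  by rewrite mulnC expnM; case: (c) => [|c']; [rewrite !expn0 | rewrite leq_exp2r].
rewrite -(ler_pM2l q2).
have h1 : 2 ^+ q * #|bad|%:R <= #|{: outcome}|%:R * (W ^ L.+1)%:R :> R.
  by apply: le_trans _ tb; rewrite ler_wpM2l // ltW.
have h2 : 2 ^+ q * #|bad|%:R * #|G|%:R ^+ c <= #|{: outcome}|%:R *
  (W ^ L.+1)%:R * #|G|%:R ^+ c :> R.
  by rewrite ler_wpM2r // ltW.
have h3 : #|{: outcome}|%:R * ((W ^ L.+1)%:R * #|G|%:R ^+ c) <=
  #|{: outcome}|%:R * 2 ^+ q :> R.
  by rewrite ler_wpM2l // ltW.
by rewrite [leLHS]mulrA; apply: le_trans h2 _; rewrite -mulrA [leRHS]mulrC.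
Qed.
End Probability.

Local Open Scope ring_scope.

Theorem theorem3 (R : realType) :
  exists A : local_alg,
    [/\ polynomial_local_computation A,
        exists C : R,
          forall (G : sgraph) (id : G -> seq bool),
            connected_graph G -> injective id ->
            forall w : coins G, exists t : nat,
              [/\ terminated A id t w,
                  two_spanner (output A id w t) &
                  #|output A id w t|%:R <=
                    C * Num.max 1 (ln (#|edges G|%:R / #|G|%:R))
                      * (min_two_spanner G)%:R]
      & forall c : nat, (0 < c)%N ->
        exists K : R,
          forall (G : sgraph) (id : G -> seq bool),
            connected_graph G -> injective id ->
            exists (T : nat) (p : R),
              [/\ T%:R <=
                    K * Num.max 1 (ln #|G|%:R * ln (max_degree G)%:R),
                  has_probability (terminated A id T) p &
                  1 - 1 / #|G|%:R ^+ c <= p]].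
Proof.
exists spanner_alg; split; first exact: spanner_alg_polynomial.
- exists 400 => G id conn id_inj w.
  have U0 := @uncovered_final G id id_inj w.
  (* A time that suits all outcomes, since every phase covers a pair; the logarithmic bound is only
     probabilistic. *)
  exists (phase_time (#|G| ^ 2).+1).+1; split.
  + exact: terminated_uncovered.
  + exact: output_spanner.
  + exact: spanner_ratio.
- move=> c _; exists (2000 + 600 * c%:R) => G id conn id_inj.
  exists (phase_time (phase_count c #|G| (max_degree G))).+1.
  eexists; split; [exact: phase_count_bound | |
    exact: (termination_probability R id_inj conn c)].
  eexists; last by reflexivity.
  by move=> w w'; exact: terminated_agree.
Qed.
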